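(* Let $f=\sum_{|\alpha|\ge1}a_\alpha X_\alpha$ be a positive regular free holomorphic function and $m\ge1$. Let $\mathcal P$ be a family of noncommutative polynomials with $\mathcal N_{\mathcal P}\ne\{0\}$ and let $B=(B_1,\dots,B_n)$ be the universal model associated with the noncommutative variety $\mathcal V^m_{f,\mathcal P}$. Let $A=(A_1,\dots,A_n)\in B(\mathcal H)^n$ be such that $\sum_{|\alpha|\ge1}a_\alpha A_\alpha A_\alpha^*$ is SOT-convergent and $p(A_1,\dots,A_n)=0$ for all $p\in\mathcal P$. Let $\mathcal S^{w^*}_{f,\mathcal P}$ be the $w^*$-closed linear span of $\{B_\alpha B_\beta^*:\alpha,\beta\in\mathbb F_n^+\}$ and let $CP^{w^*}(A,\mathcal V^m_{f,\mathcal P})$ be the set of all $w^*$-continuous completely positive linear maps $\varphi:\mathcal S^{w^*}_{f,\mathcal P}\to B(\mathcal H)$ such that $$\varphi(B_\alpha B_\beta^* )=A_\alpha\varphi(I)A_\beta^*,\qquad\alpha,\beta\in\mathbb F_n^+.$$ Then the map $$\Gamma:CP^{w^*}(A,\mathcal V^m_{f,\mathcal P})\to C_{pure}(f,A)^+,\qquad\Gamma(\varphi):=\varphi(I),$$ is a bijection. In addition, if $D\in C_{pure}(f,A)^+$, then $\Gamma^{-1}(D)$ coincides with the noncommutative Berezin transform $$\mathbf B_q[\chi]:=K_q^*(\chi\otimes I)K_q,\qquad\chi\in\mathcal S^{w^*}_{f,\mathcal P},$$ associated with $q:=(f,m,A,R,\mathcal P)$, where $R:=(id-\Phi_{f,A})^m(D)$.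 Moreover, an operator $D\in B(\mathcal H)$ is in $C_{pure}(f,A)^+$ if and only if there is a Hilbert space $\mathcal D$ and an operator $K:\mathcal H\to\mathcal N_{\mathcal P}\otimes\mathcal D$ such that $$D=K^*K\quad\text{and}\quad KA_i^*=(B_i^*\otimes I_{\mathcal D})K,\qquad i=1,\dots,n.$$
   Context: Let $n\in\mathbb N=\{1,2,\dots\}$. $\mathbb F_n^+$ is the unital free semigroup on generators $g_1,\dots,g_n$ with identity $g_0$; $|\alpha|$ is the word length ($|g_0|=0$). For $X=(X_1,\dots,X_n)\in B(\mathcal H)^n$ ($\mathcal H$ a complex Hilbert space) put $X_\alpha=X_{i_1}\cdots X_{i_k}$ if $\alpha=g_{i_1}\cdots g_{i_k}$ and $X_{g_0}=I$. Operators between Hilbert spaces are bounded and linear. A positive regular free holomorphic function is a formal series $f=\sum_{\alpha\in\mathbb F_n^+}a_\alpha X_\alpha$ in noncommuting variables with $\limsup_{k\to\infty}(\sum_{|\alpha|=k}|a_\alpha|^2)^{1/2k}<\infty$, $a_\alpha\ge 0$ for all $\alpha$, $a_{g_0}=0$, and $a_{g_i}>0$ for $i=1,\dots,n$. Whenever $\sum_{|\alpha|\ge1}a_\alpha X_\alpha X_\alpha^*$ converges in the weak operator topology (WOT), $\Phi_{f,X}(Y)=\sum_{|\alpha|\ge1}a_\alpha X_\alpha YX_\alpha^*$ for $Y\in B(\mathcal H)$ (WOT convergence). $id$ is the identity map on $B(\mathcal H)$. $\mathbf D_f^m(\mathcal H)$ is the set of $X\in B(\mathcal H)^n$ (with the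 series above WOT convergent) such that $(id-\Phi_{f,X})^s(I)\ge 0$ for $s=1,\dots,m$, and $\mathcal V^m_{f,\mathcal P}(\mathcal H)=\{X\in\mathbf D_f^m(\mathcal H): p(X_1,\dots,X_n)=0\ \forall p\in\mathcal P\}$. Universal model: $F^2(H_n)=\bigoplus_{k\ge0}(\mathbb C^n)^{\otimes k}$ is the full Fock space with orthonormal basis $\{e_\alpha\}_{\alpha\in\mathbb F_n^+}$ ($e_{g_0}=1$). Put $b^{(m)}_{g_0}=1$ and, for $|\alpha|\ge1$, $b^{(m)}_\alpha=\sum_{j=1}^{|\alpha|}\sum_{\gamma_1\cdots\gamma_j=\alpha,\ |\gamma_i|\ge1}a_{\gamma_1}\cdots a_{\gamma_j}\binom{j+m-1}{m-1}$. The weighted left creation operators are $W_ie_\alpha=\sqrt{b^{(m)}_\alpha/b^{(m)}_{g_i\alpha}}\,e_{g_i\alpha}$. Let $\mathcal M_{\mathcal P}=\overline{\mathrm{span}}\{W_\alpha p(W_1,\dots,W_n)W_\beta(1):p\in\mathcal P,\alpha,\beta\in\mathbb F_n^+\}$, $\mathcal N_{\mathcal P}=F^2(H_n)\ominus\mathcal M_{\mathcal P}$, and $B_i=P_{\mathcal N_{\mathcal P}}W_i|_{\mathcal N_{\mathcal P}}$; $B=(B_1,\dots,B_n)$ is the universal model of $\mathcal V^m_{f,\mathcal P}$. $C_{pure}(f,A)^+$ is the set of all $D\in B(\mathcal H)$ such that $(id-\Phi_{f,A})^s(D)\ge0$ for $s=1,\dots,m$ and $\Phi_{f,A}^k(D)\to0$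 strongly as $k\to\infty$ (such $D$ is automatically positive). Berezin kernel: let $R\in B(\mathcal H)$ be positive with $\sum_{k\ge0}\binom{k+m-1}{m-1}\Phi_{f,A}^k(R)\le bI$ for some $b>0$ (this holds for $R=(id-\Phi_{f,A})^m(D)$ with $D\in C_{pure}(f,A)^+$). Then $K^{(m)}_{f,A,R}:\mathcal H\to F^2(H_n)\otimes\overline{R^{1/2}(\mathcal H)}$ is the bounded operator $K^{(m)}_{f,A,R}h=\sum_{\alpha}\sqrt{b^{(m)}_\alpha}\,e_\alpha\otimes R^{1/2}A_\alpha^*h$, and $K_q=(P_{\mathcal N_{\mathcal P}}\otimes I)K^{(m)}_{f,A,R}:\mathcal H\to\mathcal N_{\mathcal P}\otimes\overline{R^{1/2}(\mathcal H)}$. *)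

(* Defs.v *)
From HB Require Import structures.
From mathcomp Require Import all_boot all_order all_algebra complex finmap.
From mathcomp Require Import ring.
From mathcomp Require Import all_classical all_reals all_analysis.

Set Implicit Arguments.
Unset Strict Implicit.
Unset Printing Implicit Defensive.

Import Order.TTheory GRing.Theory Num.Theory.
Import numFieldNormedType.Exports.

Local Open Scope classical_set_scope.
Local Open Scope complex_scope.
Local Open Scope ring_scope.

(* The library only puts a topology on R[i]^o; transporting it to R[i] lets limits
   of complex sequences be stated without casts. Norms of normed modules over
   R[i], and of their elements, are nonnegative reals of R[i]. *)
HB.instance Definition _ (R : realType) := NormedModule.copy R[i] R[i]^o.

Section ComplexComplete.
Variable R : realType.
Implicit Types z : R[i].

Lemma ler_re z : `|complex.Re z|%:C <= `|z|. Proof. exact: normc_ge_Re. Qed.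

Lemma ler_im z : `|complex.Im z|%:C <= `|z|.
Proof.
case: z => a b; rewrite normc_def /= lecR.
by rewrite -sqrtr_sqr ler_wsqrtr // lerDr sqr_ge0.
Qed.

Lemma ler_reim z : `|z| <= (`|complex.Re z| + `|complex.Im z|)%:C.
Proof.
rewrite [X in `|X|]complexE (le_trans (ler_normD _ _)) //.
rewrite normrM -[X in _ + _ * X]/(`|_%:C|) !normc_def /= !expr0n /= !addr0.
by rewrite !add0r expr1n sqrtr1 mul1r !sqrtr_sqr rmorphD.
Qed.

Lemma complex_complete (F : set_system R[i]) :
  ProperFilter F -> cauchy F -> cvg F.
Proof.
move=> FF /cauchyP Fc.
have cvgproj (g : {additive R[i] -> R}) :
    (forall z, `|g z|%:C <= `|z|) -> cvg (g @ F).
  move=> gle; apply: cauchy_cvg; apply/cauchyP => e e0.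
  have [|x Fx] := Fc e%:C; first by rewrite ltcR.
  exists (g x); rewrite /fmap/=; apply: filterS Fx => y; rewrite -!ball_normE /=.
  by move=> xy; rewrite -raddfB -ltcR (le_lt_trans (gle _)).
have [a Fa] := (iffLR (cvg_ex _)) (cvgproj (@complex.Re R) ler_re).
have [b Fb] := (iffLR (cvg_ex _)) (cvgproj (@complex.Im R) ler_im).
apply/cvg_ex; exists (a +i* b)%C.
apply/(@cvgrPdist_lt _ R[i]) => e e0.
have er : e = (complex.Re e)%:C by rewrite RRe_real // gtr0_real.
have e0' : 0 < complex.Re e / 2 by rewrite divr_gt0 // -ltcR -er.
near=> z; rewrite er (le_lt_trans (ler_reim _)) // ltcR (splitr (complex.Re e)).
rewrite !raddfB /= ltrD //.
- by near: z; apply: (@cvgr_dist_lt _ R^o _ _ _ (fun z => complex.Re z) a).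
- by near: z; apply: (@cvgr_dist_lt _ R^o _ _ _ (fun z => complex.Im z) b).
Unshelve. all: by end_near. Qed.

End ComplexComplete.

HB.instance Definition _ (R : realType) :=
  Uniform_isComplete.Build R[i] (@complex_complete R).

(* Inner products are linear in the first argument. *)
HB.mixin Record NormedModule_hasDot (R : realType) H
    & NormedModule R[i] H := {
  hdot : H -> H -> R[i];
  hdot_linearl : forall (c : R[i]) (x y z : H),
    hdot (c *: x + y) z = c * hdot x z + hdot y z;
  hdotC : forall x y : H, hdot x y = (hdot y x)^*;
  hdot_norm : forall x : H, hdot x x = `|x| ^+ 2 }.

#[short(type="preHilbertType")]
HB.structure Definition PreHilbert (R : realType) :=
  {H of NormedModule R[i] H & NormedModule_hasDot R H}.

#[short(type="hilbertType")]
HB.structure Definition Hilbert (R : realType) :=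
  {H of CompleteNormedModule R[i] H & NormedModule_hasDot R H}.

HB.factory Record Lmodule_hasDot (R : realType) H & GRing.Lmodule R[i] H := {
  dot : H -> H -> R[i];
  dot_linearl : forall (c : R[i]) (x y z : H),
    dot (c *: x + y) z = c * dot x z + dot y z;
  dotC : forall x y : H, dot x y = (dot y x)^*;
  dot_ge0 : forall x : H, 0 <= dot x x;
  dot_eq0 : forall x : H, dot x x = 0 -> x = 0 }.

HB.builders Context R H & Lmodule_hasDot R H.

Let dotDl x y z : dot (x + y) z = dot x z + dot y z.
Proof. by have := dot_linearl 1 x y z; rewrite scale1r mul1r. Qed.

Let dot0l z : dot 0 z = 0.
Proof. by apply: (addrI (dot 0 z)); rewrite -dotDl !addr0. Qed.

Let dotZl c x z : dot (c *: x) z = c * dot x z.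
Proof. by have := dot_linearl c x 0 z; rewrite dot0l !addr0. Qed.

Let dotDr x y z : dot z (x + y) = dot z x + dot z y.
Proof. by rewrite dotC dotDl rmorphD /= -!dotC. Qed.

Let dotZr c x z : dot z (c *: x) = c^* * dot z x.
Proof. by rewrite dotC dotZl rmorphM /= -dotC. Qed.

Let cauchy_schwarz x y : `|dot x y| ^+ 2 <= dot x x * dot y y.
Proof.
have [->|y0] := eqVneq y 0.
  by rewrite dotC dot0l conjC0 normr0 expr0n mulr_ge0 ?dot_ge0.
have yy0 : 0 < dot y y.
  rewrite lt_neqAle dot_ge0 andbT eq_sym; apply: contraNneq y0.
  by move=> /dot_eq0 ->.
have yyr : (dot y y)^* = dot y y by rewrite -dotC.
have := dot_ge0 (dot y y *: x + (- dot x y) *: y).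
rewrite dotDl !dotZl !dotDr !dotZr yyr rmorphN /= (dotC y x).
rewrite (_ : _ + _ = dot y y * (dot x x * dot y y - dot x y * (dot x y)^*)).
  by rewrite pmulr_rge0 // subr_ge0 normCK.
by ring.
Qed.

Let norm (x : H) := sqrtC (dot x x).

Let ler_normD x y : norm (x + y) <= norm x + norm y.
Proof.
have nge0 z : 0 <= norm z by rewrite sqrtC_ge0 dot_ge0.
rewrite -(@ler_pXn2r _ 2) ?nnegrE ?addr_ge0 // sqrrD !sqrtCK dotDl !dotDr.
rewrite addrA [leRHS]addrAC -!addrA lerD2l [leRHS]addrC addrA lerD2r (dotC y x).
rewrite (_ : dot x y + _ = 'Re (dot x y) *+ 2); last first.
  by rewrite ReE -[RHS]mulr_natr divfK // pnatr_eq0.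
rewrite lerMn2r /= (le_trans (leif_Re_Creal _)) //.
rewrite -(@ler_pXn2r _ 2) ?nnegrE ?mulr_ge0 //.
by rewrite exprMn !sqrtCK.
Qed.

Let normrZ (c : R[i]) x : norm (c *: x) = `|c| * norm x.
Proof.
rewrite /norm dotZl dotZr mulrA -normCK sqrtCM ?nnegrE ?dot_ge0 ?exprn_ge0 //.
by rewrite sqrCK.
Qed.

Let normr0_eq0 x : norm x = 0 -> x = 0.
Proof. by move/eqP; rewrite sqrtC_eq0 => /eqP/dot_eq0. Qed.

HB.instance Definition _ :=
  Lmodule_isNormed.Build R[i] H ler_normD normrZ normr0_eq0.

Let dot_norm x : dot x x = `|x| ^+ 2.
Proof. by rewrite sqrtCK. Qed.

HB.instance Definition _ :=
  NormedModule_hasDot.Build R H dot_linearl dotC dot_norm.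

HB.end.


Section Dot.
Variables (R : realType) (H : preHilbertType R).
Implicit Types (x y z : H) (c : R[i]).

Lemma hdotDl x y z : hdot (x + y) z = hdot x z + hdot y z.
Proof. by have := hdot_linearl 1 x y z; rewrite scale1r mul1r. Qed.

Lemma hdot0l z : hdot 0 z = 0.
Proof. by apply: (addrI (hdot 0 z)); rewrite -hdotDl !addr0. Qed.

Lemma hdotZl c x z : hdot (c *: x) z = c * hdot x z.
Proof. by have := hdot_linearl c x 0 z; rewrite hdot0l !addr0. Qed.

Lemma hdotNl x z : hdot (- x) z = - hdot x z.
Proof. by rewrite -scaleN1r hdotZl mulN1r. Qed.

Lemma hdotBl x y z : hdot (x - y) z = hdot x z - hdot y z.
Proof. by rewrite hdotDl hdotNl. Qed.

Lemma hdotDr x y z : hdot z (x + y) = hdot z x + hdot z y.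
Proof. by rewrite hdotC hdotDl rmorphD /= -!hdotC. Qed.

Lemma hdotZr c x z : hdot z (c *: x) = c^* * hdot z x.
Proof. by rewrite hdotC hdotZl rmorphM /= -hdotC. Qed.

Lemma hdotNr x z : hdot z (- x) = - hdot z x.
Proof. by rewrite hdotC hdotNl rmorphN /= -hdotC. Qed.

Lemma hdotBr x y z : hdot z (x - y) = hdot z x - hdot z y.
Proof. by rewrite hdotDr hdotNr. Qed.

Lemma hdot_ge0 x : 0 <= hdot x x.
Proof. by rewrite hdot_norm exprn_ge0. Qed.

Lemma hdot_eq0 x : hdot x x = 0 -> x = 0.
Proof. by rewrite hdot_norm => /eqP; rewrite expf_eq0 /= normr_eq0 => /eqP. Qed.

Lemma hdot_le x y : `|hdot x y| <= `|x| * `|y|.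
Proof.
have [->|y0] := eqVneq y 0; first by rewrite hdotC hdot0l conjC0 normr0 mulr_ge0.
have yy0 : 0 < hdot y y by rewrite hdot_norm exprn_gt0 // normr_gt0.
have yyr : (hdot y y)^* = hdot y y by rewrite -hdotC.
rewrite -(@ler_pXn2r _ 2) ?nnegrE ?mulr_ge0 // exprMn -!hdot_norm.
have := hdot_ge0 (hdot y y *: x + (- hdot x y) *: y).
rewrite hdotDl !hdotZl !hdotDr !hdotZr yyr rmorphN /= (hdotC y x).
rewrite (_ : _ + _ = hdot y y * (hdot x x * hdot y y - hdot x y * (hdot x y)^*)).
  by rewrite pmulr_rge0 // subr_ge0 normCK.
by ring.
Qed.

Lemma hdot_continuousl y : continuous (hdot ^~ y).
Proof.
move=> x; apply/cvgrPdist_le => e e0.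
have d0 : 0 < e / (`|y| + 1) by rewrite divr_gt0 // ltr_wpDl.
near=> z; rewrite -hdotBl (le_trans (hdot_le _ _)) //.
have : `|x - z| <= e / (`|y| + 1).
  by near: z; apply: (@cvgr_dist_le _ H _ _ _ id x).
move/(ler_wpM2r (normr_ge0 y))/le_trans; apply.
rewrite -mulrA ler_piMr ?(ltW e0) // mulrC ler_pdivrMr ?ltr_wpDl //.
by rewrite mul1r lerDl.
Unshelve. all: by end_near. Qed.

End Dot.

Section ComplexHilbert.
Variable R : realType.

Let cdot (x y : R[i]) : R[i] := x * y^*.

Let cdot_linearl (c x y z : R[i]) : cdot (c *: x + y) z = c * cdot x z + cdot y z.
Proof. by rewrite /cdot mulrDl mulrA. Qed.

Let cdotC (x y : R[i]) : cdot x y = (cdot y x)^*.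
Proof. by rewrite /cdot rmorphM /= conjCK mulrC. Qed.

Let cdot_norm (x : R[i]) : cdot x x = `|x| ^+ 2.
Proof. by rewrite normCK. Qed.

HB.instance Definition _ :=
  NormedModule_hasDot.Build R R[i] cdot_linearl cdotC cdot_norm.

End ComplexHilbert.

Section ClosedSubspace.
Variables (R : realType) (H : hilbertType R).

(* Closed subspaces are Hilbert spaces in their own right: as a type, [V] is the
   subtype of the ambient space carried by [cset V]. *)
Record csubspace := CSubspace {
  cset : set H;
  cset0 : cset 0;
  csetP : forall (c : R[i]) x y, cset x -> cset y -> cset (c *: x + y);
  cset_closed : closed cset }.

Record csub_sort (V : csubspace) :=
  CSub { csub_val : H; csub_valP : csub_val \in cset V }.

HB.instance Definition _ (V : csubspace) := [isSub for @csub_val V].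
HB.instance Definition _ (V : csubspace) := [Choice of csub_sort V by <:].

Lemma csub_submod (V : csubspace) : submod_closed [in cset V].
Proof.
split; first by apply/mem_set/cset0.
by move=> c x y /set_mem Vx /set_mem Vy; apply/mem_set/csetP.
Qed.

HB.instance Definition _ (V : csubspace) :=
  GRing.SubChoice_isSubLmodule.Build R[i] H [in cset V] (csub_sort V)
    (csub_submod V).

Section Instances.
Variable V : csubspace.
Let sdot (x y : csub_sort V) := hdot (val x) (val y).

Let sdot_linearl c x y z : sdot (c *: x + y) z = c * sdot x z + sdot y z.
Proof. by rewrite /sdot linearP hdot_linearl. Qed.

Let sdotC x y : sdot x y = (sdot y x)^*.
Proof. exact: hdotC. Qed.

Let sdot_ge0 x : 0 <= sdot x x.
Proof. exact: hdot_ge0. Qed.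

Let sdot_eq0 x : sdot x x = 0 -> x = 0.
Proof. by move=> /hdot_eq0 x0; apply: val_inj. Qed.

HB.instance Definition _ := Lmodule_hasDot.Build R (csub_sort V)
  sdot_linearl sdotC sdot_ge0 sdot_eq0.

Lemma csub_norm (x : csub_sort V) : `|x| = `|val x|.
Proof.
apply/eqP; rewrite -(@eqrXn2 _ 2) //; apply/eqP.
by rewrite -(hdot_norm x) -hdot_norm.
Qed.

Lemma csub_complete (F : set_system (csub_sort V)) :
  ProperFilter F -> cauchy F -> cvg F.
Proof.
move=> FF /cauchyP Fc.
have /cvg_ex[l Fl] : cvg (val @ F).
  apply: cauchy_cvg; apply/cauchyP => e e0; have [x Fx] := Fc e e0.
  exists (val x); rewrite /fmap /=; apply: filterS Fx => y.
  by rewrite -!ball_normE /= csub_norm raddfB.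
have Vl : cset V l.
  apply: (@closed_cvg _ _ F FF val (cset V) (@cset_closed V) _ l Fl).
  by apply: nearW => x; apply/set_mem/csub_valP.
apply/cvg_ex; exists (CSub (mem_set Vl)); apply/cvgrPdist_lt => e e0.
near=> x; rewrite csub_norm raddfB /=.
by near: x; apply: (@cvgr_dist_lt _ _ _ _ _ val l).
Unshelve. all: by end_near. Qed.

HB.instance Definition _ := Uniform_isComplete.Build (csub_sort V) csub_complete.

End Instances.
End ClosedSubspace.
Coercion csub_sort : csubspace >-> Sortclass.


Section Spans.
Variable R : realType.

Definition lspan (V : lmodType R[i]) (S : set V) : set V :=
  [set v | exists (k : nat) (c : 'I_k -> R[i]) (s : 'I_k -> V),
     (forall i, S (s i)) /\ v = \sum_i c i *: s i].

Lemma lspan0 (V : lmodType R[i]) (S : set V) : lspan S 0.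
Proof.
exists 0%N, (fun=> 0), (fun=> 0); split=> [[]//|]; by rewrite big_ord0.
Qed.

Lemma sub_lspan (V : lmodType R[i]) (S : set V) : S `<=` lspan S.
Proof.
move=> x Sx; exists 1%N, (fun=> 1), (fun=> x); split=> //.
by rewrite big_ord1 scale1r.
Qed.

Lemma lspanP (V : lmodType R[i]) (S : set V) (c : R[i]) x y :
  lspan S x -> lspan S y -> lspan S (c *: x + y).
Proof.
move=> [k [a [s [Ss ->]]]] [l [b [t [St ->]]]].
exists (k + l)%N.
exists (fun i : 'I_(k + l) => match fintype.split i with inl i => c * a i | inr i => b i end).
exists (fun i : 'I_(k + l) => match fintype.split i with inl i => s i | inr i => t i end).
split=> [i|]; first by case: (fintype.split i).
rewrite big_split_ord scaler_sumr /=; congr (_ + _); apply: eq_bigr => i _.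
  by rewrite (unsplitK (inl i)) scalerA.
by rewrite (unsplitK (inr i)).
Qed.

Variable H : hilbertType R.
Implicit Types S : set H.

Lemma closure_normP S (x : H) :
  closure S x <-> forall e : R[i], 0 < e -> exists2 s, S s & `|x - s| < e.
Proof.
split=> [Sx e e0|Sx B].
  have [s [Ss]] := Sx _ (nbhsx_ballx x e e0).
  by rewrite -ball_normE /=; exists s.
move=> /nbhs_ballP[e /= e0 xeB]; have [s Ss xs] := Sx e e0.
by exists s; split=> //; apply: xeB; rewrite -ball_normE.
Qed.

Lemma closure_linear S (c : R[i]) :
    (forall x y, S x -> S y -> S (c *: x + y)) ->
  forall x y, closure S x -> closure S y -> closure S (c *: x + y).
Proof.
move=> Slin x y /closure_normP Sx /closure_normP Sy; apply/closure_normP => e e0.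
have c0 : 0 < `|c| + 1 by rewrite ltr_wpDl.
have [|s Ss xs] := Sx (e / 2 / (`|c| + 1)); first by rewrite !divr_gt0.
have [|t St yt] := Sy (e / 2); first by rewrite divr_gt0.
exists (c *: s + t); first exact: Slin.
rewrite opprD addrACA -scalerBr (le_lt_trans (ler_normD _ _)) //.
rewrite [ltRHS]splitr ler_ltD // normrZ.
rewrite (le_trans (ler_wpM2l (normr_ge0 c) (ltW xs))) // mulrA.
by rewrite ler_pdivrMr // [leLHS]mulrC ler_pM2l ?divr_gt0 // lerDl.
Qed.

Definition clspan S : csubspace H :=
  @CSubspace R H (closure (lspan S)) (subset_closure (lspan0 S))
    (fun c => closure_linear (lspanP c)) (@closed_closure _ _).

Lemma orthc_linear S (c : R[i]) (x y : H) :
  [set x | forall y, S y -> hdot x y = 0] x ->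
  [set x | forall y, S y -> hdot x y = 0] y ->
  [set x | forall y, S y -> hdot x y = 0] (c *: x + y).
Proof. by move=> /= xS yS z Sz; rewrite hdotDl hdotZl xS // yS // mulr0 addr0. Qed.

Lemma orthc_closed S : closed [set x : H | forall y, S y -> hdot x y = 0].
Proof.
rewrite (_ : mkset _ = \bigcap_(y in S) (hdot ^~ y) @^-1` [set 0]).
  apply: closed_bigI => y _; apply: closed_comp => [x _|].
    exact: hdot_continuousl.
  exact: (@accessible_closed_set1 _ (hausdorff_accessible (@norm_hausdorff _ R[i]))).
by apply/seteqP; split.
Qed.

Definition orthc S : csubspace H :=
  @CSubspace R H [set x | forall y, S y -> hdot x y = 0]
    (fun y _ => hdot0l y) (@orthc_linear S) (@orthc_closed S).

End Spans.

Section BoundedOperators.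
Variables (R : realType) (H K : hilbertType R).

Definition is_bop : {pred H -> K} := fun f => `[< linear f /\ continuous f >].

Record bop := Bop { bop_fun :> H -> K; bopP : bop_fun \in is_bop }.

HB.instance Definition _ := [isSub for bop_fun].
HB.instance Definition _ := [Choice of bop by <:].

Lemma bop_submod : submod_closed is_bop.
Proof.
split.
  apply/asboolP; split=> [c x y|x]; first by rewrite /= scaler0 addr0.
  exact: cvg_cst.
move=> c f g /asboolP[fl fc] /asboolP[gl gc]; apply/asboolP; split.
  move=> a x y; rewrite -![(c *: f + g) _]/(c *: f _ + g _) fl gl.
  by rewrite !scalerDr !scalerA mulrC addrACA.
move=> x; apply: (@cvgD _ K _ _ _ (fun y => c *: f y) g); last exact: gc.
by apply: (@cvgZr _ K); exact: fc.
Qed.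

HB.instance Definition _ :=
  GRing.SubChoice_isSubLmodule.Build R[i] (H -> K) is_bop bop bop_submod.

Lemma bop_linear (T : bop) : linear T.
Proof. by have /asboolP[] := bopP T. Qed.

Lemma bop_continuous (T : bop) : continuous T.
Proof. by have /asboolP[] := bopP T. Qed.

Definition mkbop (f : H -> K) (fl : linear f) (fc : continuous f) : bop :=
  @Bop f (asboolT (conj fl fc)).

Lemma bop_ext (S T : bop) : S =1 T -> S = T.
Proof. by move=> ST; apply: val_inj; apply/funext. Qed.

End BoundedOperators.

Definition bid (R : realType) (H : hilbertType R) : bop H H :=
  @mkbop R H H id (fun _ _ _ => erefl) (fun _ => cvg_id).

Definition bcomp_subproof (R : realType) (H K L : hilbertType R)
    (S : bop K L) (T : bop H K) : linear (S \o T).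
Proof. by move=> c x y /=; rewrite !bop_linear. Qed.

Definition bcomp (R : realType) (H K L : hilbertType R)
    (S : bop K L) (T : bop H K) : bop H L :=
  mkbop (bcomp_subproof S T)
    (fun x => continuous_comp (@bop_continuous _ _ _ T x)
                              (@bop_continuous _ _ _ S (T x))).

Lemma val_bop_continuous (R : realType) (H : hilbertType R) (V : csubspace H) :
  continuous (val : V -> H).
Proof.
move=> x; apply/(@cvgrPdist_lt _ H _ _ (nbhs_filter x)) => e e0; apply/nbhs_ballP; exists e => //= y.
by rewrite -ball_normE /= csub_norm raddfB.
Qed.

Definition binc (R : realType) (H : hilbertType R) (V : csubspace H) : bop V H :=
  mkbop (linearP (val : V -> H)) (@val_bop_continuous R H V).



Section ComplexLimits.
Variables (R : realType) (T : Type) (F : set_system T).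
Context {FF : ProperFilter F}.
Implicit Types (u : T -> R[i]) (l z : R[i]).

Lemma cvgC_ge u l z : (\forall k \near F, z <= u k) -> u @ F --> l -> z <= l.
Proof.
move=> zu ul; have uzl : u k - z @[k --> F] --> l - z.
  exact: (cvgB ul (cvg_cst _)).
suff -> : l = z + `|l - z| by rewrite lerDl.
rewrite -[LHS](subrK z) addrC; congr (_ + _).
apply: (@cvg_unique _ (@norm_hausdorff _ R[i]) _ _ _ _ uzl).
apply: cvg_trans (cvg_norm uzl); apply: near_eq_cvg.
by apply: filterS zu => k zu; rewrite ger0_norm ?subr_ge0.
Qed.

Lemma cvgC_le u l z : (\forall k \near F, u k <= z) -> u @ F --> l -> l <= z.
Proof.
move=> uz ul; rewrite -lerN2; apply: (@cvgC_ge (fun k => - u k)).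
  by apply: filterS uz => k; rewrite lerN2.
exact: cvgN.
Qed.

Lemma cvg_conj u l : u @ F --> l -> (u k)^* @[k --> F] --> l^*.
Proof.
move=> /cvgrPdist_lt ul; apply/cvgrPdist_lt => e e0.
by apply: filterS (ul e e0) => k; rewrite -rmorphB /= norm_conjC.
Qed.

End ComplexLimits.

Section LengthSums.
Variable n : nat.

Definition lsum (V : nmodType) (F : seq 'I_n -> V) (N : nat) : V :=
  \sum_(k < N) \sum_(s : k.-tuple 'I_n) F s.

Lemma lsumD (V : nmodType) (F G : seq 'I_n -> V) N :
  lsum (fun s => F s + G s) N = lsum F N + lsum G N.
Proof. by rewrite /lsum -big_split; apply: eq_bigr => k _; rewrite -big_split. Qed.

Variable R : realType.
Implicit Types (F G : seq 'I_n -> R[i]).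

Lemma lsumZ (c : R[i]) F N : lsum (fun s => c * F s) N = c * lsum F N.
Proof. by rewrite /lsum mulr_sumr; apply: eq_bigr => k _; rewrite mulr_sumr. Qed.

Lemma lsum_conj F N : lsum (fun s => (F s)^*) N = (lsum F N)^*.
Proof. by rewrite /lsum rmorph_sum; apply: eq_bigr => k _; rewrite rmorph_sum. Qed.

Lemma ler_lsum F G N : (forall s, F s <= G s) -> lsum F N <= lsum G N.
Proof. by move=> FG; apply: ler_sum => k _; apply: ler_sum. Qed.

Lemma lsumS (V : nmodType) (F : seq 'I_n -> V) N :
  lsum F N.+1 = lsum F N + \sum_(s : N.-tuple 'I_n) F s.
Proof. by rewrite /lsum big_ord_recr. Qed.

Lemma ler_lsum_dist F G : (forall s, `|F s| <= G s) -> forall N M, (N <= M)%N ->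
  `|lsum F M - lsum F N| <= lsum G M - lsum G N.
Proof.
move=> FG N M /subnKC <-; elim: (M - N)%N => [|k IH].
  by rewrite addn0 !subrr normr0.
rewrite addnS !lsumS addrAC [leRHS]addrAC (le_trans (ler_normD _ _)) // lerD //.
by rewrite (le_trans (ler_norm_sum _ _ _)) // ler_sum.
Qed.

Lemma lsum_homo F : (forall s, 0 <= F s) -> {homo lsum F : N M / (N <= M)%N >-> N <= M}.
Proof.
move=> F0 N M NM; rewrite -subr_ge0.
apply: (le_trans (normr_ge0 (lsum F M - lsum F N))).
by apply: ler_lsum_dist NM => s; rewrite ger0_norm.
Qed.

Lemma ler_lsum_term F s : (forall s, 0 <= F s) -> F s <= lsum F (size s).+1.
Proof.
move=> F0; rewrite lsumS (bigD1 (in_tuple s)) //= addrCA lerDl addr_ge0 //.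
  by apply: sumr_ge0 => k _; apply: sumr_ge0.
exact: sumr_ge0.
Qed.

Lemma lsum_cvg F G (M : R[i]) : (forall s, `|F s| <= G s) ->
  (forall N, lsum G N <= M) -> cvgn (lsum F).
Proof.
move=> FG GM; have G0 s : 0 <= G s by exact: le_trans (FG s).
have GR N : lsum G N = (complex.Re (lsum G N))%:C.
  rewrite RRe_real // ger0_real //.
  by apply: sumr_ge0 => k _; apply: sumr_ge0.
have /cvg_cauchy/cauchyP Gc : cvgn (fun N => complex.Re (lsum G N)).
  apply: nondecreasing_is_cvgn.
    by move=> N N' NN'; rewrite -lecR -!GR lsum_homo.
  exists (complex.Re M) => _ [N _ <-].
  by have := GM N; rewrite lecE => /andP[].
apply: cauchy_cvg; apply/cauchyP => e e0.
have er : e = (complex.Re e)%:C by rewrite RRe_real // gtr0_real.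
have [|x [N0 _ Nx]] := Gc (complex.Re e / 2).
  by rewrite divr_gt0 // -ltcR -er.
exists (lsum F N0); exists N0 => // N /= N0N.
rewrite -ball_normE /= distrC (le_lt_trans (ler_lsum_dist FG N0N)) // er.
rewrite (GR N) (GR N0) -rmorphB ltcR (le_lt_trans (ler_norm _)) // (splitr (complex.Re e)).
have := Nx N N0N; have := Nx N0 (leqnn _); rewrite -!ball_normE /= => x0 xN.
rewrite -(subrKA x) addrC (le_lt_trans (ler_normD _ _)) // ltrD //.
by rewrite distrC.
Qed.

End LengthSums.

Section FockSpace.
Variables (n : nat) (R : realType) (K : hilbertType R).
Implicit Types (s : seq 'I_n) (x y z : seq 'I_n -> K).

(* The Hilbert space tensor product of the full Fock space with K, presented
   through the decomposition into the sum over k of (C^n)^(tensor k) tensor K: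
   square-summable families of vectors of K indexed by words, the word s being
   the basis vector e_s. The Fock space itself is the case K = C. *)
Definition fock_pred : {pred seq 'I_n -> K} := fun x =>
  `[< exists M : R[i], forall N, lsum (fun s => `|x s| ^+ 2) N <= M >].

Record fock := Fock { fock_fun :> seq 'I_n -> K; fockP : fock_fun \in fock_pred }.

HB.instance Definition _ := [isSub for fock_fun].
HB.instance Definition _ := [Choice of fock by <:].

Lemma fock_submod : submod_closed fock_pred.
Proof.
split.
  apply/asboolP; exists 0 => N; rewrite /lsum big1 // => k _.
  by rewrite big1 // => s _; rewrite normr0 expr0n.
move=> c x y /asboolP[M xM] /asboolP[L yL]; apply/asboolP.
exists (`|c| ^+ 2 * M *+ 2 + L *+ 2) => N.
pose F s := (`|c| ^+ 2 * `|x s| ^+ 2 *+ 2) + (`|y s| ^+ 2 *+ 2).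
apply: (@le_trans _ _ (lsum F N)).
  apply: ler_lsum => s; rewrite -![(c *: x + y) _]/(c *: x s + y s) /F.
  rewrite -exprMn -normrZ -mulrnDl.
  apply: (@le_trans _ _ ((`|c *: x s| + `|y s|) ^+ 2)).
    by rewrite ler_pXn2r ?nnegrE ?addr_ge0 // ler_normD.
  rewrite sqrrD addrAC mulr2n lerD2l -subr_ge0.
  rewrite (_ : _ - _ = (`|c *: x s| - `|y s|) ^+ 2); last by ring.
  by rewrite -real_normK ?rpredB ?normr_real // exprn_ge0.
have lsum2 (G : seq 'I_n -> R[i]) : lsum (fun s => G s *+ 2) N = lsum G N *+ 2.
  by rewrite -mulr_natl -lsumZ; congr lsum; apply/funext => s; rewrite mulr_natl.
rewrite lsumD !lsum2 lsumZ lerD // lerMn2r /= ?yL //.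
by rewrite ler_wpM2l // exprn_ge0.
Qed.

HB.instance Definition _ :=
  GRing.SubChoice_isSubLmodule.Build R[i] (seq 'I_n -> K) fock_pred fock fock_submod.

Lemma fock_linE (c : R[i]) (x y : fock) s : (c *: x + y) s = c *: x s + y s.
Proof. by []. Qed.

Let fdot (x y : fock) : R[i] := limn (lsum (fun s => hdot (x s) (y s))).

Let fdot_cvg (x y : fock) :
  lsum (fun s => hdot (x s) (y s)) @ \oo --> fdot x y.
Proof.
have /asboolP[M xM] := fockP x; have /asboolP[L yL] := fockP y.
apply: (@lsum_cvg _ _ _ (fun s => `|x s| ^+ 2 + `|y s| ^+ 2) (M + L)).
  move=> s; rewrite (le_trans (hdot_le _ _)) //.
  have h : 0 <= `|x s| * `|y s| by rewrite mulr_ge0.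
  rewrite (le_trans (_ : _ <= (`|x s| * `|y s|) *+ 2)) // ?mulr2n ?lerDl //.
  rewrite -subr_ge0 (_ : _ - _ = (`|x s| - `|y s|) ^+ 2); last by ring.
  by rewrite -real_normK ?rpredB ?normr_real // exprn_ge0.
by move=> N; rewrite lsumD lerD.
Qed.

Let hd := @norm_hausdorff _ R[i].

Let fdot_linearl (c : R[i]) (x y z : fock) :
  fdot (c *: x + y) z = c * fdot x z + fdot y z.
Proof.
apply: (@cvg_unique _ hd _ _ _ _ (@fdot_cvg _ _)).
rewrite (_ : lsum _ = fun N => c * lsum (fun s => hdot (x s) (z s)) N
                           + lsum (fun s => hdot (y s) (z s)) N).
  apply: (@cvgD _ R[i]); last exact: fdot_cvg.
  by apply: (@cvgZr _ R[i]); exact: fdot_cvg.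
apply/funext => N; rewrite -lsumZ -lsumD.
by congr lsum; apply/funext => s; rewrite fock_linE hdot_linearl.
Qed.

Let fdotC (x y : fock) : fdot x y = (fdot y x)^*.
Proof.
apply: (@cvg_unique _ hd _ _ _ _ (@fdot_cvg _ _)).
rewrite (_ : lsum _ = fun N => (lsum (fun s => hdot (y s) (x s)) N)^*).
  apply: cvg_conj; exact: fdot_cvg.
apply/funext => N; rewrite -lsum_conj.
by congr lsum; apply/funext => s; rewrite hdotC.
Qed.

Let fdot_ge_lsum (x : fock) N : lsum (fun s => `|x s| ^+ 2) N <= fdot x x.
Proof.
apply: cvgC_ge (@fdot_cvg x x); exists N => // M NM.
rewrite (_ : (fun s => hdot (x s) (x s)) = fun s => `|x s| ^+ 2).
  by apply: lsum_homo NM => s; rewrite exprn_ge0.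
by apply/funext => s; rewrite hdot_norm.
Qed.

Let fdot_ge0 (x : fock) : 0 <= fdot x x.
Proof. by have := fdot_ge_lsum x 0; rewrite /lsum big_ord0. Qed.

Let fdot_term (x : fock) s : `|x s| ^+ 2 <= fdot x x.
Proof.
apply: le_trans (fdot_ge_lsum x (size s).+1).
by apply: (@ler_lsum_term _ _ (fun s => `|x s| ^+ 2)) => t; rewrite exprn_ge0.
Qed.

Let fdot_eq0 (x : fock) : fdot x x = 0 -> x = 0.
Proof.
move=> x0; apply: val_inj; apply/funext => s; apply/eqP.
suff : `|x s| ^+ 2 == 0 by rewrite expf_eq0 /= normr_eq0.
by rewrite eq_le exprn_ge0 // andbT -x0 fdot_term.
Qed.

HB.instance Definition _ := Lmodule_hasDot.Build R fock
  fdot_linearl fdotC fdot_ge0 fdot_eq0.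

Lemma fock_dot_cvg (x y : fock) :
  lsum (fun s => hdot (x s) (y s)) @ \oo --> hdot x y.
Proof. exact: fdot_cvg. Qed.

Lemma fock_norm_ge (x : fock) s : `|x s| <= `|x|.
Proof. by rewrite -(@ler_pXn2r _ 2) ?nnegrE // -(hdot_norm x) fdot_term. Qed.

Lemma fock_norm_le (x : fock) (M : R[i]) : 0 <= M ->
  (forall N, lsum (fun s => `|x s| ^+ 2) N <= M ^+ 2) -> `|x| <= M.
Proof.
move=> M0 xM; rewrite -(@ler_pXn2r _ 2) ?nnegrE // -(hdot_norm x).
apply: cvgC_le (@fdot_cvg x x); apply: nearW => N.
rewrite (_ : (fun s => hdot (x s) (x s)) = fun s => `|x s| ^+ 2) //.
by apply/funext => s; rewrite hdot_norm.
Qed.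

Lemma fock_lsum_le (x : fock) N : lsum (fun s => `|x s| ^+ 2) N <= `|x| ^+ 2.
Proof. by rewrite -(hdot_norm x) fdot_ge_lsum. Qed.

Lemma fock_complete (F : set_system fock) : ProperFilter F -> cauchy F -> cvg F.
Proof.
move=> FF /cauchyP Fc.
have lim s : exists l : K, (fun x : fock => x s) @ F --> l.
  apply: (iffLR (cvg_ex _)); apply: cauchy_cvg.
  apply/cauchyP => e e0; have [x Fx] := Fc e e0.
  exists (x s); rewrite /fmap /=; apply: filterS Fx => y.
  rewrite -!ball_normE /=; apply: le_lt_trans.
  exact: (fock_norm_ge (x - y) s).
have [y Fy] := choice lim.
have key (e : R[i]) : 0 < e -> exists2 A, F A & forall x : fock, A x ->
    forall N, lsum (fun s => `|x s - y s| ^+ 2) N <= e ^+ 2.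
  move=> e0; have e2 : 0 < e / 2 by rewrite divr_gt0.
  have [x0 Fx0] := Fc _ e2; exists (ball x0 (e / 2)) => // x xb N.
  have xF : \forall z \near F, `|x - z| <= e.
    apply: filterS Fx0 => z zb; rewrite -(subrKA x0) (splitr e).
    rewrite (le_trans (ler_normD _ _)) //; apply: lerD; apply: ltW.
      by move: xb; rewrite -ball_normE /= distrC.
    by move: zb; rewrite -ball_normE.
  have cv : (fun z : fock => lsum (fun s => `|x s - z s| ^+ 2) N) @ F -->
      lsum (fun s => `|x s - y s| ^+ 2) N.
    have adc := @add_continuous R[i].
    rewrite /lsum; apply: (cvg_big adc) => k _; apply: (cvg_big adc) => s _.
    rewrite expr2; under eq_fun do rewrite expr2.
    have h : (fun z : fock => `|x s - z s|) @ F --> `|x s - y s|.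
      by apply: cvg_norm; apply: cvgB; [exact: cvg_cst|exact: Fy].
    exact: (@cvgM _ _ _ FF).
  apply: cvgC_le cv; apply: filterS xF => z xz.
  apply: le_trans (fock_lsum_le (x - z) N) _.
  by rewrite ler_pXn2r ?nnegrE // ltW.
have y_fock : y \in fock_pred.
  have [A /filter_ex[x Ax] yA] := key 1 ltr01.
  have xyP : x \- y \in fock_pred by apply/asboolP; exists (1 ^+ 2); exact: yA.
  have -> : y = x - Fock xyP by apply/funext => s /=; rewrite opprB addrC subrK.
  exact: fockP.
apply/cvg_ex; exists (Fock y_fock); apply/cvgrPdist_le => e e0.
have [A FA yA] := key e e0; apply: filterS FA => x Ax; rewrite distrC.
by apply: fock_norm_le (ltW e0) _; exact: yA.
Qed.

HB.instance Definition _ := Uniform_isComplete.Build fock fock_complete.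

End FockSpace.
Arguments fock_pred {n R K}.


Notation "S ∘ T" := (bcomp S T) (at level 40, left associativity) : ring_scope.

Section Operators.
Variable R : realType.
Implicit Types H K L : hilbertType R.

(* [xget 0 A] is the element of A when there is one. Adjoints (Riesz), positive
   square roots of positive operators and orthogonal projections exist and are
   unique; so are the other operators introduced this way below. *)
Definition adj H K (T : bop H K) : bop K H :=
  xget 0 [set S : bop K H | forall x y, hdot (T x) y = hdot x (S y)].

Definition bpos H (T : bop H H) : Prop := forall x, 0 <= hdot (T x) x.

Definition bsqrt H (T : bop H H) : bop H H :=
  xget 0 [set S : bop H H | bpos S /\ S ∘ S = T].

Definition bproj H (V : csubspace H) : bop H V :=
  xget 0 [set P : bop H V | forall x (y : V), hdot (x - val (P x)) (val y) = 0].

Lemma bran_linear H K (T : bop H K) (c : R[i]) (x y : K) :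
  range T x -> range T y -> range T (c *: x + y).
Proof. by move=> [u _ <-] [v _ <-]; exists (c *: u + v); rewrite ?bop_linear. Qed.

Lemma bop0 H K (T : bop H K) : T 0 = 0.
Proof. by apply: (addrI (T 0)); rewrite -{1}[T 0]scale1r -bop_linear scale1r !addr0. Qed.

Definition branc H K (T : bop H K) : csubspace K :=
  @CSubspace R K (closure (range T))
    (subset_closure (ex_intro2 _ _ 0 I (bop0 T)))
    (fun c => closure_linear (@bran_linear _ _ T c)) (@closed_closure _ _).

Lemma branc_subproof H K (T : bop H K) (x : H) : T x \in cset (branc T).
Proof. by apply/mem_set/subset_closure; exists x. Qed.

Definition branc_elem H K (T : bop H K) (x : H) : branc T :=
  CSub (branc_subproof T x).

Definition wot_cvg H K (u : nat -> bop H K) (T : bop H K) : Prop :=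
  forall x y, hdot (u N x) y @[N --> \oo] --> hdot (T x) y.

Definition sot_cvg H K (u : nat -> bop H K) (T : bop H K) : Prop :=
  forall x, u N x @[N --> \oo] --> T x.

Lemma adj_id H : adj (bid H) = bid H.
Proof.
apply: xget_unique => // S Sadj; apply: bop_ext => y /=.
apply/eqP; rewrite -subr_eq0; apply/eqP/hdot_eq0.
by rewrite hdotBr -Sadj subrr.
Qed.

End Operators.

Section WeakStar.
Variables (R : realType) (H : hilbertType R).

Definition sq_summable (x : nat -> H) : Prop :=
  exists M : R[i], forall N, \sum_(k < N) `|x k| ^+ 2 <= M.

(* The w*-topology of B(H), as the dual of the trace class, is the ultraweak one:
   the initial topology of the functionals T |-> sum_k <T x_k, y_k> with (x_k) and
   (y_k) square-summable. *)
Definition sq_pair : Type :=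
  {xy : (nat -> H) * (nat -> H) | sq_summable xy.1 /\ sq_summable xy.2}.

Definition wstar_eval (T : bop H H) : {ptws sq_pair -> R[i]} :=
  fun p => limn (series (fun k => hdot (T ((sval p).1 k)) ((sval p).2 k))).

Definition wstar : Type := initial_topology wstar_eval.

HB.instance Definition _ := Topological.on wstar.

End WeakStar.


Section FockTensor.
Variables (n : nat) (R : realType).
Implicit Types K : hilbertType R.

Definition single_fun K (s : seq 'I_n) (k : K) : seq 'I_n -> K :=
  fun t => if t == s then k else 0.

Lemma single_subproof K (s : seq 'I_n) (k : K) : single_fun s k \in fock_pred.
Proof.
apply/asboolP; exists (`|k| ^+ 2) => N; rewrite /lsum.
have z j : (j == size s :> nat) = false ->
    \sum_(t : j.-tuple 'I_n) `|single_fun s k t| ^+ 2 = 0.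
  move=> js; rewrite big1 // => t _; rewrite /single_fun.
  case: eqP => [ts|_]; last by rewrite normr0 expr0n.
  by move: js; rewrite -ts size_tuple eqxx.
have [sN|Ns] := ltnP (size s) N; last first.
  rewrite big1 ?exprn_ge0 // => j _; apply: z.
  by apply/eqP => js; have := ltn_ord j; rewrite js ltnNge Ns.
rewrite (bigD1 (Ordinal sN)) //= [X in _ + X]big1 ?addr0; last first.
  by move=> j /negbTE js; apply: z; rewrite -js.
rewrite (bigD1 (in_tuple s)) //= [X in _ + X]big1 ?addr0 ?/single_fun ?eqxx //.
move=> t /negbTE ts; rewrite /single_fun.
by rewrite -[s]/(val (in_tuple s)) val_eqE ts normr0 expr0n.
Qed.

Definition single K (s : seq 'I_n) (k : K) : fock n K := Fock (single_subproof s k).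

Lemma ftens_subproof K (x : fock n R[i]) (k : K) :
  (fun s => (x s : R[i]) *: k) \in fock_pred.
Proof.
have /asboolP[M xM] := fockP x; apply/asboolP; exists (`|k| ^+ 2 * M) => N.
rewrite (_ : (fun s => _) = fun s => `|k| ^+ 2 * `|x s| ^+ 2).
  by rewrite lsumZ ler_wpM2l // exprn_ge0.
by apply/funext => s; rewrite normrZ exprMn mulrC.
Qed.

(* elementary tensor of x and k *)
Definition ftens K (x : fock n R[i]) (k : K) : fock n K := Fock (ftens_subproof x k).

Lemma hdot_ftens K (x x' : fock n R[i]) (k k' : K) :
  hdot (ftens x k) (ftens x' k') = hdot x x' * hdot k k'.
Proof.
apply: (@cvg_unique _ (@norm_hausdorff _ R[i]) _ _ _ _ (@fock_dot_cvg _ _ _ _ _)).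
rewrite (_ : lsum _ = fun N => hdot k k' * lsum (fun s => hdot (x s) (x' s)) N).
  rewrite mulrC; apply: (@cvgZr _ R[i]); exact: fock_dot_cvg.
apply/funext => N; rewrite -lsumZ; congr lsum; apply/funext => s.
by rewrite /= hdotZl hdotZr mulrA mulrC.
Qed.

(* V tensor K, for V a closed subspace of the Fock space, as the closed span of the
   elementary tensors; [selem x k] is the elementary tensor of x and k in it. *)
Definition stens (V : csubspace (fock n R[i])) K : csubspace (fock n K) :=
  clspan [set z | exists (x : V) (k : K), z = ftens (val x) k].

Lemma selem_subproof (V : csubspace (fock n R[i])) K (x : V) (k : K) :
  ftens (val x) k \in cset (stens V K).
Proof. by apply/mem_set/subset_closure/sub_lspan; exists x, k. Qed.

Definition selem (V : csubspace (fock n R[i])) K (x : V) (k : K) : stens V K :=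
  CSub (selem_subproof x k).

(* S tensor I_K, where t and t' are the maps (x, k) |-> x tensor k of the source and
   of the target. *)
Definition btens (U V T T' K : hilbertType R) (t : U -> K -> T) (t' : V -> K -> T')
    (S : bop U V) : bop T T' :=
  xget 0 [set Z : bop T T' | forall x k, Z (t x k) = t' (S x) k].

End FockTensor.

(* noncommutative polynomials: finitely supported families of complex coefficients *)
Notation ncpoly R n := {fsfun seq 'I_n -> R[i] with 0}.

Section Tuples.
Variables (R : realType) (n : nat) (H : hilbertType R).
Implicit Types (X : 'I_n -> bop H H) (a : seq 'I_n -> R).

Definition opword X (s : seq 'I_n) : bop H H :=
  foldr (fun i T => X i ∘ T) (bid H) s.

Definition nceval (p : ncpoly R n) X : bop H H :=
  (\sum_(s <- finsupp p) p s *: opword X s)%fset.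

(* Series over words are summed by increasing length. *)
Definition Phi_part a X (Y : bop H H) (N : nat) : bop H H :=
  \sum_(1 <= k < N) \sum_(s : k.-tuple 'I_n)
    (a s)%:C *: (opword X s ∘ Y ∘ adj (opword X s)).

Definition Phi a X (Y : bop H H) : bop H H :=
  xget 0 [set T | wot_cvg (Phi_part a X Y) T].

Definition idPhi a X (s : nat) (Y : bop H H) : bop H H :=
  iter s (fun Z => Z - Phi a X Z) Y.

Definition Cpure a (m : nat) X : set (bop H H) :=
  [set D | (forall s, (1 <= s <= m)%N -> bpos (idPhi a X s D)) /\
           sot_cvg (fun k => iter k (Phi a X) D) 0].

End Tuples.

Section Model.
Variables (R : realType) (n : nat) (a : seq 'I_n -> R) (m : nat).

Definition positive_regular : Prop :=
  [/\ (limn_esup (fun k =>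
         ((\sum_(s : k.-tuple 'I_n) `|a s| ^+ 2) `^ ((2 * k)%N%:R^-1))%:E)
         < +oo)%E,
      forall s, 0 <= a s, a [::] = 0 & forall i, 0 < a [:: i]].

(* The factorizations g_1 ... g_j = s into nonempty words are the [reshape l s] with
   l a sequence of j positive lengths adding up to the length of s. *)
Definition bweight (s : seq 'I_n) : R :=
  if s is [::] then 1 else
  \sum_(1 <= j < (size s).+1)
    \sum_(l : j.-tuple 'I_(size s).+1 |
          all (leq 1) (map val l) && (sumn (map val l) == size s))
      (\prod_(g <- reshape (map val l) s) a g) * 'C((j + m - 1)%N, (m - 1)%N)%:R.

Local Notation F2 := (fock n R[i]).

Definition fvec (s : seq 'I_n) : F2 := @single n R R[i] s 1.

Definition Wmodel (i : 'I_n) : bop F2 F2 :=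
  xget 0 [set T : bop F2 F2 | forall s,
    T (fvec s) = (Num.sqrt (bweight s / bweight (i :: s)))%:C *: fvec (i :: s)].

Variable P : set (ncpoly R n).

Definition MP : csubspace F2 :=
  clspan [set x | exists p s t, P p /\
    x = opword Wmodel s (nceval p Wmodel (opword Wmodel t (fvec [::])))].

Definition NP : csubspace F2 := orthc (cset MP).

Definition Bmodel (i : 'I_n) : bop NP NP := bproj NP ∘ Wmodel i ∘ binc NP.

Definition BB (s t : seq 'I_n) : bop NP NP := opword Bmodel s ∘ adj (opword Bmodel t).

Definition Swstar : set (wstar NP) :=
  closure (lspan [set T : bop NP NP | exists s t, T = BB s t] : set (wstar NP)).

Lemma BB_Swstar s t : BB s t \in Swstar.
Proof. by apply/mem_set/subset_closure/sub_lspan; exists s, t. Qed.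

Definition SBB s t : Swstar := exist _ (BB s t) (BB_Swstar s t).

Lemma bid_Swstar : bid NP \in Swstar.
Proof.
have -> : bid NP = BB [::] [::] by rewrite /BB /= adj_id; apply: bop_ext.
exact: BB_Swstar.
Qed.

Definition Sid : Swstar := exist _ (bid NP) bid_Swstar.

End Model.

Arguments NP {R n} a m P.
Arguments Bmodel {R n} a m P i.
Arguments Swstar {R n} a m P _.
Arguments SBB {R n} a m P s t.
Arguments Sid {R n} a m P.

Section CompletelyPositive.
Variables (R : realType) (N H : hilbertType R) (S : set (wstar N)).
Implicit Type phi : S -> bop H H.

Definition op_linear phi : Prop :=
  forall (c : R[i]) (x y z : S),
    (set_val z : bop N N) = c *: (set_val x : bop N N) + set_val y ->
    phi z = c *: phi x + phi y.

(* positivity of [T i j] as an operator on the k-fold direct sum of N *)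
Definition completely_positive phi : Prop :=
  forall (k : nat) (T : 'I_k -> 'I_k -> S),
    (forall x : 'I_k -> N,
       0 <= \sum_i \sum_j hdot ((set_val (T i j) : bop N N) (x j)) (x i)) ->
    forall h : 'I_k -> H, 0 <= \sum_i \sum_j hdot (phi (T i j) (h j)) (h i).

Definition wstar_continuous phi : Prop := continuous (phi : S -> wstar H).

End CompletelyPositive.


Section Berezin.
Variables (R : realType) (n : nat) (a : seq 'I_n -> R) (m : nat).
Variable P : set (ncpoly R n).
Variables (H : hilbertType R) (A : 'I_n -> bop H H).

Local Notation S := (Swstar a m P).
Local Notation N := (NP a m P).

Definition CPwstar : set (S -> bop H H) :=
  [set phi | [/\ op_linear phi, completely_positive phi, wstar_continuous phi &
     forall s t, phi (SBB a m P s t) =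
       opword A s ∘ phi (Sid a m P) ∘ adj (opword A t)]].

Definition Gamma (phi : S -> bop H H) : bop H H := phi (Sid a m P).

(* Here Q is the positive operator R of the Berezin kernel K_{f,A,R}. *)
Definition kernel_part (Q : bop H H) (h : H) (k : nat) :
    fock n (branc (bsqrt Q)) :=
  lsum (fun s => (Num.sqrt (bweight a m s))%:C *:
    ftens (fvec R s) (branc_elem (bsqrt Q) (adj (opword A s) h))) k.

Definition berezin_kernel (Q : bop H H) : bop H (fock n (branc (bsqrt Q))) :=
  xget 0 [set T : bop H (fock n (branc (bsqrt Q))) |
    forall h, kernel_part Q h @ \oo --> T h].

Definition Kq (Q : bop H H) : bop H (stens N (branc (bsqrt Q))) :=
  btens (@ftens n R _) (@selem n R N _) (bproj N) ∘ berezin_kernel Q.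

Definition berezin (Q : bop H H) (chi : bop N N) : bop H H :=
  adj (Kq Q) ∘ btens (@selem n R N _) (@selem n R N _) chi ∘ Kq Q.

End Berezin.

Arguments CPwstar {R n} a m P {H} A.
Arguments Gamma {R n} a m P {H} phi.
Arguments berezin {R n} a m P {H} A Q chi.

(* Main.v *)
Require Import Defs.
From mathcomp Require Import all_boot all_order all_algebra complex finmap.
From mathcomp Require Import ring lra zify.
From mathcomp Require Import all_classical all_reals all_analysis.

Set Implicit Arguments.
Unset Strict Implicit.
Unset Printing Implicit Defensive.

Import Order.TTheory GRing.Theory Num.Theory.
Import numFieldNormedType.Exports.

Local Open Scope classical_set_scope.
Local Open Scope complex_scope.
Local Open Scope ring_scope.

(** Let f be the noncommutative power series with coefficients a. The weights b
    are the coefficients of (1 - f)^(-m) ([bweightE]), so multiplying them by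
    1 - f lowers m by one ([wbin_rec]). The theorem follows from reading this
    identity off quadratic forms, in two directions.

    From a factorization to a pure operator: let K from H to F2 (x) E intertwine
    adj A_i with adj W_i (x) I. Then <adj K K h, h> is the sum over the words u of
    b_u F(h, u) with F(h, u) = |K h u|^2 / b_u, and adj A_s acts on F by prefixing
    the word s. On forms expanded in this way Phi multiplies the coefficients by f
    ([wform_Phi]). So (id - Phi)^s(adj K K) has the coefficients of (1 - f)^(s-m),
    which are nonnegative for s <= m, and Phi^k(adj K K) only sees the words of
    length at least k, which makes adj K K pure ([dilation_Cpure]). For the
    inclusion of N_P into the Fock space this says that the identity of N_P is pure
    for the model B ([bid_Cpure]).

    From a pure operator D to a factorization: put D_s = (id - Phi)^s(D) and
    Q = D_m. As D_{s+1} = D_s - Phi(D_s) and Phi^k(D_s) tends to 0, each D_s is the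
    sum of the Phi^k(D_{s+1}), and after m such summations
    <D h, h> = sum_u b_u <Q adj(A_u) h, adj(A_u) h> ([Cpure_wsum]). The right-hand
    side is the squared norm of the Berezin kernel at h, so the kernel K is bounded
    with adj K K = D ([berezin_kernel_sq]). It intertwines adj A_i with
    adj W_i (x) I, and p(A) = 0 for p in P forces its range into N_P (x) E
    ([dilation_range]). This proves the last equivalence.

    For the bijection, let V from H to N_P (x) E intertwine adj A_i with
    adj B_i (x) I. The compression of chi (x) I by V is completely positive and
    ultraweakly continuous, because expanding along a family of E obtained by
    Gram-Schmidt turns <(chi (x) I) z, w> into a series of terms <chi z_j, w_j>
    with square-summable coefficients ([btens_expansion], [compression_cp],
    [weval_compression]); with the Berezin kernel for V this gives surjectivity and
    the formula for the inverse. Conversely, an ultraweakly continuous completely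
    positive phi with the given relation on the generators carries Phi_B to Phi_A
    ([graph_Phi]), so phi(I) inherits purity from I ([CP_Cpure]). Injectivity holds
    because phi(I) determines phi on the generators, whose span is ultraweakly
    dense ([op_linear_ext]).

    The operators obtained from inner product equations (adjoints, projections,
    square roots, S (x) I) are constructed from the completeness of Hilbert spaces,
    and infinite sums over words are handled as unconditional sums of nonnegative
    extended real numbers. *)

(** * Limits, bounded operators and inner products *)

Section HilbertBasics.
Variable R : realType.
Implicit Types H K L : hilbertType R.

(** Norms in a module over R[i] are complex numbers; order arguments are
    carried out on their real values. *)
Definition rnorm (V : normedModType R[i]) (x : V) : R := complex.Re `|x|.

Lemma realC (z : R[i]) : 0 <= z -> z = (complex.Re z)%:C.
Proof. by move=> z0; rewrite RRe_real // ger0_real. Qed.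

Lemma rnormE (V : normedModType R[i]) (x : V) : `|x| = (rnorm x)%:C.
Proof. exact: realC. Qed.

Lemma rnorm_ge0 (V : normedModType R[i]) (x : V) : 0 <= rnorm x.
Proof. by rewrite -ler0c -rnormE. Qed.

Lemma cvgC_seqP (V : normedModType R[i]) (u : nat -> V) (l : V) :
  u @ \oo --> l <->
  forall e : R, 0 < e -> exists N, forall k, (N <= k)%N -> `|l - u k| <= e%:C.
Proof.
split=> [/cvgrPdist_le ul e e0|ul].
  have [|N _ Nu] := ul e%:C; first by rewrite ltcR.
  by exists N => k Nk; apply: Nu.
apply/cvgrPdist_le => e e0.
have [|N Nu] := ul (complex.Re e); first by rewrite -ltcR -realC // ltW.
by exists N => // k /= Nk; rewrite [e]realC ?(ltW e0) //; apply: Nu.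
Qed.

Lemma cauchy_seq_cvg (V : completeNormedModType R[i]) (u : nat -> V) :
  (forall e : R, 0 < e -> exists N, forall k l, (N <= k)%N -> (N <= l)%N ->
     `|u k - u l| <= e%:C) -> exists l : V, u @ \oo --> l.
Proof.
move=> uc; apply: (iffLR (cvg_ex _)); apply: cauchy_cvg; apply/cauchyP => e e0.
have er : e = (complex.Re e)%:C by rewrite -realC // ltW.
have e0' : 0 < complex.Re e / 2 by rewrite divr_gt0 // -ltcR -er.
have [N Nu] := uc _ e0'.
exists (u N); exists N => // k /= Nk; rewrite -ball_normE /=.
apply: le_lt_trans (Nu _ _ (leqnn _) Nk) _.
by rewrite er ltcR ltr_pdivrMr // ltr_pMr ?ltr1n // -ltcR -er.
Qed.

Lemma cvgC_real (u : nat -> R) (l : R) :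
  (fun k => (u k)%:C) @ \oo --> l%:C <-> u @ \oo --> l.
Proof.
split=> [/cvgC_seqP ul|/cvgrPdist_le ul].
  apply/cvgrPdist_le => e e0; have [N Nu] := ul _ e0.
  exists N => // k /= /Nu; rewrite -rmorphB normc_def /= expr0n addr0 sqrtr_sqr.
  by rewrite lecR.
apply/cvgC_seqP => e e0; have [N _ Nu] := ul _ e0.
exists N => k /Nu /=; rewrite -rmorphB normc_def /= expr0n addr0 sqrtr_sqr.
by rewrite lecR.
Qed.

Lemma cvgC_add (u v : nat -> R[i]) (l m : R[i]) : u @ \oo --> l -> v @ \oo --> m ->
  u k + v k @[k --> \oo] --> l + m.
Proof. by move=> ul vm; exact: (@cvgD _ R[i] _ \oo _ u v l m ul vm). Qed.

Lemma cvgC_sub (u v : nat -> R[i]) (l m : R[i]) : u @ \oo --> l -> v @ \oo --> m ->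
  u k - v k @[k --> \oo] --> l - m.
Proof. by move=> ul vm; exact: (@cvgB _ R[i] _ \oo _ u v l m ul vm). Qed.

Lemma cvgC_mul (u v : nat -> R[i]) (l m : R[i]) : u @ \oo --> l -> v @ \oo --> m ->
  u k * v k @[k --> \oo] --> l * m.
Proof. by move=> ul vm; exact: (@cvgM R[i] _ \oo _ u v l m ul vm). Qed.

Lemma cvg_hdotl H (u : nat -> H) (l y : H) :
  u @ \oo --> l -> hdot (u k) y @[k --> \oo] --> hdot l y.
Proof.
move=> ul; exact: (@continuous_cvg _ _ _ \oo _ u (hdot ^~ y) l (@hdot_continuousl _ _ y l) ul).
Qed.

Lemma cvg_hdot H (u v : nat -> H) (l m : H) :
  u @ \oo --> l -> v @ \oo --> m -> hdot (u k) (v k) @[k --> \oo] --> hdot l m.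
Proof.
move=> ul vm.
have -> : (fun k => hdot (u k) (v k)) =
    (fun k => hdot (u k - l) (v k - m) + (hdot (u k) m + hdot l (v k) - hdot l m)).
  by apply/funext => k; rewrite hdotBl !hdotBr; ring.
have h1 : hdot (u k) m @[k --> \oo] --> hdot l m by exact: cvg_hdotl.
have h2 : hdot l (v k) @[k --> \oo] --> hdot l m.
  rewrite hdotC; under eq_fun do rewrite hdotC.
  by apply: cvg_conj; exact: cvg_hdotl.
have h3 : hdot (u k - l) (v k - m) @[k --> \oo] --> (0 : R[i]).
  apply/cvgrPdist_le => e e0.
  have nu : `|u k - l| @[k --> \oo] --> (0 : R[i]).
    by rewrite -[X in _ --> X](normr0 H) -(subrr l); apply: cvg_norm; exact: (cvgB ul (cvg_cst l)).
  have nv : `|v k - m| @[k --> \oo] --> (0 : R[i]).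
    by rewrite -[X in _ --> X](normr0 H) -(subrr m); apply: cvg_norm; exact: (cvgB vm (cvg_cst m)).
  have : `|u k - l| * `|v k - m| @[k --> \oo] --> (0 : R[i]).
    by rewrite -[X in _ --> X](mulr0 0); apply: cvgM.
  move=> /cvgrPdist_le /(_ e e0).
  apply: filterS => k; rewrite !sub0r !normrN normrM !normr_id; apply: le_trans.
  exact: hdot_le.
have c : (fun=> hdot l m) @ \oo --> hdot l m by exact: cvg_cst.
have h4 := cvgC_sub (cvgC_add h1 h2) c.
by have := cvgC_add h3 h4; rewrite add0r addrK.
Qed.

Lemma cvg_uniq (V : normedModType R[i]) (u : nat -> V) (l m : V) :
  u @ \oo --> l -> u @ \oo --> m -> l = m.
Proof. by move=> ul um; apply: (@cvg_unique _ (@norm_hausdorff _ V) _ _ _ _ ul um). Qed.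

Lemma bopD H K (T : bop H K) x y : T (x + y) = T x + T y.
Proof. by have := bop_linear T 1 x y; rewrite !scale1r. Qed.

Lemma bopZ H K (T : bop H K) c x : T (c *: x) = c *: T x.
Proof. by have := bop_linear T c x 0; rewrite !addr0 (bop0 T) addr0. Qed.

Lemma bopN H K (T : bop H K) x : T (- x) = - T x.
Proof. by rewrite -scaleN1r bopZ scaleN1r. Qed.

Lemma bopB H K (T : bop H K) x y : T (x - y) = T x - T y.
Proof. by rewrite bopD bopN. Qed.

Lemma bop_sum H K (T : bop H K) I (r : seq I) (P : pred I) (F : I -> H) :
  T (\sum_(i <- r | P i) F i) = \sum_(i <- r | P i) T (F i).
Proof. by apply: (big_morph _ (bopD T) (bop0 T)). Qed.

Lemma bop_subE H K (S T : bop H K) x : (S - T) x = S x - T x. Proof. by []. Qed.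
Lemma bop_scaleE H K c (S : bop H K) x : (c *: S) x = c *: S x. Proof. by []. Qed.
Lemma bop_0E H K x : (0 : bop H K) x = 0. Proof. by []. Qed.
Lemma bop_sumE H K I (r : seq I) (P : pred I) (F : I -> bop H K) x :
  (\sum_(i <- r | P i) F i) x = \sum_(i <- r | P i) F i x.
Proof. by elim/big_rec2: _ => // i y T _ <-. Qed.

(** Every vector can be rescaled into a ball around 0 on which T stays below 1. *)
Lemma bop_bounded H K (T : bop H K) : exists2 M : R, 0 < M & forall x, `|T x| <= M%:C * `|x|.
Proof.
have /cvgrPdist_le /(_ 1 ltr01) := @bop_continuous _ _ _ T 0.
move=> /nbhs_ballP[e /= e0 He]; have er := realC (ltW e0).
have e0' : 0 < complex.Re e by rewrite -ltcR -er.
exists (2 / complex.Re e); first by rewrite divr_gt0.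
move=> x; have [->|x0] := eqVneq x 0; first by rewrite bop0 !normr0 mulr0.
have nx : 0 < `|x| by rewrite normr_gt0.
have := He (((complex.Re e / 2)%:C / `|x|) *: x); rewrite -ball_normE /= sub0r normrN.
rewrite normrZ normrM normfV normr_id divfK ?gt_eqF // ger0_norm; last first.
  by rewrite ler0c divr_ge0 // ltW.
rewrite [X in _ < X]er ltcR ltr_pdivrMr // ltr_pMr ?ltr1n // => /(_ isT).
rewrite bop0 sub0r normrN bopZ normrZ normrM normfV normr_id ger0_norm; last first.
  by rewrite ler0c divr_ge0 // ltW.
rewrite mulrAC ler_pdivrMr // mul1r => h.
have -> : (2 / complex.Re e)%:C = ((complex.Re e / 2)%:C)^-1.
  by rewrite -fmorphV invf_div.
by rewrite ler_pdivlMl // ltcR divr_gt0.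
Qed.

Lemma bounded_continuous H K (f : H -> K) (M : R) : linear f ->
  (forall x, `|f x| <= M%:C * `|x|) -> continuous f.
Proof.
move=> fl fM x; apply/cvgrPdist_le => e e0.
have fB y : f x - f y = f (x - y).
  by rewrite [x - y]addrC -[- y]scaleN1r fl scaleN1r addrC.
have M0 : 0 < `|M| + 1 by rewrite ltr_wpDl.
have d0 : 0 < e / (`|M| + 1)%:C by rewrite divr_gt0 // ltcR.
apply/nbhs_ballP; exists (e / (`|M| + 1)%:C) => //= y; rewrite -ball_normE /= fB => xy.
apply: le_trans (fM _) _; apply: (@le_trans _ _ ((`|M| + 1)%:C * `|x - y|)).
  by rewrite ler_wpM2r // lecR (le_trans (ler_norm _)) // lerDl.
by rewrite mulrC -ler_pdivlMr ?ltcR // ltW.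
Qed.

Definition mkbopM H K (f : H -> K) (M : R) (fl : linear f)
    (fM : forall x, `|f x| <= M%:C * `|x|) : bop H K :=
  mkbop fl (bounded_continuous fl fM).

Lemma hdot_nullr H (x : H) : (forall y, hdot x y = 0) -> x = 0.
Proof. by move=> h; apply: hdot_eq0. Qed.

Lemma hdot_ext H (x y : H) : (forall z, hdot x z = hdot y z) -> x = y.
Proof.
move=> h; apply/eqP; rewrite -subr_eq0; apply/eqP/hdot_nullr => z.
by rewrite hdotBl h subrr.
Qed.

Lemma hdot_suml H I (r : seq I) (P : pred I) (F : I -> H) y :
  hdot (\sum_(i <- r | P i) F i) y = \sum_(i <- r | P i) hdot (F i) y.
Proof. by apply: (big_morph (hdot ^~ y) (fun a b => hdotDl a b y) (hdot0l y)). Qed.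

Lemma hdot0r H (x : H) : hdot x 0 = 0.
Proof. by rewrite hdotC hdot0l conjC0. Qed.

Lemma hdot_sumr H I (r : seq I) (P : pred I) (F : I -> H) y :
  hdot y (\sum_(i <- r | P i) F i) = \sum_(i <- r | P i) hdot y (F i).
Proof. by apply: (big_morph (hdot y) (fun a b => hdotDr a b y) (hdot0r y)). Qed.

Lemma parallelogram H (x y : H) :
  `|x + y| ^+ 2 + `|x - y| ^+ 2 = 2 * `|x| ^+ 2 + 2 * `|y| ^+ 2.
Proof. by rewrite -!hdot_norm hdotBl hdotDl !hdotBr !hdotDr; ring. Qed.

End HilbertBasics.

(** * Projections, adjoints and positive operators *)

Section Projection.
Variable R : realType.
Implicit Types H K L : hilbertType R.

Lemma rnorm2_hdot H (x : H) : hdot x x = (rnorm x ^+ 2)%:C.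
Proof. by rewrite hdot_norm rnormE rmorphXn. Qed.

Lemma rparallel H (x y : H) :
  rnorm (x + y) ^+ 2 + rnorm (x - y) ^+ 2 = 2 * rnorm x ^+ 2 + 2 * rnorm y ^+ 2.
Proof.
apply: complexI; have := parallelogram x y; rewrite -!hdot_norm !rnorm2_hdot.
by rewrite !rmorphD !rmorphM /= => ->; rewrite !rmorph_nat.
Qed.

Lemma rnormZ (V : normedModType R[i]) (c : R) (x : V) : 0 <= c -> rnorm (c%:C *: x) = c * rnorm x.
Proof.
move=> c0; apply: complexI; rewrite rmorphM /= -!rnormE normrZ ger0_norm // ler0c //.
Qed.

(** A minimizing sequence for the distance from x to V is Cauchy by the
    parallelogram identity, because midpoints stay in V. At the limit v,
    minimality against v + c y with c = <x - v, y> / <y, y> forces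
    orthogonality. *)
Lemma projection_exists H (V : csubspace H) (x : H) :
  exists2 v : H, cset V v & forall y, cset V y -> hdot (x - v) y = 0.
Proof.
pose E := [set rnorm (x - v) ^+ 2 | v in cset V].
have E0 : has_inf E.
  split; first by exists (rnorm (x - 0) ^+ 2), 0 => //; exact: cset0.
  by exists 0 => _ [v _ <-]; rewrite sqr_ge0.
set d := inf E.
have dV v : cset V v -> d <= rnorm (x - v) ^+ 2.
  by move=> Vv; apply: ge_inf; [exact: E0.2|exists v].
have hk (k : nat) : exists v, cset V v /\ rnorm (x - v) ^+ 2 < d + k.+1%:R^-1.
  have [|_ [v Vv <-] vd] := @inf_adherent _ E k.+1%:R^-1 _ E0.
    by rewrite invr_gt0.
  by exists v.
have [u uP] := choice hk.
have uV k : cset V (u k) by have [] := uP k.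
have ud k : rnorm (x - u k) ^+ 2 < d + k.+1%:R^-1 by have [] := uP k.
(* midpoints of V are at distance at least sqrt d from x as well *)
have mid k l : 4 * d <= rnorm ((x - u k) + (x - u l)) ^+ 2.
  have -> : (x - u k) + (x - u l) = (2:R)%:C *: (x - (2^-1 *: u k + 2^-1 *: u l)).
    have -> : ((2:R)%:C : R[i]) = 2 by rewrite rmorph_nat.
    rewrite scalerBr scalerDr !scalerA divff ?pnatr_eq0 // !scale1r.
    by rewrite scaler_nat mulr2n opprD addrACA.
  rewrite rnormZ // exprMn -natrX ler_pM2l ?ltr0n //.
  apply: dV; apply: csetP => //; rewrite -[X in cset V X]addr0; apply: csetP => //.
  exact: cset0.
have [v uv] : exists v : H, u @ \oo --> v.
  apply: cauchy_seq_cvg => e e0.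
  have [N _ HN] : \forall N \near \oo, N.+1%:R^-1 < e ^+ 2 / 4.
    apply: (near_infty_natSinv_lt (PosNum _)); rewrite divr_gt0 ?exprn_gt0 //.
  exists N => k l Nk Nl; rewrite rnormE lecR -(@ler_pXn2r _ 2) ?nnegrE ?rnorm_ge0 ?ltW //.
  have h j : (N <= j)%N -> (j.+1%:R : R)^-1 < e ^+ 2 / 4 by move=> /HN.
  have := rparallel (x - u k) (x - u l); have := mid k l; have := ud k; have := ud l.
  have := h _ Nk; have := h _ Nl.
  have -> : x - u k - (x - u l) = - (u k - u l) by rewrite !opprB addrC addrA subrK.
  have -> : rnorm (- (u k - u l)) = rnorm (u k - u l) by rewrite /rnorm normrN.
  set A := rnorm (x - u k + _) ^+ 2; set B := rnorm (u k - u l) ^+ 2.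
  set a := rnorm (x - u k) ^+ 2; set b := rnorm (x - u l) ^+ 2.
  move: (k.+1%:R^-1 : R) (l.+1%:R^-1 : R) (e ^+ 2) => i j E2.
  by move=> *; lra.
have Vv : cset V v.
  apply: (@closed_cvg _ _ \oo _ u (cset V) (@cset_closed _ _ V) _ v uv).
  exact: nearW.
exists v => // y Vy.
have [->|y0] := eqVneq y 0; first exact: hdot0r.
have dz : hdot (x - v) (x - v) <= d%:C.
  rewrite rnorm2_hdot lecR; apply/ler_addgt0Pr => e e0.
  rewrite -lecR -rnorm2_hdot.
  have cv : hdot (x - u k) (x - u k) @[k --> \oo] --> hdot (x - v) (x - v).
    have h : x - u k @[k --> \oo] --> x - v.
      have c : (fun=> x) @ \oo --> x by exact: cvg_cst.
      exact: (@cvgB _ _ _ _ _ _ _ _ _ c uv).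
    exact: cvg_hdot.
  apply: cvgC_le cv.
  have [N _ HN] := near_infty_natSinv_lt (PosNum e0).
  exists N => // k /= Nk; rewrite rnorm2_hdot lecR (le_trans (ltW (ud k))) // lerD2l.
  by apply: ltW; exact: HN.
have yy0 : 0 < hdot y y by rewrite hdot_norm exprn_gt0 // normr_gt0.
have yyr : (hdot y y)^* = hdot y y by rewrite -hdotC.
have zmin c : hdot (x - v) (x - v) <= hdot (x - v - c *: y) (x - v - c *: y).
  apply: le_trans dz _; rewrite rnorm2_hdot lecR.
  have -> : x - v - c *: y = x - (c *: y + v) by rewrite opprD addrA addrAC.
  by apply: dV; apply: csetP.
move: (x - v) zmin => z /(_ (hdot z y / hdot y y)).
set c := _ / _.
rewrite hdotBl !hdotBr !hdotZl !hdotZr (hdotC y z) /c rmorphM /= fmorphV /= yyr.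
rewrite -subr_ge0.
rewrite (_ : _ - _ = - (hdot z y * (hdot z y)^* / hdot y y)); last first.
  by field; rewrite gt_eqF.
rewrite -normCK oppr_ge0 pmulr_lle0 ?invr_gt0 // => h.
have : `|hdot z y| ^+ 2 == 0 by rewrite eq_le h exprn_ge0.
by rewrite expf_eq0 normr_eq0 => /eqP.
Qed.

Lemma csub_hdot H (V : csubspace H) (x y : V) : hdot x y = hdot (val x) (val y).
Proof. by []. Qed.

Lemma bproj_spec H (V : csubspace H) x (y : V) : hdot (x - val (bproj V x)) (val y) = 0.
Proof.
have Vval (y' : V) : cset V (val y') by apply/set_mem/csub_valP.
suff : exists P : bop H V, forall x (y : V), hdot (x - val (P x)) (val y) = 0.
  by move=> /(xgetPex 0) /(_ x y).
have hx (x' : H) : exists w : V, forall y : V, hdot (x' - val w) (val y) = 0.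
  have [v Vv vP] := projection_exists V x'.
  exists (CSub (mem_set Vv)) => y' /=; exact: vP (Vval y').
have [f fP] := choice hx.
have fu (x' : H) (w : V) : (forall y : V, hdot (x' - val w) (val y) = 0) -> f x' = w.
  move=> wP; apply: hdot_ext => z; rewrite !csub_hdot.
  have := wP z; rewrite -(fP x' z) !hdotBl => /eqP.
  by rewrite (inj_eq (addrI _)) eqr_opp => /eqP.
have fl : linear f.
  move=> c a b; apply: fu => z.
  have -> : c *: a + b - val (c *: f a + f b) = c *: (a - val (f a)) + (b - val (f b)).
    by rewrite -[val _]/(c *: val (f a) + val (f b)) opprD addrACA scalerBr.
  by rewrite hdotDl hdotZl !fP mulr0 addr0.
have fb z : `|f z| <= 1%:C * `|z|.
  rewrite mul1r; have [->|f0] := eqVneq (f z) 0; first by rewrite normr0.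
  have f1 : 0 < `|f z| by rewrite normr_gt0.
  rewrite -(ler_pM2r f1) -expr2 -hdot_norm csub_hdot.
  have -> : hdot (val (f z)) (val (f z)) = hdot z (val (f z)).
    by apply/eqP; rewrite eq_sym -subr_eq0 -hdotBl fP.
  have h := hdot_le z (val (f z)); rewrite -csub_norm in h.
  apply: le_trans h; rewrite real_ler_norm // ger0_real //.
  suff -> : hdot z (val (f z)) = hdot (val (f z)) (val (f z)) by exact: hdot_ge0.
  by apply/eqP; rewrite -subr_eq0 -hdotBl fP.
by exists (mkbopM fl fb).
Qed.

Lemma bproj_id H (V : csubspace H) (y : V) : bproj V (val y) = y.
Proof.
apply: hdot_ext => z; rewrite !csub_hdot.
by have := bproj_spec (val y) z; rewrite hdotBl => /eqP; rewrite subr_eq0 => /eqP.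
Qed.

Lemma hdot_bproj H (V : csubspace H) x (y : V) : hdot (bproj V x) y = hdot x (val y).
Proof.
apply/eqP; rewrite csub_hdot eq_sym -subr_eq0 -hdotBl; apply/eqP; exact: bproj_spec.
Qed.

(** A nonzero vector orthogonal to the kernel of f represents f after scaling,
    since every x differs from a multiple of it by an element of the kernel. *)
Lemma riesz H (f : H -> R[i]) (M : R) : linear f ->
  (forall x, `|f x| <= M%:C * `|x|) -> exists s, forall x, f x = hdot x s.
Proof.
move=> fl fM; have fc := @bounded_continuous _ _ R[i] _ _ fl fM.
have f0 : f 0 = 0.
  by have := fl (-1) 0 0; rewrite scaleN1r oppr0 addr0 scaleN1r addNr.
have kl (c : R[i]) (x y : H) : f x = 0 -> f y = 0 -> f (c *: x + y) = 0.
  by move=> fx fy; rewrite fl fx fy scaler0 addr0.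
have kc : closed [set x | f x = 0].
  apply: (@closed_comp _ _ f [set 0]) => [x _|]; first exact: fc.
  exact: (@accessible_closed_set1 _ (hausdorff_accessible (@norm_hausdorff _ R[i]))).
pose V := CSubspace f0 kl kc.
have [allz|] := pselect (forall x, f x = 0); first by exists 0 => x; rewrite hdot0r.
move=> /existsNP[x0 /eqP fx0].
have [v /= fv vP] := projection_exists V x0.
set z := x0 - v in vP *; have fz : f z = f x0.
  by rewrite /z addrC -[- v]scaleN1r fl fv scaler0 add0r.
have zz : hdot z z != 0.
  apply: contra_neq fx0 => /hdot_eq0 z0; by rewrite -fz z0.
exists ((f z)^* / hdot z z *: z) => x.
have : hdot z (x - (f x / f z) *: z) = 0.
  apply: vP => /=; rewrite addrC -scaleNr fl.
  by rewrite -[_ *: _]/(- (f x / f z) * f z) mulNr divfK ?fz // addNr.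
rewrite hdotBr hdotZr => /eqP; rewrite subr_eq0 => /eqP h.
have zzr : (hdot z z)^* = hdot z z by rewrite -hdotC.
rewrite hdotZr (hdotC x z) h !(rmorphM, fmorphV) /= !conjCK zzr.
by rewrite fz; field; rewrite zz fx0.
Qed.

Lemma adjP H K (T : bop H K) x y : hdot (T x) y = hdot x (adj T y).
Proof.
suff : exists S : bop K H, forall x y, hdot (T x) y = hdot x (S y).
  by move=> /(xgetPex 0) /(_ x y).
have [M M0 TM] := bop_bounded T.
have hx (y' : K) : exists s : H, forall x, hdot (T x) y' = hdot x s.
  apply: (@riesz _ (fun x => hdot (T x) y') (M * rnorm y')).
    by move=> c a b; rewrite bop_linear hdotDl hdotZl.
  move=> z; apply: le_trans (hdot_le _ _) _.
  by rewrite rmorphM /= -rnormE mulrAC ler_wpM2r.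
have [f fP] := choice hx.
have fl : linear f.
  move=> c a b; apply: hdot_ext => z; rewrite hdotC [RHS]hdotC; congr (_^*).
  by rewrite -fP hdotDr hdotZr !fP hdotDr hdotZr.
have fb z : `|f z| <= M%:C * `|z|.
  have [->|f0] := eqVneq (f z) 0; first by rewrite normr0 mulr_ge0 // ler0c ltW.
  have f1 : 0 < `|f z| by rewrite normr_gt0.
  rewrite -(ler_pM2r f1) -expr2 -hdot_norm -fP.
  apply: (@le_trans _ _ (`|hdot (T (f z)) z|)).
    by rewrite real_ler_norm // fP ger0_real // hdot_ge0.
  apply: le_trans (hdot_le _ _) _.
  by rewrite mulrAC ler_wpM2r.
by exists (mkbopM fl fb).
Qed.

Lemma adjPr H K (T : bop H K) x y : hdot y (T x) = hdot (adj T y) x.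
Proof. by rewrite hdotC adjP -hdotC. Qed.

Lemma adj_uniq H K (T : bop H K) (S : bop K H) :
  (forall x y, hdot (T x) y = hdot x (S y)) -> adj T = S.
Proof.
move=> h; apply: bop_ext => y; apply: hdot_ext => z.
by rewrite -adjPr hdotC h -hdotC.
Qed.

Lemma adjK H K (T : bop H K) : adj (adj T) = T.
Proof. by apply: adj_uniq => x y; rewrite -adjPr. Qed.

Lemma adj_comp H K L (S : bop K L) (T : bop H K) : adj (S ∘ T) = adj T ∘ adj S.
Proof. by apply: adj_uniq => x y /=; rewrite !adjP. Qed.

Lemma adj_bproj H (V : csubspace H) (y : V) : adj (bproj V) y = val y.
Proof. by apply: hdot_ext => x; rewrite -adjPr hdotC hdot_bproj -hdotC. Qed.

Lemma adj_binc H (V : csubspace H) : adj (binc V) = bproj V.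
Proof. by apply: adj_uniq => x y /=; rewrite hdotC -hdot_bproj -hdotC. Qed.

(** Over the complex scalars a sesquilinear form is determined by its diagonal.
    Operators can thus be compared through their quadratic forms. *)
Lemma polarization H (T : bop H H) x y : hdot (T x) y *+ 4 =
  hdot (T (x + y)) (x + y) - hdot (T (x - y)) (x - y)
  + 'i * (hdot (T (x + 'i *: y)) (x + 'i *: y) - hdot (T (x - 'i *: y)) (x - 'i *: y)).
Proof.
rewrite !(bopD, bopN, bopZ) !(hdotDl, hdotNl, hdotZl) !(hdotDr, hdotNr, hdotZr) conjCi.
have := sqrCi R[i]; move: 'i => i i2; ring: i2.
Qed.

Lemma bop_quad_ext H (S T : bop H H) : (forall x, hdot (S x) x = hdot (T x) x) -> S = T.
Proof.
move=> h; apply: bop_ext => x; apply: hdot_ext => y; apply/eqP.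
have p4 : (4%:R : R[i]) != 0 by rewrite pnatr_eq0.
by rewrite -(inj_eq (mulIf p4)) !mulr_natr !polarization !h.
Qed.

(** <T x, x> is real, so T and its adjoint have the same quadratic form. *)
Lemma bpos_sa H (T : bop H H) : bpos T -> forall x y, hdot (T x) y = hdot x (T y).
Proof.
move=> Tp x y; rewrite adjP; congr hdot; congr bop_fun.
apply: bop_quad_ext => {x y} z; rewrite -adjPr hdotC.
by apply: CrealP; rewrite ger0_real.
Qed.

(** Cauchy-Schwarz for the form <T x, y>, which may be degenerate. If
    <T y, y> = 0, then <T (x - c y), x - c y> is affine in c, and it can stay
    nonnegative only if its linear part <T x, y> vanishes. *)
Lemma bpos_CS H (T : bop H H) : bpos T -> forall x y,
  `|hdot (T x) y| ^+ 2 <= hdot (T x) x * hdot (T y) y.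
Proof.
move=> Tp x y; have sa := bpos_sa Tp.
have yx : hdot (T y) x = (hdot (T x) y)^* by rewrite sa hdotC.
have pos c : 0 <= hdot (T x) x - c^* * hdot (T x) y - c * (hdot (T x) y)^*
       + c * c^* * hdot (T y) y.
  have := Tp (x - c *: y).
  by rewrite !(bopD, bopN, bopZ) !(hdotDl, hdotNl, hdotZl) !(hdotDr, hdotNr, hdotZr) yx; congr (0 <= _); ring.
have [y0|y0] := eqVneq (hdot (T y) y) 0.
  rewrite y0 mulr0; have : 0 <= hdot (T x) x by [].
  move: pos; rewrite y0; move: (hdot (T x) y) (hdot (T x) x) => w q pos q0.
  rewrite real_leNgt ?real0 ?rpredX ?normr_real //; apply/negP => w0.
  (* at c = (q + 1) / |w|^2 w the value is q - 2 (q + 1) < 0 *)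
  have := pos ((q + 1) / (`|w| ^+ 2) * w); rewrite mulr0 addr0 !rmorphM /= fmorphV /=.
  rewrite [(`|w| ^+ 2)^*]rmorphXn /= conj_normC [(q + 1)^*](CrealP _); last first.
    by rewrite rpredD ?real1 // ger0_real.
  rewrite (_ : _ - _ = - (q + 2)); last first.
    have : w * w^* != 0 by rewrite -normCK gt_eqF.
    rewrite mulf_eq0 negb_or => /andP[w1 w2].
    by rewrite normCK; field; rewrite w1 w2.
  rewrite oppr_ge0 => q2; have : 0 < q + 2 by rewrite ltr_wpDl.
  by move=> /lt_le_trans /(_ q2); rewrite ltxx.
have yp : 0 < hdot (T y) y by rewrite lt_neqAle eq_sym y0 Tp.
have yr : (hdot (T y) y)^* = hdot (T y) y by apply: CrealP; rewrite ger0_real.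
have := pos (hdot (T x) y / hdot (T y) y).
rewrite !rmorphM /= fmorphV /= yr.
rewrite (_ : _ + _ = (hdot (T x) x * hdot (T y) y - `|hdot (T x) y| ^+ 2) / hdot (T y) y).
  by rewrite pmulr_lge0 ?invr_gt0 // subr_ge0.
by rewrite normCK; field.
Qed.

End Projection.

(** * Square roots of positive operators *)

Section SquareRoot.
Variable R : realType.
Implicit Types H K L : hilbertType R.

Lemma ler_normC_sub (V : normedModType R[i]) (x y z : V) : `|x - z| <= `|x - y| + `|y - z|.
Proof. by rewrite -[X in `|X - _|](subrK y) -addrA ler_normD. Qed.

Lemma ler_addC_eps (a b : R) (M : R) :
  (forall e : R, 0 < e -> a <= b + M * e) -> a <= b.
Proof.
move=> h; apply/ler_addgt0Pr => e e0.
have M0 : 0 < `|M| + 1 by rewrite ltr_wpDl.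
have e1 : 0 < e / (`|M| + 1) by rewrite divr_gt0.
apply: le_trans (h _ e1) _; rewrite lerD2l.
rewrite mulrA ler_pdivrMr // mulrC ler_pM2l //.
by rewrite (le_trans (ler_norm _)) // lerDl.
Qed.

(** Cauchy-Schwarz for the form of X, applied to x and X x. *)
Lemma bpos_bound H (X : bop H H) : bpos X -> (forall x, hdot (X x) x <= `|x| ^+ 2) ->
  forall x, `|X x| <= `|x|.
Proof.
move=> Xp X1 x.
have [->|X0] := eqVneq (X x) 0; first by rewrite normr0.
have n0 : 0 < `|X x| by rewrite normr_gt0.
have := bpos_CS Xp x (X x); rewrite hdot_norm => h.
have : (`|X x| ^+ 2) ^+ 2 <= `|x| ^+ 2 * `|X x| ^+ 2.
  rewrite -[X in X ^+ 2](ger0_norm (exprn_ge0 2 (ltW n0))); apply: le_trans h _.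
  by apply: ler_pM => //; apply: X1.
rewrite [X in X <= _]expr2 ler_pM2r ?exprn_gt0 // => h2.
by rewrite -(@ler_pXn2r _ 2) ?nnegrE.
Qed.

(** A fixed point Y = (X + Y^2) / 2 satisfies (1 - Y)^2 = 1 - X. The iterates
    are polynomials in X with nonnegative coefficients; in particular they
    commute. *)
Fixpoint sqrt_iter H (X : bop H H) (k : nat) : bop H H :=
  if k is k'.+1 then (2^-1 : R[i]) *: (X + sqrt_iter X k' ∘ sqrt_iter X k') else 0.

(** The same iteration at the scalar 1. As all coefficients are nonnegative, it
    dominates the norms of the iterates, and of their differences, as soon as
    X is a contraction. *)
Fixpoint sqrt_bound (k : nat) : R :=
  if k is k'.+1 then (1 + sqrt_bound k' ^+ 2) / 2 else 0.

Lemma sqrt_bound_ge0 k : 0 <= sqrt_bound k.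
Proof. by case: k => //= k; rewrite divr_ge0 // addr_ge0 // sqr_ge0. Qed.

Lemma sqrt_bound_le1 k : sqrt_bound k <= 1.
Proof.
elim: k => [|k IH] /=; first exact: ler01.
by rewrite ler_pdivrMr // mul1r -[leRHS]/(1 + 1) lerD2l expr_le1 // sqrt_bound_ge0.
Qed.

Lemma sqrt_bound_leS k : sqrt_bound k <= sqrt_bound k.+1.
Proof.
elim: k => [|k IH]; first exact: sqrt_bound_ge0.
rewrite -[leLHS]/((1 + sqrt_bound k ^+ 2) / 2) -[leRHS]/((1 + sqrt_bound k.+1 ^+ 2) / 2) ler_pM2r ?invr_gt0 // lerD2l.
by rewrite ler_pXn2r ?nnegrE ?sqrt_bound_ge0.
Qed.

(** The scalar iterates increase to a limit and dominate the differences of the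
    operator iterates, which therefore converge strongly to some F. Then
    F = (X + F^2) / 2 and |F| <= 1, so 1 - F is a positive square root of
    1 - X. *)
Lemma sqrt_exists1 H (X : bop H H) : bpos X -> (forall x, hdot (X x) x <= `|x| ^+ 2) ->
  exists S : bop H H, bpos S /\ S ∘ S = bid H - X.
Proof.
move=> Xp X1; have X1' := bpos_bound Xp X1.
pose Y := sqrt_iter X; pose y := sqrt_bound.
have YS k x : Y k.+1 x = 2^-1 *: (X x + Y k (Y k x)) by [].
have yS k : y k.+1 = (1 + y k ^+ 2) / 2 by [].
have Ysa k x z : hdot (Y k x) z = hdot x (Y k z).
  elim: k x z => [|k IH] x z; first by rewrite hdot0l hdot0r.
  rewrite !YS hdotZl hdotZr hdotDl hdotDr !IH (bpos_sa Xp).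
  by rewrite fmorphV /= conjC_nat.
have comm (Z : bop H H) : (forall x, Z (X x) = X (Z x)) ->
    forall k x, Z (Y k x) = Y k (Z x).
  move=> ZX; elim=> [|k IH] x; first by rewrite bop0.
  by rewrite !YS bopZ bopD ZX !IH.
have XY k x : X (Y k x) = Y k (X x) by apply: comm.
have YY k l x : Y k (Y l x) = Y l (Y k x) by apply: comm => z; rewrite XY.
have Yb k x : `|Y k x| <= (y k)%:C * `|x|.
  elim: k x => [|k IH] x; first by rewrite normr0 mul0r.
  rewrite YS normrZ -[y _]/((1 + y k ^+ 2) / 2) normfV normr_nat rmorphM fmorphV rmorph_nat.
  rewrite mulrAC [leRHS]mulrC ler_pM2l ?invr_gt0 // rmorphD rmorphXn /= mulrDl mul1r.
  apply: le_trans (ler_normD _ _) _; apply: lerD => //.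
  apply: le_trans (IH _) _; rewrite expr2 -mulrA ler_wpM2l // ler0c.
  exact: sqrt_bound_ge0.
have Yd k x : `|Y k.+1 x - Y k x| <= (y k.+1 - y k)%:C * `|x|.
  elim: k x => [|k IH] x.
    rewrite -[y 1%N]/((1 + 0 ^+ 2) / 2) -[y 0%N]/0 -[Y 0%N x]/0 !subr0 expr0n addr0.
    rewrite YS -[Y 0%N _]/0 addr0 normrZ.
    by rewrite normfV normr_nat mul1r fmorphV rmorph_nat ler_wpM2l // invr_ge0.
  have -> : Y k.+2 x - Y k.+1 x =
      2^-1 *: (Y k.+1 (Y k.+1 x - Y k x) + (Y k.+1 (Y k x) - Y k (Y k x))).
    rewrite bopB addrA subrK (YS k.+1) [X in _ - X = _]YS -scalerBr; congr (_ *: _).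
    by rewrite opprD addrACA subrr add0r.
  have -> : (y k.+2 - y k.+1)%:C = 2^-1 * ((y k.+1)%:C * (y k.+1 - y k)%:C +
      (y k.+1 - y k)%:C * (y k)%:C).
    have -> : (2^-1 : R[i]) = (2^-1 : R)%:C by rewrite fmorphV rmorph_nat.
    rewrite -!(rmorphM, rmorphD); congr (_%:C).
    rewrite (yS k.+1) {2}(yS k); move: (y k.+1) (y k) => A B; by field.
  rewrite normrZ normfV normr_nat -mulrA ler_pM2l ?invr_gt0 // mulrDl.
  apply: le_trans (ler_normD _ _) _; apply: lerD.
    apply: le_trans (Yb _ _) _; rewrite -mulrA ler_wpM2l // ler0c.
    exact: sqrt_bound_ge0.
  apply: le_trans (IH _) _; rewrite -mulrA ler_wpM2l // ler0c subr_ge0.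
  exact: sqrt_bound_leS.
have Ydl k l x : `|Y (k + l)%N x - Y k x| <= (y (k + l)%N - y k)%:C * `|x|.
  elim: l => [|l IH]; first by rewrite addn0 !subrr normr0 mul0r.
  rewrite addnS; apply: le_trans (ler_normC_sub _ (Y (k + l)%N x) _) _.
  by apply: le_trans (lerD (Yd _ _) IH) _; rewrite -mulrDl -rmorphD addrA subrK.
have yc : cvgn y.
  apply: nondecreasing_is_cvgn; first by apply/nondecreasing_seqP => k; exact: sqrt_bound_leS.
  by exists 1 => _ [k _ <-]; exact: sqrt_bound_le1.
have yle k : y k <= limn y.
  by apply: nondecreasing_cvgn_le => //; apply/nondecreasing_seqP => j; exact: sqrt_bound_leS.
have Yc x : exists z : H, (fun k => Y k x) @ \oo --> z.
  apply: cauchy_seq_cvg => e e0.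
  have d0 : 0 < e / 2 / (rnorm x + 1).
    by rewrite !divr_gt0 // ltr_wpDl // rnorm_ge0.
  have /cvgrPdist_le/(_ _ d0)[N _ HN] := yc.
  have key k : (N <= k)%N -> `|Y k x - Y N x| <= (e / 2)%:C.
    move=> Nk; have /= := HN N (leqnn _); rewrite ger0_norm ?subr_ge0 // => h1.
    rewrite -(subnKC Nk); apply: le_trans (Ydl _ _ _) _; rewrite (subnKC Nk) rnormE -rmorphM lecR.
    apply: (@le_trans _ _ (e / 2 / (rnorm x + 1) * (rnorm x + 1))); last first.
      by rewrite divfK // gt_eqF // ltr_wpDl // rnorm_ge0.
    apply: ler_pM; rewrite ?rnorm_ge0 ?lerDl // ?subr_ge0.
      rewrite -(subnKC Nk); elim: (k - N)%N => [|j IH]; first by rewrite addn0.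
      by rewrite addnS (le_trans IH) // sqrt_bound_leS.
    by apply: le_trans h1; rewrite lerD2r.
  exists N => k l Nk Nl; apply: le_trans (ler_normC_sub _ (Y N x) _) _.
  rewrite (splitr e) rmorphD lerD ?key // distrC; exact: key.
have [f fP] := choice Yc.
have fl : linear f.
  move=> c a b; apply: (@cvg_uniq _ _ _ _ _ (fP _)).
  rewrite (_ : (fun k => _) = fun k => c *: Y k a + Y k b).
    have h1 : c *: Y k a @[k --> \oo] --> c *: f a by apply: (@cvgZr _ H); exact: fP.
    exact: (@cvgD _ H _ \oo _ _ _ _ _ h1 (fP b)).
  by apply/funext => k; rewrite bop_linear.
have fb x : `|f x| <= 1%:C * `|x|.
  have h : `|Y k x| @[k --> \oo] --> `|f x| by apply: cvg_norm; exact: fP.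
  apply: cvgC_le h; apply: nearW => k; apply: le_trans (Yb _ _) _.
  by rewrite ler_wpM2r // lecR sqrt_bound_le1.
pose F := mkbopM fl fb.
have Fsa x z : hdot (F x) z = hdot x (F z).
  have h1 : hdot (Y k x) z @[k --> \oo] --> hdot (F x) z by apply: cvg_hdotl; exact: fP.
  apply: (cvg_uniq h1); under eq_fun do rewrite Ysa hdotC.
  by rewrite hdotC; apply: cvg_conj; apply: cvg_hdotl; exact: fP.
have FE x : F x = 2^-1 *: (X x + F (F x)).
  have YY2 : Y k (Y k x) @[k --> \oo] --> F (F x).
    apply/cvgC_seqP => e e0; have e2 : 0 < e / 2 by rewrite divr_gt0.
    have [N1 h1] := (cvgC_seqP _ _).1 (fP x) _ e2.
    have [N2 h2] := (cvgC_seqP _ _).1 (fP (f x)) _ e2.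
    exists (maxn N1 N2) => k; rewrite geq_max => /andP[/h1 k1 /h2 k2].
    apply: le_trans (ler_normC_sub _ (Y k (f x)) _) _.
    rewrite (splitr e) rmorphD lerD // -bopB; apply: le_trans (Yb _ _) _.
    apply: le_trans k1; rewrite -[leRHS]mul1r ler_wpM2r // lecR; exact: sqrt_bound_le1.
  have h0 : (fun k => Y k.+1 x) @ \oo --> F x.
    by have := fP x; rewrite -(cvg_shiftS (fun k => Y k x)).
  apply: (cvg_uniq h0); under eq_fun do rewrite YS.
  apply: (@cvgZr _ H); have hc : (fun=> X x) @ \oo --> X x by exact: cvg_cst.
  exact: (@cvgD _ H _ \oo _ _ _ _ _ hc YY2).
exists (bid H - F); split.
  move=> x; rewrite bop_subE hdotBl subr_ge0 /= -[hdot (f x) x]/(hdot (F x) x) hdot_norm.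
  have Fr : hdot (F x) x \is Num.real by apply/CrealP; rewrite -hdotC Fsa.
  apply: le_trans (real_ler_norm Fr) _; apply: le_trans (hdot_le _ _) _.
  by rewrite expr2 ler_wpM2r //; have := fb x; rewrite mul1r.
apply: bop_ext => x; change (x - F x - F (x - F x) = x - X x); rewrite bopB.
have := FE x; set u := F x; set w := F u => h.
have -> : u - w = X x - u.
  apply/eqP; rewrite subr_eq addrAC eq_sym subr_eq -mulr2n -scaler_nat h scalerA divff ?pnatr_eq0 //.
  by rewrite scale1r.
by rewrite opprB addrA subrK.
Qed.

(** Dividing T by a bound of its norm brings it between 0 and 1. *)
Lemma sqrt_exists H (T : bop H H) : bpos T -> exists S : bop H H, bpos S /\ S ∘ S = T.
Proof.
move=> Tp; have [M M0 TM] := bop_bounded T.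
pose T' := (M^-1)%:C *: T; pose X := bid H - T'.
have Mi : 0 < (M^-1)%:C :> R[i] by rewrite ltcR invr_gt0.
have h1 x : hdot (T' x) x <= `|x| ^+ 2.
  rewrite hdotZl rmorphV ?unitfE ?gt_eqF //= ler_pdivrMl ?ltcR //.
  rewrite (le_trans (real_ler_norm (ger0_real (Tp x)))) //.
  by rewrite (le_trans (hdot_le _ _)) // expr2 mulrA ler_wpM2r.
have Xp : bpos X by move=> x; rewrite bop_subE hdotBl hdot_norm subr_ge0 h1.
have X1 x : hdot (X x) x <= `|x| ^+ 2.
  by rewrite bop_subE hdotBl hdot_norm gerBl hdotZl mulr_ge0 ?Tp ?(ltW Mi).
have [S [Sp SS]] := sqrt_exists1 Xp X1.
have sM : 0 <= (Num.sqrt M)%:C :> R[i] by rewrite ler0c sqrtr_ge0.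
exists ((Num.sqrt M)%:C *: S); split; first by move=> x; rewrite hdotZl mulr_ge0 ?Sp.
apply: bop_ext => x.
change ((Num.sqrt M)%:C *: S ((Num.sqrt M)%:C *: S x) = T x); rewrite bopZ scalerA -rmorphM -expr2 sqr_sqrtr ?ltW //.
have := congr1 (fun B : bop H H => B x) SS; rewrite /= => ->.
rewrite -[X in _ *: X]/(x - (x - (M^-1)%:C *: T x)) opprB addrC subrK scalerA -rmorphM divff ?gt_eqF //.
by rewrite scale1r.
Qed.

Lemma bsqrtP H (T : bop H H) : bpos T -> bpos (bsqrt T) /\ bsqrt T ∘ bsqrt T = T.
Proof. by move=> /sqrt_exists /(xgetPex 0). Qed.

End SquareRoot.

(** * Extension by density *)

Section Extension.
Variable R : realType.
Implicit Types H K L : hilbertType R.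

Lemma rnorm_tri (V : normedModType R[i]) (x y : V) : rnorm (x + y) <= rnorm x + rnorm y.
Proof. by rewrite -lecR; have := ler_normD x y; rewrite !rnormE -rmorphD. Qed.

Lemma rnorm_dist (V : normedModType R[i]) (x y : V) : rnorm (x - y) = rnorm (y - x).
Proof. by rewrite /rnorm distrC. Qed.

Definition spanning H (A : set H) : Prop := forall z, closure (lspan A) z.

Lemma total_approx H (A : set H) : spanning A -> forall (z : H) (e : R), 0 < e ->
  exists2 x, lspan A x & `|z - x| <= e%:C.
Proof.
move=> tA z e e0; have /closure_normP/(_ e%:C) := tA z.
rewrite ltcR => /(_ e0)[x Ax zx]; exists x => //; exact: ltW.
Qed.

Lemma clspan_min H (S : set H) (V : csubspace H) : S `<=` cset V ->
  cset (clspan S) `<=` cset V.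
Proof.
move=> SV; rewrite ((closure_id (cset V)).1 (@cset_closed _ _ V)).
apply: closure_subset => _ [k [c [s [As ->]]]].
elim/big_ind: _ => [|x y Vx Vy|i _]; first exact: cset0.
  by rewrite -[x]scale1r; apply: csetP.
by rewrite -[X in cset V X]addr0; apply: csetP; [exact/SV|exact: cset0].
Qed.

Lemma dense_closed H (A : set H) (V : csubspace H) : spanning A -> A `<=` cset V ->
  forall z, cset V z.
Proof. by move=> tA AV z; exact: clspan_min AV z (tA z). Qed.

Lemma dense_orth H (A : set H) (x : H) : spanning A -> (forall a, A a -> hdot x a = 0) -> x = 0.
Proof.
move=> tA xA; apply: hdot_nullr => y; rewrite hdotC.
suff -> : hdot y x = 0 by rewrite conjC0.
apply: (@dense_closed _ A (orthc [set x]) tA _ y) => // a Aa _ ->.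
by rewrite hdotC xA // conjC0.
Qed.

Lemma ker_closed H K (T : bop H K) : closed [set x | T x = 0].
Proof.
apply: (@closed_comp _ _ T [set 0]) => [x _|]; first exact: bop_continuous.
exact: (@accessible_closed_set1 _ (hausdorff_accessible (@norm_hausdorff _ K))).
Qed.

Lemma bop_dense_ext H K (A : set H) (S T : bop H K) : spanning A ->
  (forall a, A a -> S a = T a) -> S = T.
Proof.
move=> tA ST; pose D := S - T.
have kl (c : R[i]) (x y : H) : D x = 0 -> D y = 0 -> D (c *: x + y) = 0.
  by move=> Dx Dy; rewrite bop_linear Dx Dy scaler0 addr0.
pose V := CSubspace (bop0 D) kl (@ker_closed _ _ D).
apply: bop_ext => z; apply/eqP; rewrite -subr_eq0 -bop_subE; apply/eqP.
apply: (@dense_closed _ A V tA _ z) => a Aa.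
by change (S a - T a = 0); rewrite ST // subrr.
Qed.

(** The combinations of the t i and of the t' i form a bounded linear relation,
    and the closure of a bounded relation is the graph of a bounded map. The
    inequality makes the map well defined even when the t i are linearly
    dependent. *)
Lemma dense_extension H K (I : Type) (t : I -> H) (t' : I -> K) (M : R) : 0 <= M ->
  (forall k (c : 'I_k -> R[i]) (s : 'I_k -> I),
     `|\sum_i c i *: t' (s i)| <= M%:C * `|\sum_i c i *: t (s i)|) ->
  spanning (range t) ->
  exists Z : bop H K, (forall i, Z (t i) = t' i) /\ (forall z, `|Z z| <= M%:C * `|z|).
Proof.
move=> M0 tM tot.
pose G x y := exists k (c : 'I_k -> R[i]) (s : 'I_k -> I),
  x = \sum_i c i *: t (s i) /\ y = \sum_i c i *: t' (s i).
have Glin (a : R[i]) x y x' y' : G x y -> G x' y' -> G (a *: x + x') (a *: y + y').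
  move=> [k [c [s [-> ->]]]] [l [b [u [-> ->]]]]; exists (k + l)%N.
  exists (fun i : 'I_(k + l) => match fintype.split i with inl i => a * c i | inr i => b i end).
  exists (fun i : 'I_(k + l) => match fintype.split i with inl i => s i | inr i => u i end).
  split; rewrite big_split_ord scaler_sumr /=; congr (_ + _); apply: eq_bigr => i _;
    by rewrite ?(unsplitK (inl i)) ?(unsplitK (inr i)) ?scalerA.
have GM x y : G x y -> `|y| <= M%:C * `|x| by move=> [k [c [s [-> ->]]]]; exact: tM.
have GB x y x' y' : G x y -> G x' y' -> `|y - y'| <= M%:C * `|x - x'|.
  move=> g g'; apply: GM.
  by rewrite -(addrC (- x')) -(addrC (- y')) -[- x']scaleN1r -[- y']scaleN1r; apply: Glin.
have Gap (z : H) (e : R) : 0 < e -> exists x y, G x y /\ `|z - x| <= e%:C.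
  move=> e0; have [x [k [c [s [As ->]]]] zx] := total_approx tot z e0.
  have h i : exists r, t r = s i by have [r _] := As i; exists r.
  have [r rP] := choice h.
  exists (\sum_i c i *: s i), (\sum_i c i *: t' (r i)); split => //.
  by exists k, c, r; split=> //; apply: eq_bigr => i _; rewrite rP.
(* the closure of G *)
pose rel z y := forall e : R, 0 < e -> exists x w, [/\ G x w, `|z - x| <= e%:C & `|y - w| <= e%:C].
have relM z y : rel z y -> `|y| <= M%:C * `|z|.
  move=> zy; rewrite !rnormE -rmorphM lecR; apply: (@ler_addC_eps _ _ _ (1 + M)) => e e0.
  have [x [w [Gxw zx yw]]] := zy e e0.
  have h1 : rnorm w <= M * rnorm x by have := GM _ _ Gxw; rewrite !rnormE -rmorphM lecR.
  have h2 : rnorm x <= rnorm z + e.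
    by have := rnorm_tri (x - z) z; rewrite subrK rnorm_dist; move: zx; rewrite rnormE lecR; lra.
  have h3 : rnorm y <= e + rnorm w.
    by have := rnorm_tri (y - w) w; rewrite subrK; move: yw; rewrite rnormE lecR; lra.
  by nra.
have rell (c : R[i]) z y z' y' : rel z y -> rel z' y' -> rel (c *: z + z') (c *: y + y').
  move=> zy zy' e e0; have c0 : 0 < rnorm c + 1 by rewrite ltr_wpDl // rnorm_ge0.
  have d0 : 0 < e / (rnorm c + 1) by rewrite divr_gt0.
  have [x [w [g zx yw]]] := zy _ (divr_gt0 d0 (ltr0Sn R 1)).
  have [x' [w' [g' zx' yw']]] := zy' _ (divr_gt0 e0 (ltr0Sn R 1)).
  have bnd (V : normedModType R[i]) (p q p' q' : V) :
      `|p - q| <= (e / (rnorm c + 1) / 2)%:C -> `|p' - q'| <= (e / 2)%:C ->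
      `|c *: p + p' - (c *: q + q')| <= e%:C.
    move=> pq pq'; rewrite opprD addrACA -scalerBr; apply: le_trans (ler_normD _ _) _.
    rewrite [X in _ <= X%:C](splitr e) rmorphD; apply: lerD => //.
    rewrite normrZ; apply: (@le_trans _ _ (`|c| * (e / (rnorm c + 1) / 2)%:C)).
      by rewrite ler_wpM2l.
    rewrite rnormE -rmorphM lecR mulrA ler_pM2r ?invr_gt0 // mulrCA ler_piMr ?(ltW e0) //.
    by rewrite ler_pdivrMr // mul1r lerDl.
  by exists (c *: x + x'), (c *: w + w'); split; [exact: Glin|exact: bnd|exact: bnd].
have reli i : rel (t i) (t' i).
  move=> e e0; exists (t i), (t' i); split; rewrite ?subrr ?normr0 ?ler0c ?ltW //.
  by exists 1%N, (fun=> 1), (fun=> i); rewrite !big_ord1 !scale1r.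
have rele z : exists y, rel z y.
  have hk (k : nat) : exists xw : H * K, G xw.1 xw.2 /\ `|z - xw.1| <= (k.+1%:R^-1)%:C.
    have [|x [w [Gx zx]]] := Gap z k.+1%:R^-1; first by rewrite invr_gt0.
    by exists (x, w).
  have [u uP] := choice hk.
  have small e : 0 < e -> exists N, forall k, (N <= k)%N -> (k.+1%:R^-1 : R) <= e.
    move=> e0; have [N _ HN] := near_infty_natSinv_lt (PosNum e0).
    by exists N => k Nk; apply: ltW; exact: HN.
  have [y uy] : exists y : K, (fun k => (u k).2) @ \oo --> y.
    apply: cauchy_seq_cvg => e e0.
    have M1 : 0 < M + 1 by rewrite ltr_wpDl.
    have d0 : 0 < e / (M + 1) / 2 by rewrite !divr_gt0.
    have [N HN] := small _ d0; exists N => k l Nk Nl.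
    have [gk zk] := uP k; have [gl zl] := uP l.
    apply: le_trans (GB _ _ _ _ gk gl) _.
    apply: (@le_trans _ _ (M%:C * (e / (M + 1))%:C)).
      apply: ler_wpM2l; first by rewrite ler0c.
      apply: le_trans (ler_normC_sub _ z _) _; rewrite (splitr (e / (M + 1))) rmorphD.
      apply: lerD; first by rewrite distrC; apply: le_trans zk _; rewrite lecR HN.
      by apply: le_trans zl _; rewrite lecR HN.
    rewrite -rmorphM lecR mulrCA ler_piMr ?(ltW e0) //.
    by rewrite ler_pdivrMr // mul1r lerDl.
  exists y => e e0; have [N HN] := small _ e0.
  have [N' HN'] := (cvgC_seqP _ _).1 uy _ e0.
  exists (u (maxn N N')).1, (u (maxn N N')).2; have [g zz] := uP (maxn N N'); split=> //.
    by apply: le_trans zz _; rewrite lecR HN // leq_maxl.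
  by apply: HN'; rewrite leq_maxr.
have relu z y y' : rel z y -> rel z y' -> y = y'.
  move=> h h'; apply/eqP; rewrite -subr_eq0 -normr_le0.
  have := relM _ _ (rell (-1) _ _ _ _ h' h); rewrite !scaleN1r addNr normr0 mulr0.
  by rewrite addrC.
have [f fP] := choice rele.
have fl : linear f by move=> c a b; apply: relu _ _ _ (fP _) (rell c _ _ _ _ (fP a) (fP b)).
exists (mkbopM fl (fun x => relM _ _ (fP x))); split=> [i|z] /=; last exact: relM.
exact: relu _ _ _ (fP _) (reli i).
Qed.

End Extension.

(** * Operators on Hilbert space tensor products *)

Section Tensors.
Variable R : realType.

(** [tens_dot] and [tens_total] together determine the Hilbert space tensor
    product of U and K up to unitary equivalence; they hold for the Fock space
    with values in K and for its subspaces V (x) K alike. *)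
Definition tens_dot (U K T : hilbertType R) (t : U -> K -> T) : Prop :=
  forall x x' k k', hdot (t x k) (t x' k') = hdot x x' * hdot k k'.

Definition tens_total (U K T : hilbertType R) (t : U -> K -> T) : Prop :=
  spanning [set z | exists x k, z = t x k].

Variables (K : hilbertType R).

(** The norm estimate behind S (x) I: if |S| <= M and Q is the square root of
    M^2 - adj S S, then M^2 |sum_i c_i x_i (x) k_i|^2 exceeds
    |sum_i c_i S x_i (x) k_i|^2 by exactly |sum_i c_i Q x_i (x) k_i|^2. *)
Lemma btensP (U V T T' : hilbertType R) (t : U -> K -> T) (t' : V -> K -> T') (S : bop U V) :
  tens_dot t -> tens_dot t' -> tens_total t ->
  forall x k, btens t t' S (t x k) = t' (S x) k.
Proof.
move=> td td' tt.
suff : exists Z : bop T T', forall x k, Z (t x k) = t' (S x) k by move=> /(xgetPex 0).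
have [M M0 SM] := bop_bounded S.
pose t1 (p : U * K) := t p.1 p.2; pose t2 (p : U * K) := t' (S p.1) p.2.
have bnd j (c : 'I_j -> R[i]) (s : 'I_j -> U * K) :
    `|\sum_i c i *: t2 (s i)| <= M%:C * `|\sum_i c i *: t1 (s i)|.
  pose P := (M ^+ 2)%:C *: bid U - (adj S ∘ S).
  have Pp : bpos P.
    move=> x; rewrite bop_subE hdotBl bop_scaleE hdotZl hdot_norm subr_ge0 /=.
    rewrite -adjPr hdot_norm rmorphXn -exprMn ler_pXn2r ?nnegrE //.
    by rewrite mulr_ge0 // ler0c ltW.
  have [Qp QQ] := bsqrtP Pp; set Q := bsqrt P in Qp QQ.
  have MC : 0 <= M%:C :> R[i] by rewrite ler0c ltW.
  rewrite -(@ler_pXn2r _ 2) ?nnegrE ?mulr_ge0 // exprMn -!hdot_norm.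
  rewrite -subr_ge0 (_ : _ - _ = hdot (\sum_i c i *: t (Q (s i).1) (s i).2)
      (\sum_i c i *: t (Q (s i).1) (s i).2)); first exact: hdot_ge0.
  rewrite !hdot_suml mulr_sumr -sumrB; apply: eq_bigr => i _.
  rewrite !hdot_sumr mulr_sumr -sumrB; apply: eq_bigr => l _.
  rewrite !hdotZl !hdotZr td td' td (bpos_sa Qp).
  rewrite -[Q (Q _)]/((Q ∘ Q) _) QQ -(bpos_sa Pp) bop_subE hdotBl bop_scaleE hdotZl /=.
  by rewrite -adjPr rmorphXn; ring.
have tot : spanning (range t1).
  move=> z; apply: closure_subset (tt z) => _ [m [c [s [As ->]]]].
  exists m, c, s; split=> // i; have [x [k ->]] := As i; by exists (x, k).
have [Z [Zt _]] := dense_extension (ltW M0) bnd tot.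
by exists Z => x k; exact: (Zt (x, k)).
Qed.

Lemma tens_ext (U T L : hilbertType R) (t : U -> K -> T) (S S' : bop T L) : tens_total t ->
  (forall x k, S (t x k) = S' (t x k)) -> S = S'.
Proof. by move=> tt SS'; apply: bop_dense_ext tt _ => _ [x [k ->]]. Qed.

Lemma btens_comp (U V W T T' T'' : hilbertType R) (t : U -> K -> T) (t' : V -> K -> T')
    (t'' : W -> K -> T'') (S : bop V W) (S' : bop U V) :
  tens_dot t -> tens_dot t' -> tens_dot t'' -> tens_total t -> tens_total t' ->
  btens t t'' (S ∘ S') = btens t' t'' S ∘ btens t t' S'.
Proof.
move=> td td' td'' tt tt'; apply: (tens_ext tt) => x k.
rewrite (btensP _ td td'' tt) -[RHS]/(btens t' t'' S (btens t t' S' (t x k))).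
by rewrite (btensP _ td td' tt) (btensP _ td' td'' tt').
Qed.

Lemma btens_adj (U V T T' : hilbertType R) (t : U -> K -> T) (t' : V -> K -> T') (S : bop U V) :
  tens_dot t -> tens_dot t' -> tens_total t -> tens_total t' ->
  adj (btens t t' S) = btens t' t (adj S).
Proof.
move=> td td' tt tt'; apply: (tens_ext tt') => x k.
apply/eqP; rewrite -subr_eq0; apply/eqP; apply: (dense_orth tt) => _ [x' [k' ->]].
by rewrite hdotBl -adjPr (btensP _ td td' tt) (btensP _ td' td tt') td td' -adjPr subrr.
Qed.

Lemma btens_lin (U V T T' : hilbertType R) (t : U -> K -> T) (t' : V -> K -> T')
    (c : R[i]) (S S' : bop U V) :
  (forall c x x' k, t' (c *: x + x') k = c *: t' x k + t' x' k) ->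
  tens_dot t -> tens_dot t' -> tens_total t ->
  btens t t' (c *: S + S') = c *: btens t t' S + btens t t' S'.
Proof.
move=> tl td td' tt; apply: (tens_ext tt) => x k.
by rewrite -[RHS]/(c *: btens t t' S (t x k) + btens t t' S' (t x k)) !(btensP _ td td' tt) -tl.
Qed.

Lemma btens_id (U T : hilbertType R) (t : U -> K -> T) :
  tens_dot t -> tens_total t -> btens t t (bid U) = bid T.
Proof. by move=> td tt; apply: (tens_ext tt) => x k; rewrite (btensP _ td td tt). Qed.

End Tensors.

(** * Fock spaces *)

Section LengthSums.
Variable n : nat.

Lemma lsum_ext (V : nmodType) (F G : seq 'I_n -> V) N : F =1 G -> lsum F N = lsum G N.
Proof. by move=> /funext ->. Qed.

Lemma lsum_delta (V : nmodType) (s : seq 'I_n) (F : seq 'I_n -> V) N :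
  lsum (fun t => if t == s then F t else 0) N = if (size s < N)%N then F s else 0.
Proof.
rewrite /lsum; have z j : (j == size s :> nat) = false ->
    \sum_(t : j.-tuple 'I_n) (if val t == s then F t else 0) = 0.
  move=> js; rewrite big1 // => t _; case: eqP => // ts.
  by move: js; rewrite -ts size_tuple eqxx.
case: ltnP => sN; last first.
  rewrite big1 // => j _; apply: z.
  by apply/eqP => js; have := ltn_ord j; rewrite js ltnNge sN.
rewrite (bigD1 (Ordinal sN)) //= [X in _ + X]big1 ?addr0; last first.
  by move=> j /negbTE js; apply: z; rewrite -js.
rewrite (bigD1 (in_tuple s)) //= [X in _ + X]big1 ?addr0 ?eqxx //.
move=> t /negbTE ts.
by rewrite -[s]/(val (in_tuple s)) val_eqE ts.
Qed.

Lemma big_tuple_cons (V : nmodType) k (G : seq 'I_n -> V) :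
  \sum_(t : k.+1.-tuple 'I_n) G t = \sum_i \sum_(s : k.-tuple 'I_n) G (i :: s).
Proof.
rewrite pair_bigA /=.
rewrite (reindex (fun p : 'I_n * k.-tuple 'I_n => [tuple of p.1 :: p.2])) //=.
exists (fun t => (thead t, behead_tuple t)) => [[i t] _|t _] /=.
  by rewrite theadE; congr (_, _); apply: val_inj.
by case/tupleP: t => i t; apply: val_inj => /=; rewrite theadE.
Qed.

Lemma lsum_cons (V : nmodType) (G : seq 'I_n -> V) N :
  lsum G N.+1 = G [::] + \sum_i lsum (fun s => G (i :: s)) N.
Proof.
rewrite /lsum big_ord_recl; congr (_ + _).
  rewrite (bigD1 [tuple]) //= big1 ?addr0 // => t.
  by case/eqP; exact: tuple0.
by rewrite exchange_big; apply: eq_bigr => k _ /=; rewrite big_tuple_cons.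
Qed.

Lemma lsum_raddf (U V : nmodType) (f : U -> V) (F : seq 'I_n -> U) N :
  f 0 = 0 -> {morph f : x y / x + y} -> f (lsum F N) = lsum (fun s => f (F s)) N.
Proof.
move=> f0 fD; rewrite /lsum (big_morph f fD f0); apply: eq_bigr => k _.
by rewrite (big_morph f fD f0).
Qed.

End LengthSums.

Section Fock.
Variables (n : nat) (R : realType).
Implicit Types K : hilbertType R.

Lemma fockD K (x y : fock n K) s : (x + y) s = x s + y s. Proof. by []. Qed.
Lemma fockZ K c (x : fock n K) s : (c *: x) s = c *: x s. Proof. by []. Qed.
Lemma fockN K (x : fock n K) s : (- x) s = - x s. Proof. by []. Qed.
Lemma fock0 K s : (0 : fock n K) s = 0. Proof. by []. Qed.

Lemma fock_ext K (x y : fock n K) : (forall s, x s = y s) -> x = y.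
Proof. by move=> xy; apply: val_inj; apply/funext. Qed.

Lemma hdot_single K (x : fock n K) s (k : K) : hdot x (single s k) = hdot (x s) k.
Proof.
have h := @fock_dot_cvg _ _ _ x (single s k).
apply: (cvg_uniq h); apply/cvgC_seqP => e e0; exists (size s).+1 => N sN.
rewrite (_ : lsum _ N = hdot (x s) k) ?subrr ?normr0 ?ler0c ?ltW //.
rewrite (@lsum_ext _ _ _ (fun t => if t == s then hdot (x t) k else 0)).
  by rewrite lsum_delta sN.
by move=> t /=; rewrite /single_fun; case: eqP; rewrite ?hdot0r.
Qed.

Definition ftrunc K (x : fock n K) (N : nat) : fock n K := lsum (fun s => single s (x s)) N.

Lemma hdot_ftrunc K (x y : fock n K) N :
  hdot x (ftrunc y N) = lsum (fun s => hdot (x s) (y s)) N.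
Proof.
rewrite (lsum_raddf _ _ (hdot0r x) (fun u v => hdotDr u v x)).
by apply: lsum_ext => s; rewrite hdot_single.
Qed.

Lemma ftruncE K (x : fock n K) N s : ftrunc x N s = if (size s < N)%N then x s else 0.
Proof.
rewrite (lsum_raddf (f := fun y : fock n K => y s)) //.
rewrite (@lsum_ext _ _ _ (fun t => if t == s then x t else 0)) ?lsum_delta //.
by move=> t /=; rewrite /single_fun eq_sym; case: eqP.
Qed.

Lemma hdot_ftrunc2 K (x : fock n K) N : hdot (ftrunc x N) (ftrunc x N) =
  lsum (fun s => `|x s| ^+ 2) N.
Proof.
rewrite hdot_ftrunc /lsum; apply: eq_bigr => k _; apply: eq_bigr => s _.
by rewrite ftruncE size_tuple ltn_ord hdot_norm.
Qed.

Lemma norm_ftrunc K (x : fock n K) N : `|ftrunc x N| <= `|x|.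
Proof.
rewrite -(@ler_pXn2r _ 2) ?nnegrE // -hdot_norm hdot_ftrunc2; exact: fock_lsum_le.
Qed.

Lemma ftrunc_cvg K (x : fock n K) : ftrunc x N @[N --> \oo] --> x.
Proof.
have E N : `|x - ftrunc x N| ^+ 2 = hdot x x - lsum (fun s => hdot (x s) (x s)) N.
  rewrite -hdot_norm hdotBl !hdotBr hdot_ftrunc2 hdot_ftrunc [hdot (ftrunc _ _) x]hdotC.
  rewrite hdot_ftrunc -lsum_conj.
  have -> : (fun s => `|x s| ^+ 2) = fun s => hdot (x s) (x s).
    by apply/funext => s; rewrite hdot_norm.
  have -> : (fun s => (hdot (x s) (x s))^*) = fun s => hdot (x s) (x s).
    by apply/funext => s; rewrite -hdotC.
  by rewrite subrr subr0.
apply/cvgC_seqP => e e0; have e2 : 0 < e ^+ 2 by rewrite exprn_gt0.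
have [N HN] := (cvgC_seqP _ _).1 (@fock_dot_cvg _ _ _ x x) _ e2.
exists N => k /HN h; rewrite -(@ler_pXn2r _ 2) ?nnegrE ?ler0c ?(ltW e0) //.
rewrite E -rmorphXn; apply: le_trans h; rewrite real_ler_norm // -E.
by rewrite rpredX // normr_real.
Qed.

Lemma fock_dense K : spanning [set z : fock n K | exists (s : seq 'I_n) (k : K), z = single s k].
Proof.
set A := mkset _ => x; have xt := @ftrunc_cvg K x.
have Al : forall y, lspan A y -> cset (clspan A) y by move=> y; exact: subset_closure.
have Vs (s : seq 'I_n) k : cset (clspan A) (single s k) by apply/Al/sub_lspan; exists s, k.
apply: (@closed_cvg _ _ \oo _ (ftrunc x) (cset (clspan A)) (@cset_closed _ _ _) _ x xt).
apply: nearW => N.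
have add0 (y : fock n K) z : cset (clspan A) y -> cset (clspan A) z -> cset (clspan A) (y + z).
  by move=> Vy Vz; rewrite -[y]scale1r; apply: csetP.
rewrite /ftrunc /lsum; elim/big_ind: _ => [||k _]; [exact: cset0|exact: add0|].
by elim/big_ind: _ => [||s _]; [exact: cset0|exact: add0|exact: Vs].
Qed.

Lemma ftens_fvec K (s : seq 'I_n) (k : K) : ftens (fvec R s) k = single s k.
Proof.
apply: fock_ext => t /=; rewrite /single_fun.
by case: eqP => _; rewrite ?scale1r ?scale0r.
Qed.

Lemma ftens_total K : tens_total (@ftens n R K).
Proof.
move=> x; apply: closure_subset (@fock_dense K x) => _ [j [c [s [As ->]]]].
exists j, c, s; split=> // i; have [u [k ->]] := As i; exists (fvec R u), k.
by rewrite ftens_fvec.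
Qed.

Lemma selem_dot (V : csubspace (fock n R[i])) K : tens_dot (@selem n R V K).
Proof. by move=> x x' k k'; rewrite csub_hdot hdot_ftens. Qed.

Lemma selem_total (V : csubspace (fock n R[i])) K : tens_total (@selem n R V K).
Proof.
move=> z; apply/closure_normP => e e0.
have Vz : cset (stens V K) (val z) by apply/set_mem/csub_valP.
have [_ [j [c [s [As ->]]]] zs] := (closure_normP _ _).1 Vz e e0.
have h i : exists p : V * K, s i = ftens (val p.1) p.2.
  by have [x [k ->]] := As i; exists (x, k).
have [p ps] := choice h.
exists (\sum_i c i *: selem (p i).1 (p i).2).
  exists j, c, (fun i => selem (p i).1 (p i).2); split=> // i.
  by exists (p i).1, (p i).2.
rewrite csub_norm raddfB raddf_sum /=; move: zs.
rewrite (eq_bigr (fun i => c i *: ftens (val (p i).1) (p i).2)) // => i _.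
by rewrite ps.
Qed.

Lemma ftens_lin K c (x x' : fock n R[i]) (k : K) :
  ftens (c *: x + x') k = c *: ftens x k + ftens x' k.
Proof.
apply: fock_ext => s; rewrite fockD fockZ.
have E (y : fock n R[i]) : ftens y k s = (y s : R[i]) *: k by [].
rewrite !E fock_linE scalerDl; congr (_ + _).
by rewrite -scalerA.
Qed.

Lemma selem_lin (V : csubspace (fock n R[i])) K c (x x' : V) (k : K) :
  selem (c *: x + x') k = c *: selem x k + selem x' k.
Proof.
apply: val_inj; rewrite linearP -[LHS]/(ftens (val (c *: x + x')) k) linearP.
exact: ftens_lin.
Qed.

Lemma hdotCE (x y : R[i]) : hdot x y = x * y^*.
Proof. by []. Qed.

Lemma hdot_fvec (x : fock n R[i]) s : hdot x (fvec R s) = x s.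
Proof. by rewrite hdot_single hdotCE conjC1 mulr1. Qed.

End Fock.

(** * Noncommutative power series with nonnegative coefficients *)

Section WordSums.
Variables (n : nat) (R : realType).
Implicit Types (u v : seq 'I_n) (a c : seq 'I_n -> R).

Lemma esum_seq (T : choiceType) (r : seq T) (f : T -> \bar R) : uniq r ->
  (forall x, (0 <= f x)%E) -> (\esum_(x in [set` r]) f x = \sum_(x <- r) f x)%E.
Proof.
move=> ur f0; rewrite esum_fset; [|exact: finite_seq|by []].
by rewrite -(fsbig_seq _ _ ur).
Qed.

(** Sums over words are unconditional, with values in the extended reals, so
    that they can be regrouped freely; [lsum_wsum] relates them to sums by
    increasing length. *)
Definition wsum (F : seq 'I_n -> R) : \bar R := \esum_(u in [set: seq 'I_n]) (F u)%:E.

Lemma wsum_size k (F : seq 'I_n -> R) : (forall u, 0 <= F u) ->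
  \esum_(u in [set u : seq 'I_n | size u = k]) (F u)%:E = (\sum_(t : k.-tuple 'I_n) F t)%:E.
Proof.
move=> F0; have -> : [set u : seq 'I_n | size u = k] = [set` map val (enum {:k.-tuple 'I_n})].
  apply/seteqP; split=> u /=.
    by move=> /eqP uk; apply/mapP; exists (Tuple uk) => //; exact: mem_enum.
  by move=> /mapP[t _ ->]; exact: size_tuple.
have f0 u : (0 <= (F u)%:E)%E by rewrite lee_fin.
have ur : uniq (map val (enum {:k.-tuple 'I_n})) by rewrite (map_inj_uniq val_inj) enum_uniq.
by rewrite (esum_seq ur f0) big_map big_enum /= sumEFin.
Qed.

Lemma lsum_wsum (F : seq 'I_n -> R) : (forall u, 0 <= F u) ->
  (lsum F N)%:E @[N --> \oo] --> wsum F.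
Proof.
move=> F0; have -> : wsum F = (\sum_(0 <= k <oo) (\sum_(t : k.-tuple 'I_n) F t)%:E)%E.
  rewrite /wsum; have -> : [set: seq 'I_n] = \bigcup_k [set u : seq 'I_n | size u = k].
    by apply/seteqP; split=> u // _; exists (size u).
  rewrite nneseries_sum_bigcup; last 2 first.
  - by apply/trivIsetP => i j _ _ ij; apply/seteqP; split=> u // [/= ui uj]; case/eqP: ij; rewrite -ui.
  - by move=> u; rewrite lee_fin.
  by apply: eq_eseriesr => k _; rewrite wsum_size.
have -> : (fun N => (lsum F N)%:E) =
    (fun N => \sum_(0 <= k < N) (\sum_(t : k.-tuple 'I_n) F t)%:E)%E.
  by apply/funext => N; rewrite big_mkord sumEFin.
by apply: is_cvg_nneseries => k _ _; rewrite lee_fin sumr_ge0.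
Qed.

Lemma wsum_cvg (F : seq 'I_n -> R) (l : R) : (forall u, 0 <= F u) ->
  lsum F @ \oo --> l -> wsum F = l%:E.
Proof.
move=> F0 Fl; apply: (@cvg_unique _ (@ereal_hausdorff R) _ _ _ _ (lsum_wsum F0)).
by apply: cvg_EFin => //; apply: nearW.
Qed.

Lemma cvg_wsum (F : seq 'I_n -> R) (l : R) : (forall u, 0 <= F u) ->
  wsum F = l%:E -> lsum F @ \oo --> l.
Proof. by move=> F0 Fl; have := lsum_wsum F0; rewrite Fl => /fine_cvgP[_]. Qed.

(** Coefficients of the product of two noncommutative power series. *)
Definition wconv a c u : R := \sum_(i < (size u).+1) a (take i u) * c (drop i u).

(** A pair of words is the same thing as a word with a marked cut. *)
Lemma wsum_conv a c (F : seq 'I_n -> R) : (forall u, 0 <= a u) -> (forall u, 0 <= c u) ->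
    (forall u, 0 <= F u) ->
  \esum_(u in [set: seq 'I_n]) \esum_(v in [set: seq 'I_n]) (a u * c v * F (u ++ v))%:E =
  wsum (fun u => wconv a c u * F u).
Proof.
move=> a0 c0 F0; rewrite esum_esum; last by move=> *; rewrite lee_fin !mulr_ge0.
have -> : wsum (fun u => wconv a c u * F u) =
    \esum_(u in [set: seq 'I_n]) \esum_(i in [set` iota 0 (size u).+1])
      (a (take i u) * c (drop i u) * F u)%:E.
  apply: eq_esum => u _; rewrite esum_seq ?iota_uniq //; last first.
    by move=> i; rewrite lee_fin !mulr_ge0.
  rewrite sumEFin /wconv mulr_suml -(big_mkord xpredT (fun i => a (take i u) * c (drop i u) * F u)).
  by rewrite /index_iota subn0.
rewrite esum_esum; last by move=> *; rewrite lee_fin !mulr_ge0.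
rewrite (@reindex_esum _ _ _ ([set: seq 'I_n] `*`` (fun u => [set` iota 0 (size u).+1]))
    _ (fun p => (take p.2 p.1, drop p.2 p.1))).
  by apply: eq_esum => -[u i] _ /=; rewrite cat_take_drop.
have iotaE i N : [set` iota 0 N.+1] i <-> (i <= N)%N by rewrite /mkset mem_iota.
split.
- by [].
- move=> [u i] [v j] /set_mem[_ /iotaE iu] /set_mem[_ /iotaE jv] [e1 e2].
  rewrite /= in iu jv.
  have uv : u = v by rewrite -(cat_take_drop i u) e1 e2 cat_take_drop.
  rewrite uv in iu e1 *; congr (_, _).
  by rewrite -(size_takel iu) e1 size_takel.
- move=> [u v] _; exists (u ++ v, size u); last by rewrite take_size_cat // drop_size_cat.
  by split; [|apply/iotaE; rewrite size_cat leq_addr].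
Qed.

Definition wdelta u : R := (u == [::])%:R.
Definition wpow a k : seq 'I_n -> R := iter k (wconv a) wdelta.

(** Coefficients of (1 - f)^(-m) = sum_k C(k + m - 1, k) f^k, where f is the
    power series with coefficients a. For m = 0 the truncated subtraction still
    gives the series 1, since C(0, 0) = 1 and C(k - 1, k) = 0 for k > 0. *)
Definition wbin a m u : R := \sum_(k < (size u).+1) 'C(k + m - 1, k)%:R * wpow a k u.

Lemma wconv_ge0 a c : (forall u, 0 <= a u) -> (forall u, 0 <= c u) -> forall u, 0 <= wconv a c u.
Proof. by move=> a0 c0 u; apply: sumr_ge0 => i _; apply: mulr_ge0. Qed.

Lemma le_wconv a c c' : (forall u, 0 <= a u) -> (forall u, c u <= c' u) ->
  forall u, wconv a c u <= wconv a c' u.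
Proof. by move=> a0 cc' u; apply: ler_sum => i _; apply: ler_wpM2l. Qed.

Lemma iter_wconv_ge0 a c k : (forall u, 0 <= a u) -> (forall u, 0 <= c u) ->
  forall u, 0 <= iter k (wconv a) c u.
Proof. by move=> a0 c0; elim: k => //= k IH u; apply: wconv_ge0. Qed.

Lemma wconv_short a c : a [::] = 0 -> forall u,
  wconv a c u = \sum_(i < size u) a (take i.+1 u) * c (drop i.+1 u).
Proof. by move=> a0 u; rewrite /wconv big_ord_recl take0 a0 mul0r add0r. Qed.

(** Without constant term, each factor f uses up at least one letter. *)
Lemma iter_wconv_short a c k u : a [::] = 0 -> (size u < k)%N -> iter k (wconv a) c u = 0.
Proof.
move=> a0; elim: k u => // k IH u uk; rewrite iterS wconv_short //.
apply: big1 => i _; rewrite IH ?mulr0 // size_drop.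
by have := ltn_ord i; lia.
Qed.

Lemma wbinE a m N u : a [::] = 0 -> (size u <= N)%N ->
  wbin a m u = \sum_(k < N.+1) 'C(k + m - 1, k)%:R * wpow a k u.
Proof.
move=> a0 uN; rewrite /wbin -(big_mkord xpredT (fun k => 'C(k + m - 1, k)%:R * wpow a k u)).
rewrite -(big_mkord xpredT (fun k => 'C(k + m - 1, k)%:R * wpow a k u)).
rewrite [RHS](@big_cat_nat _ _ _ (size u).+1) //= [X in _ = _ + X]big_nat_cond.
rewrite [X in _ = _ + X]big1 ?addr0 // => k /andP[/andP[uk _] _].
by rewrite /wpow iter_wconv_short ?mulr0.
Qed.

(** The identity (1 - f) (1 - f)^(-m-1) = (1 - f)^(-m); on the coefficients of
    the powers of f it is the rule of Pascal. *)
Lemma wbin_rec a m u : a [::] = 0 -> wbin a m.+1 u = wbin a m u + wconv a (wbin a m.+1) u.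
Proof.
move=> a0; set N := size u.
have -> : wconv a (wbin a m.+1) u = \sum_(k < N.+1) 'C(k + m, k)%:R * wpow a k.+1 u.
  rewrite (eq_bigr (fun k : 'I_N.+1 => \sum_(i < N.+1)
      'C(k + m, k)%:R * (a (take i u) * wpow a k (drop i u)))); last first.
    by move=> k _; rewrite /wpow iterS mulr_sumr.
  rewrite exchange_big; apply: eq_bigr => i _ /=.
  rewrite (@wbinE _ _ N) // ?size_drop ?leq_subr // mulr_sumr; apply: eq_bigr => k _.
  by rewrite addnS subn1 /=; ring.
have zN : wpow a N.+1 u = 0 by exact: iter_wconv_short.
rewrite big_ord_recr zN mulr0 /= addr0.
rewrite !(@wbinE _ _ N) // !big_ord_recl /= !bin0 -addrA; congr (_ + _).
rewrite -big_split; apply: eq_bigr => k _ /=.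
by rewrite /bump /= !add1n addnS !subn1 /= addSn binS natrD mulrDl.
Qed.

Lemma wbin0 a u : a [::] = 0 -> wbin a 0 u = wdelta u.
Proof.
move=> a0; rewrite /wbin big_ord_recl /= bin0 mul1r big1 ?addr0 // => k _.
by rewrite /bump /= add1n addn0 subn1 /= bin_small ?mul0r.
Qed.

Lemma wbin_nil a m : wbin a m [::] = 1.
Proof. by rewrite /wbin big_ord1 /= bin0 mul1r /wpow /= /wdelta eqxx. Qed.

Lemma wbin_ge0 a m : (forall u, 0 <= a u) -> forall u, 0 <= wbin a m u.
Proof.
move=> a0 u; apply: sumr_ge0 => k _; rewrite mulr_ge0 ?ler0n // iter_wconv_ge0 //.
Qed.

(** By [wbin_rec], (1 - f)^(-m-1) dominates f (1 - f)^(-m-1) coefficientwise,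
    and the latter contains the term a_i g_i (1 - f)^(-m-1). This inequality
    bounds the weighted shifts. *)
Lemma wbin_cons a m i u : a [::] = 0 -> (forall u, 0 <= a u) ->
  a [:: i] * wbin a m.+1 u <= wbin a m.+1 (i :: u).
Proof.
move=> a0 a_ge0; rewrite [leRHS]wbin_rec // wconv_short //= big_ord_recl /= take0 drop0.
rewrite addrCA lerDl addr_ge0 ?wbin_ge0 // sumr_ge0 // => k _.
by rewrite mulr_ge0 ?wbin_ge0.
Qed.

Lemma wbin_gt0 a m u : a [::] = 0 -> (forall u, 0 <= a u) -> (forall i, 0 < a [:: i]) ->
  0 < wbin a m.+1 u.
Proof.
move=> a0 a_ge0 a1; elim: u => [|i u IH]; first by rewrite wbin_nil.
by apply: lt_le_trans (wbin_cons _ _ _ _ _); rewrite ?mulr_gt0.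
Qed.

(** The finite geometric expansion of (1 - f)^(-1), with its remainder,
    multiplied by (1 - f)^(-m). *)
Lemma wbin_geom a m N u : a [::] = 0 ->
  wbin a m.+1 u = \sum_(k < N) iter k (wconv a) (wbin a m) u + iter N (wconv a) (wbin a m.+1) u.
Proof.
move=> a0; elim: N u => [|N IH] u; first by rewrite big_ord0 add0r.
rewrite wbin_rec // big_ord_recl -addrA; congr (_ + _).
rewrite /wconv (eq_bigr (fun i : 'I_(size u).+1 => \sum_(k < N) a (take i u) *
    iter k (wconv a) (wbin a m) (drop i u) +
    a (take i u) * iter N (wconv a) (wbin a m.+1) (drop i u))); last first.
  by move=> i _; rewrite IH mulrDr mulr_sumr.
by rewrite big_split exchange_big.
Qed.

End WordSums.

(** * The weights as sums over factorizations *)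

Section Weights.
Variables (n : nat) (R : realType).
Implicit Types (u v : seq 'I_n) (a c : seq 'I_n -> R).

(** The prefix cut off by the outermost product with f is the first factor of
    the factorization, so both sides obey the same recursion in j. The common
    bound M on the lengths stays fixed while the word gets shorter. *)
Lemma wpow_factorizations a M j u : a [::] = 0 -> (size u < M)%N ->
  wpow a j u = \sum_(l : j.-tuple 'I_M |
      all (leq 1) (map val l) && (sumn (map val l) == size u))
    \prod_(g <- reshape (map val l) u) a g.
Proof.
move=> a0; pose G u (l : seq 'I_M) : R :=
  if all (leq 1) (map val l) && (sumn (map val l) == size u)
  then \prod_(g <- reshape (map val l) u) a g else 0.
suff: (size u < M)%N -> wpow a j u = \sum_(l : j.-tuple 'I_M) G u l.
  by move=> h /h ->; rewrite [RHS]big_mkcond.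
elim: j u => [|j IH] u uM.
  rewrite (bigD1 [tuple]) //= big1 => [|t]; last by case/eqP; exact: tuple0.
  rewrite addr0 /G /wpow /= /wdelta -size_eq0 [in RHS]eq_sym; case: eqP => _ //=.
  by rewrite big_nil.
rewrite (@big_tuple_cons _ _ j (G u)).
have GE (i : 'I_M) (l : seq 'I_M) : G u (i :: l) =
    if (0 < i <= size u)%N then a (take i u) * G (drop i u) l else 0.
  rewrite /G /= size_drop; case: ifP => [/andP[/andP[-> al] /eqP e]|h] /=.
    have iu : (i <= size u)%N by rewrite -e leq_addr.
    by rewrite iu al -e addKn eqxx big_cons.
  case: ifP => // /andP[i0 iu]; case: ifP => [/andP[al /eqP e]|]; last by rewrite mulr0.
  by move: h; rewrite i0 al e subnKC // eqxx.
rewrite /wpow iterS -/(wpow a j) wconv_short //.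
rewrite (eq_bigr (fun i : 'I_M => if (0 < i <= size u)%N then a (take i u) *
    wpow a j (drop i u) else 0)); last first.
  move=> i _; under eq_bigr do rewrite GE; case: ifP => // [iu|]; last by rewrite big1.
  by rewrite -mulr_sumr IH // size_drop; lia.
rewrite -(big_mkord xpredT (fun i => a (take i.+1 u) * wpow a j (drop i.+1 u))).
rewrite -(big_mkord xpredT (fun i => if (0 < i <= size u)%N then a (take i u) *
    wpow a j (drop i u) else 0)).
case: M uM {IH GE G} => // M uM; rewrite big_nat_recl //= add0r.
rewrite [RHS](@big_cat_nat _ _ _ (size u)) //= [X in _ = _ + X]big_nat_cond.
rewrite [X in _ = _ + X]big1 ?addr0 => [|k /andP[/andP[uk _] _]]; last first.
  by rewrite ltnNge uk.
by apply: eq_big_nat => i /andP[_ ->].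
Qed.

(** Group the factorizations by their number of factors; zero factors only
    contribute to the empty word. *)
Lemma bweightE a m u : a [::] = 0 -> (0 < m)%N -> bweight a m u = wbin a m u.
Proof.
move=> a0 m0; case: u => [|i u]; first by rewrite wbin_nil.
rewrite /bweight /wbin; set N := size (i :: u).
rewrite -(big_mkord xpredT (fun k => 'C(k + m - 1, k)%:R * wpow a k (i :: u))).
have z0 : wpow a 0 (i :: u) = 0 by [].
rewrite [RHS]big_ltn // z0 mulr0 add0r.
apply: eq_big_nat => k /andP[k0 kN].
rewrite (@wpow_factorizations a N.+1) // mulr_sumr; apply: eq_bigr => l _.
rewrite mulrC; congr (_%:R * _).
rewrite -bin_sub; last by lia.
by congr 'C(_, _); lia.
Qed.

End Weights.

(** * The universal model *)

Section Model.
Variables (n : nat) (R : realType) (a : seq 'I_n -> R) (m : nat).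
Hypothesis a_nil : a [::] = 0.
Hypothesis a_ge0 : forall u, 0 <= a u.
Hypothesis a_gt0 : forall i, 0 < a [:: i].
Hypothesis m_gt0 : (0 < m)%N.
Local Notation F2 := (fock n R[i]).

Lemma conjRC (r : R) : (r%:C)^* = r%:C :> R[i].
Proof. by apply: CrealP; apply/complex_realP; exists r. Qed.

Lemma scalerCE (c z : R[i]) : c *: z = c * z. Proof. by []. Qed.

Definition wratio i u : R := Num.sqrt (bweight a m u / bweight a m (i :: u)).

Lemma bweight_gt0 u : 0 < bweight a m u.
Proof. by rewrite bweightE // -(prednK m_gt0); apply: wbin_gt0. Qed.

Lemma wratio_bound i u : wratio i u ^+ 2 <= (a [:: i])^-1.
Proof.
rewrite sqr_sqrtr; last by rewrite divr_ge0 // ltW // bweight_gt0.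
rewrite ler_pdivrMr ?bweight_gt0 // ler_pdivlMl //.
by rewrite !bweightE // -(prednK m_gt0); apply: wbin_cons.
Qed.

Definition wshift_fun i (x : F2) : seq 'I_n -> R[i] := fun t =>
  if t is j :: s then (if j == i then (wratio i s)%:C * x s else 0) else 0.

Lemma wshift_cons i (x : F2) j s :
  wshift_fun i x (j :: s) = if j == i then (wratio i s)%:C * x s else 0.
Proof. by []. Qed.

Lemma lsum_wshift i (x : F2) N :
  lsum (fun s => `|wshift_fun i x s| ^+ 2) N <= ((a [:: i])^-1)%:C * `|x| ^+ 2.
Proof.
have C0 : 0 <= ((a [:: i])^-1)%:C :> R[i] by rewrite ler0c invr_ge0.
case: N => [|N]; first by rewrite /lsum big_ord0 mulr_ge0 // exprn_ge0.
rewrite lsum_cons /= normr0 expr0n add0r (bigD1 i) //= [X in _ + X]big1 ?addr0.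
  rewrite eqxx; apply: le_trans (ler_wpM2l C0 (fock_lsum_le x N)); rewrite -lsumZ.
  apply: ler_lsum => s; rewrite normrM exprMn ler_wpM2r ?exprn_ge0 //.
  rewrite ger0_norm ?ler0c ?sqrtr_ge0 // -rmorphXn lecR; exact: wratio_bound.
move=> j /negbTE ->; rewrite /lsum big1 // => k _; rewrite big1 // => s _.
by rewrite normr0 expr0n.
Qed.

(** The weights are bounded ([wratio_bound]), so the weighted shift of the basis
    vectors extends to an operator. *)
Lemma Wmodel_fvec i s : Wmodel a m i (fvec R s) = (wratio i s)%:C *: fvec R (i :: s).
Proof.
suff : exists T : bop F2 F2, forall s, T (fvec R s) = (wratio i s)%:C *: fvec R (i :: s).
  by move=> /(xgetPex 0) /(_ s).
have mem x : wshift_fun i x \in fock_pred.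
  by apply/asboolP; exists (((a [:: i])^-1)%:C * `|x| ^+ 2) => N; exact: lsum_wshift.
pose f x : F2 := Fock (mem x).
have fE x t : f x t = wshift_fun i x t by [].
have fl : linear f.
  move=> c x y; apply: fock_ext => t; rewrite fockD fockZ !fE.
  case: t => [|j t]; first by rewrite scaler0 addr0.
  rewrite !wshift_cons; case: eqP => _; last by rewrite scaler0 addr0.
  by rewrite fock_linE mulrDr; congr (_ + _); rewrite !scalerCE mulrCA.
have fb x : `|f x| <= (Num.sqrt (a [:: i])^-1)%:C * `|x|.
  apply: fock_norm_le; first by rewrite mulr_ge0 // ler0c sqrtr_ge0.
  move=> N; rewrite exprMn -rmorphXn sqr_sqrtr ?invr_ge0 //; exact: lsum_wshift.
exists (mkbopM fl fb) => u; apply: fock_ext => t; rewrite fockZ -[LHS]/(wshift_fun i (fvec R u) t).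
have sE v : fvec R v =1 single_fun v (1 : R[i]) by [].
case: t => [|j t]; rewrite ?wshift_cons !sE /single_fun; first by rewrite scaler0.
rewrite eqseq_cons; case: eqP => _ /=; last by rewrite scaler0.
by case: eqP => [->|_]; rewrite ?mulr0 ?scaler0.
Qed.

Lemma adj_Wmodel i (x : F2) t : adj (Wmodel a m i) x t = (wratio i t)%:C * x (i :: t).
Proof.
rewrite -hdot_fvec hdotC adjPr adjK Wmodel_fvec hdotZl rmorphM /= conjRC -hdotC.
by rewrite hdot_fvec.
Qed.

Variable P : set (ncpoly R n).
Local Notation N := (NP a m P).

(** Prefixing a letter maps the spanning family of M_P to itself, so M_P is
    invariant under the W_i. *)
Lemma NP_adjW i (x : F2) : cset N x -> cset N (adj (Wmodel a m i) x).
Proof.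
move=> Nx y My; rewrite hdotC -[0]conjC0; congr (_^*).
suff : cset (orthc [set adj (Wmodel a m i) x]) y by move=> /(_ _ erefl).
apply: clspan_min My => _ [p [s [t [Pp ->]]]] _ ->.
rewrite -adjP hdotC (Nx _ _) ?conjC0 //; apply/subset_closure/sub_lspan.
by exists p, (i :: s), t.
Qed.

Lemma cset_val (H : hilbertType R) (V : csubspace H) (x : V) : cset V (val x).
Proof. by apply/set_mem/csub_valP. Qed.

(** As N_P is invariant under adj W_i, the adjoint of the compression B_i is a
    restriction. *)
Lemma adj_Bmodel i (x : N) : val (adj (Bmodel a m P i) x) = adj (Wmodel a m i) (val x).
Proof.
rewrite /Bmodel !adj_comp adj_binc -[LHS]/(val (bproj N (adj (Wmodel a m i) (adj (bproj N) x)))).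
rewrite adj_bproj; have Nx := NP_adjW i (cset_val x).
by rewrite -[X in bproj N X]/(val (CSub (mem_set Nx))) bproj_id.
Qed.

Lemma adj_Bmodel_coord i (x : N) t :
  (val (adj (Bmodel a m P i) x) : F2) t = (wratio i t)%:C * (val x : F2) (i :: t).
Proof. by rewrite adj_Bmodel adj_Wmodel. Qed.

End Model.

(** * Quadratic forms of operators *)

Section QuadraticForms.
Variable R : realType.
Implicit Types H K : hilbertType R.

Definition qform H (T : bop H H) (h : H) : R := complex.Re (hdot (T h) h).

Lemma qformE H (T : bop H H) h : bpos T -> hdot (T h) h = (qform T h)%:C.
Proof. by move=> Tp; exact: realC. Qed.

Lemma qform_ge0 H (T : bop H H) h : bpos T -> 0 <= qform T h.
Proof. by move=> Tp; rewrite -ler0c -qformE. Qed.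

Lemma qform_sub H (S T : bop H H) h : qform (S - T) h = qform S h - qform T h.
Proof. by rewrite /qform bop_subE hdotBl raddfB. Qed.

Lemma bpos_sub H (S T : bop H H) : bpos S -> bpos T -> (forall h, qform T h <= qform S h) ->
  bpos (S - T).
Proof.
move=> Sp Tp TS h; rewrite bop_subE hdotBl !qformE // -rmorphB ler0c subr_ge0; exact: TS.
Qed.

Lemma adj_self_bpos H K (T : bop H K) : bpos (adj T ∘ T).
Proof. by move=> h; rewrite /= -adjPr hdot_ge0. Qed.

Lemma qform_adj_self H K (T : bop H K) h : qform (adj T ∘ T) h = rnorm (T h) ^+ 2.
Proof. by rewrite /qform -[(_ ∘ _) h]/(adj T (T h)) -adjPr rnorm2_hdot. Qed.

Lemma bpos_norm_le H (T : bop H H) (M : R) : 0 <= M -> bpos T ->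
  (forall h, qform T h <= M * rnorm h ^+ 2) -> forall h, rnorm (T h) ^+ 2 <= M * qform T h.
Proof.
move=> M0 Tp TM h; have [T0|T0] := eqVneq (rnorm (T h)) 0.
  by rewrite T0 expr0n mulr_ge0 // qform_ge0.
have p0 : 0 < rnorm (T h) ^+ 2 by rewrite exprn_gt0 // lt_neqAle eq_sym T0 rnorm_ge0.
have := bpos_CS Tp h (T h); rewrite rnorm2_hdot ger0_norm ?ler0c ?sqr_ge0 //.
rewrite !qformE // -rmorphXn -rmorphM lecR => h1.
have h2 : (rnorm (T h) ^+ 2) ^+ 2 <= qform T h * (M * rnorm (T h) ^+ 2).
  by apply: le_trans h1 _; rewrite ler_wpM2l // qform_ge0.
by rewrite -(ler_pM2r p0) -expr2 (le_trans h2) // mulrA [_ * M]mulrC.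
Qed.

(** For positive operators |T h|^2 <= M <T h, h>, so convergence of the quadratic
    forms to 0 is strong convergence. *)
Lemma bpos_sot0 H (T : nat -> bop H H) (M : R) : 0 <= M -> (forall k, bpos (T k)) ->
  (forall k h, qform (T k) h <= M * rnorm h ^+ 2) ->
  (forall h, hdot (T k h) h @[k --> \oo] --> (0 : R[i])) -> sot_cvg T 0.
Proof.
move=> M0 Tp TM T0 h; apply/cvgC_seqP => e e0.
have M1 : 0 < M + 1 by rewrite ltr_wpDl.
have d0 : 0 < e ^+ 2 / (M + 1) by rewrite divr_gt0 ?exprn_gt0.
have [N HN] := (cvgC_seqP _ _).1 (T0 h) _ d0.
exists N => k Nk; rewrite sub0r normrN rnormE lecR -(@ler_pXn2r _ 2) ?nnegrE ?rnorm_ge0 ?(ltW e0) //.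
apply: le_trans (bpos_norm_le M0 (Tp k) (TM k) h) _.
have := HN k Nk; rewrite sub0r normrN qformE // ger0_norm ?ler0c ?qform_ge0 // lecR => hq.
apply: (@le_trans _ _ ((M + 1) * qform (T k) h)).
  by rewrite ler_wpM2r ?qform_ge0 // lerDl.
by rewrite mulrC -ler_pdivlMr.
Qed.

Lemma bop_qform_bound H (T : bop H H) : exists2 M : R, 0 < M & forall h, qform T h <= M * rnorm h ^+ 2.
Proof.
have [M M0 TM] := bop_bounded T; exists M => // h.
apply: le_trans (ler_norm _) _; rewrite -lecR.
apply: (le_trans (ler_re (hdot (T h) h))).
apply: le_trans (hdot_le _ _) _; rewrite !rnormE -rmorphM lecR expr2 mulrA.
by rewrite ler_wpM2r ?rnorm_ge0 //; have := TM h; rewrite !rnormE -rmorphM lecR.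
Qed.

End QuadraticForms.

(** * The completely positive map of a tuple *)

Section PhiTheory.
Variables (n : nat) (R : realType) (a : seq 'I_n -> R).
Hypothesis a_nil : a [::] = 0.
Hypothesis a_ge0 : forall u, 0 <= a u.
Variables (H : hilbertType R) (X : 'I_n -> bop H H).

(** Boundedness of the row operator with entries sqrt(a_s) X_s; every series
    defining a value of Phi converges because of it. *)
Definition row_bounded : Prop := exists M : R, 0 <= M /\ forall h N,
  lsum (fun s => a s * rnorm (adj (opword X s) h) ^+ 2) N <= M * rnorm h ^+ 2.

Lemma hdot_Phi_part (Y : bop H H) N x y : hdot (Phi_part a X Y N x) y =
  lsum (fun s => (a s)%:C * hdot (Y (adj (opword X s) x)) (adj (opword X s) y)) N.
Proof.
rewrite /Phi_part bop_sumE hdot_suml.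
rewrite /lsum -(big_mkord xpredT (fun k => \sum_(s : k.-tuple 'I_n) (a s)%:C *
  hdot (Y (adj (opword X s) x)) (adj (opword X s) y))).
have E k : hdot ((\sum_(s : k.-tuple 'I_n) (a s)%:C *: (opword X s ∘ Y ∘ adj (opword X s))) x) y =
    \sum_(s : k.-tuple 'I_n) (a s)%:C * hdot (Y (adj (opword X s) x)) (adj (opword X s) y).
  rewrite bop_sumE hdot_suml; apply: eq_bigr => s _; rewrite bop_scaleE hdotZl.
  by rewrite -adjP.
case: N => [|N]; first by rewrite !big_geq.
rewrite [RHS]big_ltn // [X in _ = X + _]big1 ?add0r => [|s _].
  by apply: eq_bigr => k _; exact: E.
by rewrite tuple0 /= a_nil mul0r.
Qed.

Lemma lsumC (F : seq 'I_n -> R) N : lsum (fun s => (F s)%:C) N = (lsum F N)%:C :> R[i].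
Proof. by rewrite (lsum_raddf (f := fun r : R => r%:C : R[i])) // => u v; rewrite rmorphD. Qed.

Lemma sot_row_bounded T : sot_cvg (Phi_part a X (bid H)) T -> row_bounded.
Proof.
move=> XT; have [M M0 TM] := bop_qform_bound T; exists M; split; first exact: ltW.
move=> h N; apply: le_trans (TM h).
pose F s := a s * rnorm (adj (opword X s) h) ^+ 2.
have F0 s : 0 <= F s by rewrite mulr_ge0 ?sqr_ge0.
have c : (fun k => (lsum F k)%:C) @ \oo --> hdot (T h) h.
  rewrite (_ : (fun k => _) = fun k => hdot (Phi_part a X (bid H) k h) h).
    by apply: cvg_hdotl; exact: XT.
  apply/funext => k; rewrite hdot_Phi_part -lsumC; apply: lsum_ext => s.
  by rewrite rmorphM /= rnorm2_hdot.
have nr : \forall k \near \oo, (lsum F N)%:C <= (lsum F k)%:C :> R[i].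
  exists N => // k /= Nk; rewrite -!lsumC; apply: lsum_homo Nk => s.
  by rewrite ler0c.
have : (lsum F N)%:C <= hdot (T h) h by exact: cvgC_ge nr c.
by rewrite lecE => /andP[_ /=].
Qed.

Hypothesis Xb : row_bounded.

(** The ampliation I (x) Y. *)
Definition famp (Y : bop H H) : bop (fock n H) (fock n H) :=
  xget 0 [set T : bop (fock n H) (fock n H) | forall x s, T x s = Y (x s)].

Lemma fampE Y x s : famp Y x s = Y (x s).
Proof.
suff : exists T : bop (fock n H) (fock n H), forall x s, T x s = Y (x s).
  by move=> /(xgetPex 0) /(_ x s).
have [M M0 YM] := bop_bounded Y.
have bnd (z : fock n H) N : lsum (fun s => `|Y (z s)| ^+ 2) N <= (M%:C * `|z|) ^+ 2.
  rewrite exprMn; apply: le_trans (ler_wpM2l _ (fock_lsum_le z N)); last first.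
    by rewrite exprn_ge0 // ler0c ltW.
  rewrite -lsumZ; apply: ler_lsum => t; rewrite -exprMn ler_pXn2r ?nnegrE //.
  by rewrite mulr_ge0 // ler0c ltW.
have mem (z : fock n H) : (fun s => Y (z s)) \in fock_pred.
  by apply/asboolP; exists ((M%:C * `|z|) ^+ 2) => N; exact: bnd.
pose f z : fock n H := Fock (mem z).
have fl : linear f by move=> c z w; apply: fock_ext => t; exact: bop_linear.
have fb z : `|f z| <= M%:C * `|z|.
  apply: fock_norm_le; first by rewrite mulr_ge0 // ler0c ltW.
  by move=> N; exact: bnd.
by exists (mkbopM fl fb).
Qed.

(** The adjoint of the row operator with entries sqrt(a_s) X_s. *)
Definition rowadj : bop H (fock n H) :=
  xget 0 [set T : bop H (fock n H) | forall h s, T h s = (Num.sqrt (a s))%:C *: adj (opword X s) h].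

Lemma rowadjE h s : rowadj h s = (Num.sqrt (a s))%:C *: adj (opword X s) h.
Proof.
suff : exists T : bop H (fock n H), forall h s, T h s = (Num.sqrt (a s))%:C *: adj (opword X s) h.
  by move=> /(xgetPex 0) /(_ h s).
have [M [M0 XM]] := Xb.
have bnd h' N : lsum (fun s => `|(Num.sqrt (a s))%:C *: adj (opword X s) h'| ^+ 2) N
    <= ((Num.sqrt M)%:C * `|h'|) ^+ 2.
  rewrite exprMn -rmorphXn sqr_sqrtr // rnormE -rmorphXn -rmorphM.
  rewrite (_ : lsum _ N = (lsum (fun s => a s * rnorm (adj (opword X s) h') ^+ 2) N)%:C).
    by rewrite lecR.
  rewrite -lsumC; apply: lsum_ext => t; rewrite normrZ exprMn ger0_norm ?ler0c ?sqrtr_ge0 //.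
  by rewrite rnormE -!rmorphXn -rmorphM sqr_sqrtr.
have mem h' : (fun s => (Num.sqrt (a s))%:C *: adj (opword X s) h') \in fock_pred.
  by apply/asboolP; exists (((Num.sqrt M)%:C * `|h'|) ^+ 2) => N; exact: bnd.
pose f z : fock n H := Fock (mem z).
have fl : linear f.
  move=> c z w; apply: fock_ext => t.
  rewrite fockD fockZ -[LHS]/(_ *: adj (opword X t) (c *: z + w)) bop_linear scalerDr.
  by rewrite !scalerA [_ * c]mulrC.
have fb z : `|f z| <= (Num.sqrt M)%:C * `|z|.
  apply: fock_norm_le; first by rewrite mulr_ge0 // ler0c sqrtr_ge0.
  by move=> N; exact: bnd.
by exists (mkbopM fl fb).
Qed.

Lemma hdot_Phi_part_row (Y : bop H H) N x y : hdot (Phi_part a X Y N x) y =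
  hdot (famp Y (rowadj x)) (ftrunc (rowadj y) N).
Proof.
rewrite hdot_Phi_part hdot_ftrunc; apply: lsum_ext => s.
rewrite fampE !rowadjE bopZ hdotZl hdotZr conjRC mulrA -rmorphM -expr2.
by rewrite sqr_sqrtr.
Qed.

Lemma Phi_part_wot (Y : bop H H) :
  wot_cvg (Phi_part a X Y) (adj rowadj ∘ famp Y ∘ rowadj).
Proof.
move=> x y; under eq_fun do rewrite hdot_Phi_part_row.
rewrite /= -[X in hdot X _]/(adj rowadj (famp Y (rowadj x))) -adjPr.
have c : (fun=> famp Y (rowadj x)) @ \oo --> famp Y (rowadj x) by exact: cvg_cst.
exact: (cvg_hdot c (@ftrunc_cvg _ _ _ _)).
Qed.

(** Phi(Y) is I (x) Y between the row operator and its adjoint. Linearity and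
    positivity of Phi, and the boundedness of its partial sums, are read off
    this form. *)
Lemma PhiE (Y : bop H H) : Phi a X Y = adj rowadj ∘ famp Y ∘ rowadj.
Proof.
apply: xget_unique; first exact: Phi_part_wot.
move=> T XT; apply: bop_ext => x; apply: hdot_ext => y.
have h1 : hdot (Phi_part a X Y N x) y @[N --> \oo] --> hdot (T x) y := XT x y.
have h2 := @Phi_part_wot Y x y.
exact: (cvg_uniq h1 h2).
Qed.

Lemma Phi_wot (Y : bop H H) : wot_cvg (Phi_part a X Y) (Phi a X Y).
Proof. rewrite PhiE; exact: Phi_part_wot. Qed.

Lemma Phi_part_bound (Y : bop H H) : exists2 L : R, 0 <= L & forall N x y,
  `|hdot (Phi_part a X Y N x) y| <= L%:C * (`|x| * `|y|).
Proof.
have [M1 M10 h1] := bop_bounded (famp Y); have [M2 M20 h2] := bop_bounded rowadj.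
exists (M1 * M2 * M2); first by rewrite !mulr_ge0 // ltW.
move=> N x y; rewrite hdot_Phi_part_row; apply: le_trans (hdot_le _ _) _.
have -> : (M1 * M2 * M2)%:C * (`|x| * `|y|) = (M1%:C * (M2%:C * `|x|)) * (M2%:C * `|y|).
  by rewrite !rmorphM; ring.
apply: ler_pM => //.
  by apply: le_trans (h1 _) _; apply: ler_wpM2l; [rewrite ler0c ltW|exact: h2].
by apply: le_trans (norm_ftrunc _ _) _; exact: h2.
Qed.

Lemma PhiB (Y Z : bop H H) : Phi a X (Y - Z) = Phi a X Y - Phi a X Z.
Proof.
rewrite !PhiE; apply: bop_ext => x.
change (adj rowadj (famp (Y - Z) (rowadj x)) =
  adj rowadj (famp Y (rowadj x)) - adj rowadj (famp Z (rowadj x))).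
by rewrite -bopB; congr bop_fun; apply: fock_ext => s; rewrite fockD fockN !fampE.
Qed.

Lemma wsum_Phi (Y : bop H H) h : bpos Y ->
  wsum (fun s => a s * qform Y (adj (opword X s) h)) = (qform (Phi a X Y) h)%:E.
Proof.
move=> Yp; apply: wsum_cvg => [u|]; first by rewrite mulr_ge0 // qform_ge0.
apply/cvgC_real.
have E : (fun N => (lsum (fun s => a s * qform Y (adj (opword X s) h)) N)%:C) =
    (fun N => hdot (Phi_part a X Y N h) h).
  apply/funext => N; rewrite hdot_Phi_part -lsumC; apply: lsum_ext => s.
  by rewrite rmorphM /= -qformE.
rewrite E; suff -> : (qform (Phi a X Y) h)%:C = hdot (Phi a X Y h) h by exact: Phi_wot.
rewrite -realC //; have c := @Phi_wot Y h h; rewrite -E in c.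
apply: cvgC_ge c; apply: nearW => N; rewrite ler0c; apply: sumr_ge0 => k _.
by apply: sumr_ge0 => s _; rewrite mulr_ge0 // qform_ge0.
Qed.

Lemma Phi_pos (Y : bop H H) : bpos Y -> bpos (Phi a X Y).
Proof.
move=> Yp h; rewrite PhiE -[X in hdot X _]/(adj rowadj (famp Y (rowadj h))) -adjPr.
apply: cvgC_ge (@fock_dot_cvg _ _ _ _ _); apply: nearW => N; apply: sumr_ge0 => k _.
by apply: sumr_ge0 => s _; rewrite fampE; exact: Yp.
Qed.

Lemma iter_Phi_pos k (Y : bop H H) : bpos Y -> bpos (iter k (Phi a X) Y).
Proof. by move=> Yp; elim: k => //= k; exact: Phi_pos. Qed.

End PhiTheory.

(** * Quadratic forms expanded over words *)

Section WordForms.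
Variables (n : nat) (R : realType).
Implicit Types (F G : seq 'I_n -> R).

Lemma wsumZ (r l : R) F : 0 <= r -> (forall u, 0 <= F u) -> wsum F = l%:E ->
  wsum (fun u => r * F u) = (r * l)%:E.
Proof.
move=> r0 F0 /(cvg_wsum F0) Fl; apply: wsum_cvg => [u|]; first exact: mulr_ge0.
have -> : lsum (fun u => r * F u) = (fun N => r * lsum F N).
  apply/funext => N; rewrite (lsum_raddf (f := fun x : R => r * x)) ?mulr0 //.
  by move=> x y; rewrite mulrDr.
have c : (fun=> r) @ \oo --> r by exact: cvg_cst.
exact: (@cvgM R _ \oo _ _ _ _ _ c Fl).
Qed.

Lemma wsumD F G : (forall u, 0 <= F u) -> (forall u, 0 <= G u) ->
  wsum (fun u => F u + G u) = (wsum F + wsum G)%E.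
Proof.
by move=> F0 G0; rewrite /wsum -esumD // => u _; rewrite lee_fin.
Qed.

Lemma le_wsum F G : (forall u, F u <= G u) -> (wsum F <= wsum G)%E.
Proof. by move=> FG; apply: le_esum => u _; rewrite lee_fin. Qed.

Lemma eq_wsum F G : F =1 G -> wsum F = wsum G.
Proof. by move=> /funext ->. Qed.

Lemma lsum_short F k N : (k <= N)%N ->
  lsum (fun u => if (size u < k)%N then F u else 0) N = lsum F k.
Proof.
move=> kN; rewrite /lsum -(subnKC kN) big_split_ord /= [X in _ + X]big1 ?addr0.
  by apply: eq_bigr => i _; apply: eq_bigr => t _; rewrite size_tuple ltn_ord.
by move=> i _; apply: big1 => t _; rewrite size_tuple ltnNge leq_addr.
Qed.

Lemma wsum_short F k : (forall u, 0 <= F u) ->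
  wsum (fun u => if (size u < k)%N then F u else 0) = (lsum F k)%:E.
Proof.
move=> F0; apply: wsum_cvg => [u|]; first by case: ifP.
by apply: cvg_near_cst; exists k => // N /= kN; rewrite lsum_short.
Qed.

Lemma wsum_ge_lsum F k : (forall u, 0 <= F u) -> ((lsum F k)%:E <= wsum F)%E.
Proof. by move=> F0; rewrite -wsum_short //; apply: le_wsum => u; case: ifP. Qed.

Lemma wsum_fin_ge0 F l : (forall u, 0 <= F u) -> wsum F = l%:E -> 0 <= l.
Proof. by move=> F0 Fl; rewrite -lee_fin -Fl; apply: esum_ge0 => u _; rewrite lee_fin. Qed.

Variables (a : seq 'I_n -> R).
Hypothesis a_nil : a [::] = 0.
Hypothesis a_ge0 : forall u, 0 <= a u.
Variables (H : hilbertType R) (X : 'I_n -> bop H H).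
Hypothesis Xb : row_bounded a X.

Lemma opword_cat s t : opword X (s ++ t) = opword X s ∘ opword X t.
Proof. by elim: s => [|i s IH] /=; rewrite ?IH; apply: bop_ext. Qed.

Variable F : H -> seq 'I_n -> R.
Hypothesis F_ge0 : forall h u, 0 <= F h u.
Hypothesis F_shift : forall h s t, F (adj (opword X s) h) t = F h (s ++ t).

(** The form of Y has the power series c as its coefficients along the
    weights F h u. Two families F occur: |K h u|^2 / b_u for an intertwiner K,
    and <Q adj(X_u) h, adj(X_u) h> for a defect operator Q. Both turn the
    adjoints of the X_s into shifts of words. *)
Definition wform (Y : bop H H) (c : seq 'I_n -> R) : Prop :=
  bpos Y /\ forall h, wsum (fun u => c u * F h u) = (qform Y h)%:E.

(** <Phi(Y) h, h> is the sum of the a_s <Y adj(X_s) h, adj(X_s) h>, and passing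
    from h to adj(X_s) h prefixes s to all words: the coefficients get
    multiplied by f. *)
Lemma wform_Phi Y c : (forall u, 0 <= c u) -> wform Y c -> wform (Phi a X Y) (wconv a c).
Proof.
move=> c0 [Yp Yc]; split=> [|h]; first exact: Phi_pos.
rewrite -wsum_conv // -(wsum_Phi a_nil a_ge0 Xb) //; apply: eq_esum => s _.
rewrite -(wsumZ (a_ge0 s) _ (Yc (adj (opword X s) h))) => [|u]; last exact: mulr_ge0.
by apply: eq_esum => t _; rewrite F_shift mulrA.
Qed.

(** A difference of forms is positive as soon as its coefficients are. All
    positivity of the operators (id - Phi)^s(Y) comes from here. *)
Lemma wform_sub Y Z c d : (forall u, 0 <= d u) -> (forall u, d u <= c u) ->
  wform Y c -> wform Z d -> wform (Y - Z) (fun u => c u - d u).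
Proof.
move=> d0 dc [Yp Yc] [Zp Zd].
have E h : wsum (fun u => (c u - d u) * F h u) = (qform (Y - Z) h)%:E.
  have := Yc h.
  have -> : (fun u => c u * F h u) = (fun u => (c u - d u) * F h u + d u * F h u).
    by apply/funext => u; rewrite -mulrDl subrK.
  rewrite wsumD => [|u|u]; last 2 first.
  - by rewrite mulr_ge0 // subr_ge0.
  - exact: mulr_ge0.
  rewrite Zd qform_sub; case: (wsum _) => [r||] //.
  by rewrite -EFinD => -[<-]; rewrite addrK.
split=> //; apply: bpos_sub => // h; rewrite -subr_ge0 -qform_sub.
by apply: wsum_fin_ge0 (E h) => u; rewrite mulr_ge0 // subr_ge0.
Qed.

Lemma wform_iter Y c k : (forall u, 0 <= c u) -> wform Y c ->
  wform (iter k (Phi a X) Y) (iter k (wconv a) c).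
Proof.
move=> c0 Yc; elim: k => //= k IH; apply: wform_Phi => //.
exact: iter_wconv_ge0.
Qed.

Lemma wform_eq Y c d : c =1 d -> wform Y c -> wform Y d.
Proof. by move=> /funext ->. Qed.

(** Applying id - Phi multiplies the coefficients by 1 - f, which lowers the
    exponent in (1 - f)^(-k) by one. *)
Lemma wform_idPhi Y k s : (s <= k)%N -> wform Y (wbin a k) ->
  wform (idPhi a X s Y) (wbin a (k - s)).
Proof.
move=> sk Yk; elim: s sk => [|s IH] sk; first by rewrite subn0.
have Ys := IH (ltnW sk); set l := (k - s.+1)%N.
have kl : (k - s = l.+1)%N by rewrite /l; lia.
rewrite kl in Ys; rewrite /idPhi iterS -/(idPhi a X s Y).
have c0 u : 0 <= wbin a l.+1 u by exact: wbin_ge0.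
have rec u := wbin_rec l u a_nil.
apply: (wform_eq _ (wform_sub _ _ Ys (wform_Phi c0 Ys))) => u.
- by rewrite rec addrK.
- exact: wconv_ge0.
- by rewrite [leRHS]rec lerDr wbin_ge0.
Qed.

(** The coefficients of Phi^j(Y) are at most those of Y and vanish on the words
    shorter than j, so <Phi^j(Y) h, h> is at most a tail of the convergent
    series of <Y h, h>. *)
Lemma wform_pure Y k : wform Y (wbin a k.+1) -> sot_cvg (fun j => iter j (Phi a X) Y) 0.
Proof.
move=> Yk; have c0 u : 0 <= wbin a k.+1 u by exact: wbin_ge0.
have [Yp YF] := Yk.
have it0 j u : 0 <= iter j (wconv a) (wbin a k.+1) u by exact: iter_wconv_ge0.
have itle j u : iter j (wconv a) (wbin a k.+1) u <= wbin a k.+1 u.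
  elim: j u => //= j IH u; apply: le_trans (le_wconv a_ge0 IH u) _.
  by rewrite [leRHS]wbin_rec // lerDr wbin_ge0.
have q j h : qform (iter j (Phi a X) Y) h <=
    qform Y h - lsum (fun u => wbin a k.+1 u * F h u) j.
  have [_ jF] := wform_iter j c0 Yk.
  have F0 u : 0 <= wbin a k.+1 u * F h u by exact: mulr_ge0.
  rewrite lerBrDr -lee_fin EFinD -jF -(wsum_short _ F0) -YF -wsumD.
  - apply: le_wsum => u; case: ltnP => uj; last by rewrite addr0 ler_wpM2r.
    by rewrite iter_wconv_short // mul0r add0r.
  - by move=> u; rewrite mulr_ge0.
  - by move=> u; case: ifP.
have jp j : bpos (iter j (Phi a X) Y) by exact: iter_Phi_pos.
have [M M0 YM] := bop_qform_bound Y.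
apply: (bpos_sot0 (ltW M0)) => // [j h|h].
  apply: le_trans (q j h) _; apply: le_trans (YM h); rewrite gerBl.
  by apply: sumr_ge0 => i _; apply: sumr_ge0 => t _; apply: mulr_ge0.
apply/cvgC_seqP => e e0.
have Fl := cvg_wsum (fun u => mulr_ge0 (c0 u) (F_ge0 h u)) (YF h).
have /cvgrPdist_le/(_ e e0)[N _ HN] := Fl.
exists N => j Nj; rewrite sub0r normrN qformE // ger0_norm ?ler0c ?qform_ge0 // lecR.
apply: le_trans (q j h) _; apply: le_trans (ler_norm _) _; exact: HN.
Qed.

End WordForms.

(** * Intertwiners with the weighted shifts *)

Section Dilation.
Variables (n : nat) (R : realType) (a : seq 'I_n -> R) (m : nat).
Hypothesis a_nil : a [::] = 0.
Hypothesis a_ge0 : forall u, 0 <= a u.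
Hypothesis a_gt0 : forall i, 0 < a [:: i].
Hypothesis m_gt0 : (0 < m)%N.
Variables (H : hilbertType R) (X : 'I_n -> bop H H).
Variables (E : hilbertType R) (K : bop H (fock n E)).
Hypothesis K_shift : forall i h t,
  K (adj (X i) h) t = (wratio a m i t)%:C *: K h (i :: t).

(** [K_shift] says that K intertwines adj X_i with adj W_i (x) I. Dividing by the
    weights turns this into a plain shift of words. *)
Let F h u : R := (bweight a m u)^-1 * rnorm (K h u) ^+ 2.

Lemma dil_F_ge0 h u : 0 <= F h u.
Proof. by rewrite mulr_ge0 ?sqr_ge0 // invr_ge0 ltW // bweight_gt0. Qed.

Lemma dil_F_shift h s t : F (adj (opword X s) h) t = F h (s ++ t).
Proof.
elim: s h => [|i s IH] h; first by rewrite /= adj_id.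
rewrite /= adj_comp -[adj _ ∘ _]/(adj (opword X s) ∘ adj (X i)).
rewrite -[(_ ∘ _) h]/(adj (opword X s) (adj (X i) h)) IH /F K_shift.
have b1 u : 0 < bweight a m u by exact: bweight_gt0.
rewrite rnormZ ?sqrtr_ge0 // exprMn sqr_sqrtr; last by rewrite divr_ge0 // ltW.
by field; rewrite !gt_eqF.
Qed.

Lemma dil_wform : wform F (adj K ∘ K) (wbin a m).
Proof.
split=> [|h]; first exact: adj_self_bpos.
rewrite qform_adj_self (@eq_wsum _ _ _ (fun u => rnorm (K h u) ^+ 2)) => [|u]; last first.
  by rewrite /F -bweightE // mulrA divff ?mul1r // gt_eqF // bweight_gt0.
apply: wsum_cvg => [u|]; first exact: sqr_ge0.
apply/cvgC_real; rewrite -rnorm2_hdot.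
have -> : (fun N => (lsum (fun u => rnorm (K h u) ^+ 2) N)%:C) =
    lsum (fun s => hdot (K h s) (K h s)).
  by apply/funext => N; rewrite -lsumC; apply: lsum_ext => s; rewrite rnorm2_hdot.
exact: fock_dot_cvg.
Qed.

(** The coefficients of adj K K are those of (1 - f)^(-m), and they remain
    nonnegative under multiplication by up to m factors 1 - f. *)
Lemma dilation_Cpure : row_bounded a X -> Cpure a m X (adj K ∘ K).
Proof.
move=> Xb; split=> [s /andP[_ sm]|].
  exact: (wform_idPhi a_nil a_ge0 Xb dil_F_ge0 dil_F_shift sm dil_wform).1.
have := dil_wform; rewrite -(prednK m_gt0).
exact: (wform_pure a_nil a_ge0 Xb dil_F_ge0 dil_F_shift).
Qed.

(** Coefficientwise f (1 - f)^(-m) <= (1 - f)^(-m), so that the sum of the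
    a_s |adj(X_s) h|^2 is at most |K h|^2 = |h|^2. In particular the model
    tuple is row bounded. *)
Lemma dilation_row_bounded : adj K ∘ K = bid H -> row_bounded a X.
Proof.
move=> KK; exists 1; split=> // h N; rewrite mul1r.
have rK h' : rnorm (K h') = rnorm h'.
  apply/eqP; rewrite -(@eqrXn2 _ 2) ?rnorm_ge0 //; apply/eqP/complexI.
  by rewrite -!rnorm2_hdot adjP -[adj K _]/((adj K ∘ K) h') KK.
have [_ W] := dil_wform; rewrite -lee_fin.
have b1 : qform (bid H) h = rnorm h ^+ 2 by rewrite /qform /= rnorm2_hdot.
have f0 s : 0 <= a s * rnorm (adj (opword X s) h) ^+ 2 by rewrite mulr_ge0 ?sqr_ge0.
apply: le_trans (wsum_ge_lsum N f0) _.
have -> : wsum (fun s => a s * rnorm (adj (opword X s) h) ^+ 2) =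
    wsum (fun u => wconv a (wbin a m) u * F h u).
  rewrite -wsum_conv //; [|exact: wbin_ge0|exact: dil_F_ge0].
  apply: eq_esum => s _; rewrite KK in W.
  have Ws : wsum (fun u => wbin a m u * F (adj (opword X s) h) u) =
     (rnorm (adj (opword X s) h) ^+ 2)%:E by rewrite W /qform /= rnorm2_hdot.
  rewrite -(wsumZ (a_ge0 s) _ Ws) => [|u]; last by rewrite mulr_ge0 ?wbin_ge0 ?dil_F_ge0.
  by apply: eq_esum => t _; rewrite dil_F_shift mulrA.
have := W h; rewrite KK b1 => <-; apply: le_wsum => u; rewrite ler_wpM2r ?dil_F_ge0 //.
by rewrite -(prednK m_gt0) [leRHS]wbin_rec // lerDr wbin_ge0.
Qed.

End Dilation.

(** * Recovering a pure operator from its defect *)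

Section Telescoping.
Variables (n : nat) (R : realType) (a : seq 'I_n -> R) (m : nat).
Hypothesis a_nil : a [::] = 0.
Hypothesis a_ge0 : forall u, 0 <= a u.
Hypothesis m_gt0 : (0 < m)%N.
Variables (H : hilbertType R) (X : 'I_n -> bop H H).
Hypothesis Xb : row_bounded a X.
Variable D : bop H H.
Hypothesis DC : Cpure a m X D.

Lemma iter_PhiB k (Y Z : bop H H) :
  iter k (Phi a X) (Y - Z) = iter k (Phi a X) Y - iter k (Phi a X) Z.
Proof. by elim: k => //= k ->; rewrite PhiB. Qed.

Lemma idPhiS s (Y : bop H H) : idPhi a X s.+1 Y = idPhi a X s Y - Phi a X (idPhi a X s Y).
Proof. by rewrite /idPhi iterS. Qed.

(** Purity passes from D_s = (id - Phi)^s(D) to D_{s+1}, because Phi^k(D_{s+1})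
    is the difference of Phi^k(D_s) and Phi^{k+1}(D_s). *)
Lemma Cpure_qform0 s h :
  hdot (iter k (Phi a X) (idPhi a X s D) h) h @[k --> \oo] --> (0 : R[i]).
Proof.
elim: s => [|s IH].
  by rewrite -(hdot0l h); apply: cvg_hdotl; exact: DC.2.
rewrite idPhiS; have IHS : hdot (iter k.+1 (Phi a X) (idPhi a X s D) h) h @[k --> \oo] --> (0 : R[i]).
  by have := IH; rewrite -(cvg_shiftS (fun k => hdot (iter k (Phi a X) (idPhi a X s D) h) h)).
have := cvgC_sub IH IHS; rewrite subr0.
rewrite (_ : (fun k => _ - _) = (fun k => hdot (iter k (Phi a X)
  (idPhi a X s D - Phi a X (idPhi a X s D)) h) h)) //.
by apply/funext => k; rewrite iter_PhiB bop_subE hdotBl -iterSr.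
Qed.

Lemma telescope_qform Y N h : bpos (Y - Phi a X Y) ->
  qform Y h - qform (iter N (Phi a X) Y) h =
  \sum_(k < N) qform (iter k (Phi a X) (Y - Phi a X Y)) h.
Proof.
move=> Yp; elim: N => [|N IH]; first by rewrite big_ord0 subrr.
by rewrite big_ord_recr /= -IH iter_PhiB qform_sub -iterSr; ring.
Qed.

(** <D h, h> is the limit of <(D - Phi^N(D)) h, h>, a sum of values of forms
    Phi^k(D - Phi(D)), which are positive. *)
Lemma Cpure_pos : bpos D.
Proof.
have D1 : bpos (D - Phi a X D) by apply: (DC.1 1%N); rewrite m_gt0.
move=> h; have := @Cpure_qform0 0%N h.
have c : (fun=> hdot (D h) h) @ \oo --> hdot (D h) h by exact: cvg_cst.
move=> /(cvgC_sub c); rewrite subr0; apply: cvgC_ge; apply: nearW => N.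
have -> : hdot (D h) h - hdot (iter N (Phi a X) (idPhi a X 0 D) h) h =
    \sum_(k < N) hdot (iter k (Phi a X) (D - Phi a X D) h) h.
  elim: N => [|N IH]; first by rewrite big_ord0 subrr.
  rewrite big_ord_recr /= -IH iter_PhiB bop_subE hdotBl -iterSr /idPhi /=; ring.
by apply: sumr_ge0 => k _; apply: iter_Phi_pos.
Qed.

Lemma idPhi_pos s : (s <= m)%N -> bpos (idPhi a X s D).
Proof. by case: s => [|s] sm; [exact: Cpure_pos|apply: DC.1; rewrite sm]. Qed.

Local Notation Q := (idPhi a X m D).

Definition defect_form (h : H) u : R := qform Q (adj (opword X u) h).

Lemma defect_form_ge0 h u : 0 <= defect_form h u.
Proof. by apply: qform_ge0; exact: idPhi_pos. Qed.

Lemma defect_form_shift h s t :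
  defect_form (adj (opword X s) h) t = defect_form h (s ++ t).
Proof. by rewrite /defect_form opword_cat adj_comp. Qed.

(** Induction from the defect Q = (id - Phi)^m(D), whose coefficient series is 1,
    up to D. Each step inverts id - Phi at Y = (id - Phi)^s(D): as
    Phi^N(Y) -> 0, the form of Y is the sum of the forms of
    Phi^k(Y - Phi(Y)), and the coefficients f^k (1 - f)^(-j) add up to
    (1 - f)^(-j-1) by [wbin_geom]. *)
Lemma Cpure_wform j : (j <= m)%N -> wform defect_form (idPhi a X (m - j) D) (wbin a j).
Proof.
have F0 := defect_form_ge0; have Fs := defect_form_shift.
elim: j => [|j IH] jm.
  rewrite subn0; split=> [|h]; first exact: idPhi_pos.
  rewrite (@eq_wsum _ _ _ (fun u => if (size u < 1)%N then defect_form h u else 0)).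
    rewrite wsum_short // /lsum big_ord1 (bigD1 [tuple]) //= big1 => [|t]; last first.
      by case/eqP; exact: tuple0.
    by rewrite addr0 /defect_form /= adj_id.
  by move=> u; rewrite wbin0 // /wdelta ltnS leqn0 size_eq0; case: eqP; rewrite ?mul1r ?mul0r.
have := IH (ltnW jm); set s := (m - j.+1)%N; have -> : (m - j = s.+1)%N by rewrite /s; lia.
move=> W; have Y0 := idPhi_pos (leq_subr j.+1 m); rewrite -/s in Y0.
set Y := idPhi a X s D in Y0 *; rewrite idPhiS -/Y in W.
have b0 k u : 0 <= wbin a k u by exact: wbin_ge0.
have it0 k u : 0 <= iter k (wconv a) (wbin a j) u by exact: iter_wconv_ge0.
(* S N, the truncated product of 1 / (1 - f) with (1 - f)^(-j), agrees with
   (1 - f)^(-j-1) on the words shorter than N *)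
pose S N u : R := \sum_(k < N) iter k (wconv a) (wbin a j) u.
have S0 N u : 0 <= S N u by exact: sumr_ge0.
split=> // h; pose r N := qform Y h - qform (iter N (Phi a X) Y) h.
have WS N : wsum (fun u => S N u * defect_form h u) = (r N)%:E.
  rewrite /r telescope_qform; last exact: W.1.
  elim: N => [|N IHN].
    rewrite big_ord0 (@eq_wsum _ _ _ (fun u => 0 * defect_form h u)) => [|u].
      by rewrite /wsum esum1 // => u _; rewrite mul0r.
    by rewrite /S big_ord0.
  rewrite big_ord_recr /= EFinD -IHN.
  have [_ <-] := wform_iter a_nil a_ge0 Xb F0 Fs N (b0 j) W.
  rewrite -wsumD => [|u|u]; last 2 first.
  - by rewrite mulr_ge0.
  - by rewrite mulr_ge0.
  by apply: eq_wsum => u; rewrite /S big_ord_recr mulrDl.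
have rY N : r N <= qform Y h.
  by rewrite /r gerBl; apply: qform_ge0; apply: iter_Phi_pos.
have Sle N u : S N u <= wbin a j.+1 u.
  by rewrite (wbin_geom j N u a_nil) lerDl iter_wconv_ge0.
have Seq N u : (size u < N)%N -> wbin a j.+1 u = S N u.
  by move=> uN; rewrite (wbin_geom j N u a_nil) [X in _ + X]iter_wconv_short // addr0.
have bF0 u : 0 <= wbin a j.+1 u * defect_form h u by rewrite mulr_ge0.
have up N : lsum (fun u => wbin a j.+1 u * defect_form h u) N <= qform Y h.
  apply: le_trans (rY N); rewrite -lee_fin -WS.
  apply: le_trans (wsum_ge_lsum N _) => [|u]; last by rewrite mulr_ge0.
  rewrite lee_fin le_eqVlt; apply/orP; left; apply/eqP.
  rewrite /lsum; apply: eq_bigr => k _; apply: eq_bigr => t _.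
  by rewrite (@Seq N) // size_tuple.
apply/eqP; rewrite eq_le; apply/andP; split.
  apply: (cvge_le _ (lsum_wsum bF0)); apply: nearW => N; rewrite lee_fin; exact: up.
have rc : r @ \oo --> qform Y h.
  apply/cvgC_real; rewrite (_ : (fun k => _) = fun N => hdot (Y h) h - hdot (iter N (Phi a X) Y h) h).
    have c : (fun=> hdot (Y h) h) @ \oo --> hdot (Y h) h by exact: cvg_cst.
    have := cvgC_sub c (@Cpure_qform0 s h); rewrite subr0 -qformE //.
  by apply/funext => N; rewrite /r rmorphB /= -!qformE //; apply: iter_Phi_pos.
have rE : (fun N => (r N)%:E) @ \oo --> (qform Y h)%:E by apply: cvg_EFin => //; exact: nearW.
apply: (cvge_le _ rE); apply: nearW => N; rewrite -WS.
by apply: le_wsum => u; rewrite ler_wpM2r.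
Qed.

Lemma Cpure_wsum h : wsum (fun u => bweight a m u * defect_form h u) = (qform D h)%:E.
Proof.
have [_ /(_ h)] := Cpure_wform (leqnn m); rewrite subnn => <-.
by apply: eq_wsum => u; rewrite bweightE.
Qed.

End Telescoping.

(** * Coordinates in tensor products with the Fock space *)

Section Coordinates.
Variables (n : nat) (R : realType) (E : hilbertType R).
Local Notation F2 := (fock n R[i]).

Definition fcoord (t : seq 'I_n) : bop (fock n E) E :=
  xget 0 [set T : bop (fock n E) E | forall z, T z = z t].

Lemma fcoordE t z : fcoord t z = z t.
Proof.
suff : exists T : bop (fock n E) E, forall z, T z = z t by move=> /(xgetPex 0) /(_ z).
have fl : linear (fun z : fock n E => z t) by move=> c x y; exact: fock_linE.
have fb (w : fock n E) : `|w t| <= 1%:C * `|w| by rewrite mul1r; exact: fock_norm_ge.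
by exists (mkbopM fl fb).
Qed.

Definition ftens_right (k : E) : bop F2 (fock n E) :=
  xget 0 [set T : bop F2 (fock n E) | forall y, T y = ftens y k].

Lemma ftens_rightE k y : ftens_right k y = ftens y k.
Proof.
suff : exists T : bop F2 (fock n E), forall y, T y = ftens y k by move=> /(xgetPex 0) /(_ y).
have fl : linear (fun y : F2 => ftens y k) by move=> c x z; exact: ftens_lin.
have fb (x : F2) : `|ftens x k| <= (rnorm k)%:C * `|x|.
  rewrite -rnormE -(@ler_pXn2r _ 2) ?nnegrE ?mulr_ge0 // exprMn -!hdot_norm hdot_ftens mulrC.
  exact: lexx.
by exists (mkbopM fl fb).
Qed.

Variable M : csubspace F2.

(** Write x = x_M + x_N along M and its complement N. Against x_M (x) k both z
    and its projection to N (x) E vanish, and against x_N (x) k they agree. *)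
Lemma mem_stens_orth (z : fock n E) :
  (forall y k, cset M y -> hdot z (ftens y k) = 0) -> cset (stens (orthc (cset M)) E) z.
Proof.
move=> zM; set N := orthc (cset M).
have nE : tens_dot (@ftens n R E) by move=> *; exact: hdot_ftens.
set Z := btens (@ftens n R E) (@selem n R N E) (bproj N).
suff -> : z = val (Z z) by exact: cset_val.
apply/eqP; rewrite -subr_eq0; apply/eqP; apply: (dense_orth (@ftens_total n R E)).
move=> _ [x [k ->]]; set xM := val (bproj M x).
have Nx : cset N (x - xM) by move=> y My; exact: (bproj_spec x (CSub (mem_set My))).
have -> : ftens x k = ftens xM k + ftens (x - xM) k.
  by rewrite -!ftens_rightE -bopD addrC subrK.
rewrite hdotDr !hdotBl zM; last exact: cset_val.
have -> : hdot (val (Z z)) (ftens xM k) = 0.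
  suff : cset (orthc [set ftens xM k]) (val (Z z)) by move=> /(_ _ erefl).
  apply: (clspan_min _ (cset_val (Z z))) => _ [y [l ->]] _ ->.
  have Ny : forall w, cset M w -> hdot (val y) w = 0 := cset_val y.
  by rewrite hdot_ftens Ny ?mul0r //; exact: cset_val.
have -> : hdot (val (Z z)) (ftens (x - xM) k) = hdot z (ftens (x - xM) k).
  rewrite -[ftens (x - xM) k]/(val (selem (CSub (mem_set Nx)) k)) -csub_hdot adjP.
  rewrite /Z (btens_adj _ nE (@selem_dot n R N E) (@ftens_total n R E) (@selem_total n R N E)).
  by rewrite (btensP _ (@selem_dot n R N E) nE (@selem_total n R N E)) adj_bproj.
by rewrite !subrr addr0.
Qed.

Lemma btens_proj_id (N : csubspace F2) (z : stens N E) :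
  btens (@ftens n R E) (@selem n R N E) (bproj N) (val z) = z.
Proof.
have nE : tens_dot (@ftens n R E) by move=> *; exact: hdot_ftens.
pose Z := btens (@ftens n R E) (@selem n R N E) (bproj N) ∘ binc (stens N E).
suff ZE : Z = bid (stens N E) by rewrite -[LHS]/(Z z) ZE.
apply: (tens_ext (@selem_total n R N E)) => x k.
rewrite -[LHS]/(btens (@ftens n R E) (@selem n R N E) (bproj N) (ftens (val x) k)).
by rewrite (btensP _ nE (@selem_dot n R N E) (@ftens_total n R E)) bproj_id.
Qed.

End Coordinates.

(** * The Berezin kernel *)

Section Kernel.
Variables (n : nat) (R : realType) (a : seq 'I_n -> R) (m : nat).
Hypothesis a_nil : a [::] = 0.
Hypothesis a_ge0 : forall u, 0 <= a u.
Hypothesis a_gt0 : forall i, 0 < a [:: i].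
Hypothesis m_gt0 : (0 < m)%N.
Variable P : set (ncpoly R n).
Variables (H : hilbertType R) (X : 'I_n -> bop H H).
Local Notation F2 := (fock n R[i]).
Local Notation N := (NP a m P).

Lemma btensB_coord (E : hilbertType R) i (z : stens N E) t :
  (val (btens (@selem n R N E) (@selem n R N E) (adj (Bmodel a m P i)) z) : fock n E) t =
  (wratio a m i t)%:C *: (val z : fock n E) (i :: t).
Proof.
set B := btens _ _ _.
pose S := fcoord E t ∘ binc (stens N E) ∘ B.
pose T := (wratio a m i t)%:C *: (fcoord E (i :: t) ∘ binc (stens N E)).
suff ST : S = T.
  have := congr1 (fun U : bop (stens N E) E => U z) ST.
  rewrite -[S z]/(fcoord E t (val (B z))).
  by rewrite -[T z]/((wratio a m i t)%:C *: fcoord E (i :: t) (val z)) !fcoordE.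
apply: (tens_ext (@selem_total n R N E)) => x k.
rewrite -[S _]/(fcoord E t (val (B (selem x k)))).
rewrite -[T _]/((wratio a m i t)%:C *: fcoord E (i :: t) (val (selem x k))) !fcoordE.
rewrite /B (btensP _ (@selem_dot n R N E) (@selem_dot n R N E) (@selem_total n R N E)).
have fE (y : N) s : (val (selem y k) : fock n E) s = ((val y : F2) s : R[i]) *: k by [].
by rewrite !fE adj_Bmodel_coord // scalerA.
Qed.

Section Range.
Variables (E : hilbertType R) (K : bop H (fock n E)).
Hypothesis K_shift : forall i h t,
  K (adj (X i) h) t = (wratio a m i t)%:C *: K h (i :: t).

(** The component of K along k. It intertwines adj X_i with adj W_i, so its adjoint
    carries p(W) to p(X) for all polynomials p. *)
Let slice k : bop H F2 := adj (ftens_right n k) ∘ K.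

Lemma slice_coord k h t : slice k h t = hdot (K h t) k.
Proof.
rewrite -hdot_fvec -[slice k h]/(adj (ftens_right n k) (K h)) -adjPr ftens_rightE ftens_fvec.
exact: hdot_single.
Qed.

Lemma slice_shift k i h : slice k (adj (X i) h) = adj (Wmodel a m i) (slice k h).
Proof.
by apply: fock_ext => t; rewrite adj_Wmodel // !slice_coord K_shift hdotZl.
Qed.

Lemma adj_slice_W k i y : adj (slice k) (Wmodel a m i y) = X i (adj (slice k) y).
Proof.
by apply: hdot_ext => h; rewrite -adjPr [RHS]adjP -[RHS]adjPr slice_shift -[RHS]adjP.
Qed.

Lemma adj_slice_opword k s y : adj (slice k) (opword (Wmodel a m) s y) = opword X s (adj (slice k) y).
Proof. by elim: s => //= i s IH; rewrite -IH; exact: adj_slice_W. Qed.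

Lemma adj_slice_nceval k p y : adj (slice k) (nceval p (Wmodel a m) y) = nceval p X (adj (slice k) y).
Proof.
rewrite /nceval !bop_sumE bop_sum; apply: eq_bigr => s _.
by rewrite !bop_scaleE bopZ adj_slice_opword.
Qed.

(** By [mem_stens_orth] it is enough to pair K h with tensors y (x) k, where y is
    one of the vectors W_s p(W) W_t 1 spanning M_P. The adjoint of the slice
    along k sends such a y to a value of X_s p(X), which is 0. *)
Lemma dilation_range : (forall p, P p -> nceval p X = 0) -> forall h, cset (stens N E) (K h).
Proof.
move=> X0 h; apply: mem_stens_orth => y k My.
rewrite -ftens_rightE adjPr -[adj _ (K h)]/(slice k h) hdotC.
suff : cset (orthc [set slice k h]) y by move=> /(_ _ erefl) ->; rewrite conjC0.
apply: clspan_min My => _ [p [s [t [Pp ->]]]] _ ->.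
by rewrite adjPr adj_slice_opword adj_slice_nceval X0 // bop_0E bop0 hdot0l.
Qed.

End Range.

Hypothesis Xb : row_bounded a X.
Variable D : bop H H.
Hypothesis DC : Cpure a m X D.
Local Notation Q := (idPhi a X m D).
Local Notation E := (branc (bsqrt Q)).

Lemma defect_pos : bpos Q.
Proof. exact: (idPhi_pos a_nil a_ge0 m_gt0 Xb DC). Qed.

Lemma rnorm_bsqrt y : rnorm (bsqrt Q y) ^+ 2 = qform Q y.
Proof.
have [Sp SS] := bsqrtP defect_pos; apply: complexI.
rewrite -rnorm2_hdot -qformE; last exact: defect_pos.
transitivity (hdot ((bsqrt Q ∘ bsqrt Q) y) y); last by rewrite SS.
by rewrite [RHS](bpos_sa Sp).
Qed.

Lemma rnorm_branc_elem y : rnorm (branc_elem (bsqrt Q) y) = rnorm (bsqrt Q y).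
Proof. by rewrite /rnorm csub_norm. Qed.

(** By [Cpure_wsum] the squared norms of the coordinates add up to <D h, h>. *)
Lemma berezin_kernel_exists : exists2 T : bop H (fock n E),
  (forall h, kernel_part a m X Q h @ \oo --> T h) &
  forall h u, T h u = (Num.sqrt (bweight a m u))%:C *: branc_elem (bsqrt Q) (adj (opword X u) h).
Proof.
have b0 u : 0 <= bweight a m u by rewrite ltW // bweight_gt0.
have [M M0 DM] := bop_qform_bound D.
pose f0 h u : E := (Num.sqrt (bweight a m u))%:C *: branc_elem (bsqrt Q) (adj (opword X u) h).
have bnd h k : lsum (fun s => `|f0 h s| ^+ 2) k <= ((Num.sqrt M)%:C * `|h|) ^+ 2.
  rewrite exprMn -rmorphXn sqr_sqrtr ?(ltW M0) // rnormE -rmorphXn -rmorphM.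
  rewrite (_ : lsum _ k = (lsum (fun u => bweight a m u * defect_form a m X D h u) k)%:C).
    rewrite lecR; apply: le_trans (DM h); rewrite -lee_fin.
    rewrite -(Cpure_wsum a_nil a_ge0 m_gt0 Xb DC); apply: wsum_ge_lsum => u.
    by rewrite mulr_ge0 // (defect_form_ge0 a_nil a_ge0 m_gt0 Xb DC).
  rewrite -lsumC; apply: lsum_ext => u.
  rewrite rnormE rnormZ ?sqrtr_ge0 // -rmorphXn exprMn sqr_sqrtr // rnorm_branc_elem.
  by rewrite rnorm_bsqrt.
have mem h : f0 h \in fock_pred by apply/asboolP; exists (((Num.sqrt M)%:C * `|h|) ^+ 2) => k.
pose f h : fock n E := Fock (mem h).
have bl c x y : branc_elem (bsqrt Q) (c *: x + y) =
    c *: branc_elem (bsqrt Q) x + branc_elem (bsqrt Q) y.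
  by apply: val_inj; rewrite linearP /= bop_linear.
have fl : linear f.
  move=> c z w; apply: fock_ext => t; rewrite fockD fockZ -[LHS]/(f0 (c *: z + w) t).
  by rewrite /f0 bop_linear bl scalerDr !scalerA [_ * c]mulrC.
have fb z : `|f z| <= (Num.sqrt M)%:C * `|z|.
  apply: fock_norm_le; first by rewrite mulr_ge0 // ler0c sqrtr_ge0.
  by move=> j; exact: bnd.
exists (mkbopM fl fb) => // h.
rewrite (_ : kernel_part a m X Q h = ftrunc (f h)); first exact: ftrunc_cvg.
apply/funext => k; apply: lsum_ext => s.
rewrite ftens_fvec; apply: fock_ext => t; rewrite fockZ /= /single_fun.
by case: eqP => _; rewrite ?scaler0.
Qed.

Local Notation K := (berezin_kernel a m X Q).

Lemma berezin_kernelE h u :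
  K h u = (Num.sqrt (bweight a m u))%:C *: branc_elem (bsqrt Q) (adj (opword X u) h).
Proof.
have [T T1 T2] := berezin_kernel_exists.
suff -> : K = T by exact: T2.
apply: xget_unique => // S ST; apply: bop_ext => x.
exact: (cvg_uniq (ST x) (T1 x)).
Qed.

Lemma berezin_kernel_shift i h t :
  K (adj (X i) h) t = (wratio a m i t)%:C *: K h (i :: t).
Proof.
have b0 u : 0 < bweight a m u by rewrite bweight_gt0.
rewrite !berezin_kernelE scalerA -rmorphM -sqrtrM; last by rewrite divr_ge0 // ltW.
rewrite divfK ?gt_eqF //; congr (_ *: branc_elem _ _).
by rewrite /= adj_comp.
Qed.

Lemma berezin_kernel_sq : adj K ∘ K = D.
Proof.
apply: bop_quad_ext => h.
have E1 := qformE h (@adj_self_bpos _ _ _ K).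
have E2 := qformE h (Cpure_pos a_nil a_ge0 m_gt0 Xb DC).
rewrite E1 E2; congr (_%:C); apply: EFin_inj.
rewrite -(Cpure_wsum a_nil a_ge0 m_gt0 Xb DC).
have [_ <-] := dil_wform a_nil a_ge0 a_gt0 m_gt0 K.
apply: eq_wsum => u; rewrite -bweightE //; congr (_ * _).
have b0 : 0 < bweight a m u by rewrite bweight_gt0.
rewrite berezin_kernelE rnormZ ?sqrtr_ge0 // exprMn sqr_sqrtr ?ltW //.
by rewrite rnorm_branc_elem rnorm_bsqrt mulrA mulVf ?mul1r // gt_eqF.
Qed.

Hypothesis X0 : forall p, P p -> nceval p X = 0.

(** The Berezin kernel takes its values in N_P (x) E, by [dilation_range]. *)
Lemma val_Kq h : val (Kq a m P X Q h) = K h.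
Proof.
have Kh : cset (stens N E) (K h) by apply: (dilation_range berezin_kernel_shift X0).
rewrite -[Kq a m P X Q h]/(btens (@ftens n R E) (@selem n R N E) (bproj N) (K h)).
by rewrite -[K h]/(val (CSub (mem_set Kh))) btens_proj_id.
Qed.

Lemma Kq_sq : adj (Kq a m P X Q) ∘ Kq a m P X Q = D.
Proof.
apply: bop_quad_ext => h.
have -> : hdot (D h) h = hdot ((adj K ∘ K) h) h by rewrite berezin_kernel_sq.
change (hdot (adj (Kq a m P X Q) (Kq a m P X Q h)) h = hdot (adj K (K h)) h).
by rewrite -!adjPr csub_hdot val_Kq.
Qed.

Lemma Kq_intertwine i : Kq a m P X Q ∘ adj (X i) =
  btens (@selem n R N E) (@selem n R N E) (adj (Bmodel a m P i)) ∘ Kq a m P X Q.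
Proof.
apply: bop_ext => h; apply: val_inj; apply: fock_ext => t.
rewrite btensB_coord -[(Kq _ _ _ _ _ ∘ _) h]/(Kq a m P X Q (adj (X i) h)) !val_Kq.
exact: berezin_kernel_shift.
Qed.

End Kernel.

(** * Gram-Schmidt orthonormalization *)

Section GramSchmidt.
Variables (R : realType) (E : hilbertType R).

Lemma conj_norm (w : E) : `|w|^* = `|w| :> R[i].
Proof. by apply: CrealP; exact: normr_real. Qed.

Definition normalize (w : E) : E := `|w|^-1 *: w.

(** The first k vectors are produced together, which makes the recursion
    structural. *)
Fixpoint gram_schmidt_list (v : nat -> E) (k : nat) : seq E :=
  if k is k'.+1 then
    let l := gram_schmidt_list v k' in
    rcons l (normalize (v k' - \sum_(e <- l) hdot (v k') e *: e))
  else [::].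

(** The inverse of 0 being 0, [normalize] fixes the zero vector: a v k depending
    on its predecessors contributes 0, and v may be any sequence. *)
Definition gram_schmidt (v : nat -> E) (k : nat) : E :=
  normalize (v k - \sum_(e <- gram_schmidt_list v k) hdot (v k) e *: e).

(** Orthonormal families padded with zero vectors: for e <> 0, the equation
    <e, e> e = e says that |e| = 1. *)
Definition orthonormal0 (eps : nat -> E) : Prop :=
  (forall i j, i != j -> hdot (eps i) (eps j) = 0) /\
  (forall i, hdot (eps i) (eps i) *: eps i = eps i).

Definition eproj (eps : nat -> E) (J : nat) (x : E) : E := \sum_(j < J) hdot x (eps j) *: eps j.

Lemma gram_schmidt_rest v k : gram_schmidt v k = normalize (v k - eproj (gram_schmidt v) k (v k)).
Proof.
rewrite /gram_schmidt; congr (normalize (_ - _)).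
have -> : gram_schmidt_list v k = map (gram_schmidt v) (iota 0 k).
  elim: k => // k IH; rewrite -addn1 iotaD add0n map_cat /= -IH cats1.
  by rewrite addn1.
by rewrite big_map /eproj -(big_mkord xpredT (fun j => hdot (v k) (gram_schmidt v j) *: gram_schmidt v j))
  /index_iota subn0.
Qed.

Lemma normalize1 w : hdot (normalize w) (normalize w) *: normalize w = normalize w.
Proof.
rewrite /normalize; have [->|w0] := eqVneq w 0; first by rewrite !scaler0.
have nw : `|w| != 0 by rewrite normr_eq0.
have cw : (`|w|^-1)^* = `|w|^-1 by rewrite fmorphV /= conj_norm.
rewrite hdotZl hdotZr cw hdot_norm; have -> : `|w|^-1 * (`|w|^-1 * `|w| ^+ 2) = 1 by field.
by rewrite scale1r.
Qed.

Lemma hdot_normalize w x : hdot w x = 0 -> hdot (normalize w) x = 0.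
Proof. by rewrite hdotZl => ->; rewrite mulr0. Qed.

Lemma hdot_hdot1 (e x : E) : hdot e e *: e = e -> hdot x e * hdot e e = hdot x e.
Proof.
move=> ee; rewrite -[in RHS]ee hdotZr mulrC; congr (_ * _).
exact: hdotC.
Qed.

Lemma gram_schmidt_orthonormal0 v : orthonormal0 (gram_schmidt v).
Proof.
have n1 i : hdot (gram_schmidt v i) (gram_schmidt v i) *: gram_schmidt v i = gram_schmidt v i by rewrite gram_schmidt_rest; exact: normalize1.
split=> //.
have lt k i : (i < k)%N -> hdot (gram_schmidt v k) (gram_schmidt v i) = 0.
  elim/ltn_ind: k i => k IH i ik; rewrite gram_schmidt_rest; apply: hdot_normalize.
  rewrite hdotBl /eproj hdot_suml (bigD1 (Ordinal ik)) //= big1 ?addr0.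
    by rewrite hdotZl hdot_hdot1 // subrr.
  move=> j ji; rewrite hdotZl.
  suff -> : hdot (gram_schmidt v j) (gram_schmidt v i) = 0 by rewrite mulr0.
  have ij : j != i :> nat by apply: contra_neq ji => ji; apply: val_inj.
  case: (ltngtP j i) => [lt_ji|lt_ij|e]; last by rewrite e eqxx in ij.
    by rewrite hdotC IH ?conjC0.
  exact: IH.
move=> i j; case: (ltngtP i j) => // [ij|ji] _; last exact: lt.
by rewrite hdotC lt // conjC0.
Qed.

Lemma gram_schmidt_span v k : v k = eproj (gram_schmidt v) k.+1 (v k).
Proof.
have [orth n1] := gram_schmidt_orthonormal0 v.
rewrite /eproj big_ord_recr /= -/(eproj (gram_schmidt v) k (v k)).
set w := v k - eproj (gram_schmidt v) k (v k).
have E1 : gram_schmidt v k = normalize w by rewrite gram_schmidt_rest.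
have E2 : hdot (v k) (gram_schmidt v k) = `|w|.
  rewrite -[v k in LHS](subrK (eproj (gram_schmidt v) k (v k))) -/w hdotDl.
  rewrite [X in _ + X](_ : _ = 0) ?addr0; last first.
    rewrite /eproj hdot_suml big1 // => j _; rewrite hdotZl orth ?mulr0 //.
    by rewrite neq_ltn ltn_ord.
  rewrite E1 /normalize hdotZr hdot_norm fmorphV /= conj_norm.
  have [->|w0] := eqVneq w 0; first by rewrite normr0 expr0n mulr0.
  by field; rewrite normr_eq0.
rewrite E2 E1 /normalize scalerA.
have [w0|w0] := eqVneq w 0.
  by rewrite w0 scaler0 addr0; apply/eqP; rewrite -subr_eq0 -/w w0.
by rewrite divff ?normr_eq0 // scale1r /w addrC subrK.
Qed.

Lemma eproj_fix (eps : nat -> E) x k J : orthonormal0 eps -> (k <= J)%N ->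
  x = eproj eps k x -> eproj eps J x = x.
Proof.
move=> [orth n1] kJ xk; rewrite [RHS]xk /eproj -(subnKC kJ) big_split_ord /= [X in _ + X]big1 ?addr0 //.
move=> j _; rewrite xk /eproj hdot_suml big1 ?scale0r // => i _.
rewrite hdotZl orth ?mulr0 // neq_ltn; apply/orP; left.
by apply: leq_trans (ltn_ord i) _; exact: leq_addr.
Qed.

Lemma hdot_eproj eps J x : orthonormal0 eps -> hdot (eproj eps J x) (eproj eps J x) = hdot x (eproj eps J x).
Proof.
move=> [orth n1]; rewrite {1}/eproj hdot_suml /eproj [RHS]hdot_sumr; apply: eq_bigr => i _.
rewrite hdotZl hdot_sumr (bigD1 i) //= big1 ?addr0 => [|j ji]; last first.
  by rewrite hdotZr orth ?mulr0 // eq_sym; apply: contra_neq ji => ji; exact: val_inj.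
by rewrite !hdotZr mulrCA hdot_hdot1.
Qed.

Lemma norm_eproj eps J x : orthonormal0 eps -> `|eproj eps J x| <= `|x|.
Proof.
move=> eO; have [->|e0] := eqVneq (eproj eps J x) 0; first by rewrite normr0.
have e1 : 0 < `|eproj eps J x| by rewrite normr_gt0.
rewrite -(ler_pM2r e1) -expr2 -hdot_norm hdot_eproj //.
apply: le_trans (hdot_le _ _); rewrite real_ler_norm // -hdot_eproj // ger0_real //.
exact: hdot_ge0.
Qed.

End GramSchmidt.

(** * Expansions in tensor products *)

Section TensorExpansion.
Variables (n : nat) (R : realType) (E : hilbertType R).
Local Notation F2 := (fock n R[i]).

Lemma eproj_linear (eps : nat -> E) J : linear (eproj eps J).
Proof.
move=> c x y; rewrite /eproj scaler_sumr -big_split; apply: eq_bigr => j _.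
by rewrite hdotDl hdotZl scalerDl scalerA.
Qed.

Definition fexpand (eps : nat -> E) J (z : fock n E) : fock n E :=
  \sum_(j < J) ftens (adj (ftens_right n (eps j)) z) (eps j).

Lemma fexpandE eps J z s : fexpand eps J z s = eproj eps J (z s).
Proof.
rewrite /fexpand (big_morph (fun w : fock n E => w s) (fun x y => fockD x y s) (fock0 E s)).
apply: eq_bigr => j _; rewrite -[LHS]/((adj (ftens_right n (eps j)) z : F2) s *: eps j).
by rewrite -hdot_fvec -adjPr ftens_rightE ftens_fvec hdot_single.
Qed.

Lemma fexpandB eps J z w : fexpand eps J (z - w) = fexpand eps J z - fexpand eps J w.
Proof.
apply: fock_ext => s; rewrite fockD fockN !fexpandE fockD fockN.
by rewrite addrC -scaleN1r eproj_linear scaleN1r addrC.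
Qed.

Lemma norm_fexpand eps J z : orthonormal0 eps -> `|fexpand eps J z| <= `|z|.
Proof.
move=> eO; apply: fock_norm_le => // N; apply: le_trans (fock_lsum_le z N).
apply: ler_lsum => s; rewrite fexpandE ler_pXn2r ?nnegrE //; exact: norm_eproj.
Qed.

(** Countably many elements of F2 (x) E have countably many coordinates in E.
    Gram-Schmidt on these gives one family along which all the elements expand,
    as they would along an orthonormal basis of E; E may be nonseparable. *)
Lemma gram_schmidt_expansion (z : nat -> fock n E) : exists2 eps : nat -> E, orthonormal0 eps &
  forall i, fexpand eps J (z i) @[J --> \oo] --> z i.
Proof.
pose v k : E := if (pickle_inv k : option (nat * seq 'I_n)) is Some p then z p.1 p.2 else 0.
have eO := gram_schmidt_orthonormal0 v; exists (gram_schmidt v) => // i.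
have fixz s J : (choice.pickle (i, s) < J)%N -> eproj (gram_schmidt v) J (z i s) = z i s.
  move=> sJ; have vE : v (choice.pickle (i, s)) = z i s by rewrite /v pickleK_inv.
  apply: (eproj_fix eO sJ); rewrite -vE; exact: gram_schmidt_span.
apply/cvgC_seqP => e e0; have e2 : 0 < e / 2 by rewrite divr_gt0.
have [L HL] := (cvgC_seqP _ _).1 (@ftrunc_cvg _ _ _ (z i)) _ e2.
(* J0 exceeds the codes of all the pairs (i, s) with s shorter than L, so the
   expansion up to J0 fixes the truncation of z i at length L *)
pose J0 := (\max_(k < L) \max_(s : k.-tuple 'I_n) (choice.pickle (i, val s)).+1)%N.
exists J0 => J J0J; set t := ftrunc (z i) L.
have tt : fexpand (gram_schmidt v) J t = t.
  apply: fock_ext => s; rewrite fexpandE ftruncE; case: ltnP => sL; last first.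
    by rewrite /eproj big1 // => j _; rewrite hdot0l scale0r.
  apply: fixz; apply: leq_trans J0J; rewrite /J0.
  apply: leq_trans (leq_bigmax (Ordinal sL)) => /=.
  exact: (leq_bigmax (in_tuple s)).
have -> : z i - fexpand (gram_schmidt v) J (z i) = (z i - t) - fexpand (gram_schmidt v) J (z i - t).
  by rewrite fexpandB tt opprB addrC addrA subrK addrC.
apply: le_trans (ler_normB _ _) _; rewrite (splitr e) rmorphD.
have h := HL L (leqnn L); apply: lerD => //.
exact: le_trans (norm_fexpand _ _ eO) h.
Qed.

Variable N : csubspace F2.
Local Notation NE := (stens N E).

Definition selem_right (k : E) : bop N NE :=
  xget 0 [set T : bop N NE | forall y, T y = selem y k].

Lemma selem_rightE k y : selem_right k y = selem y k.
Proof.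
suff : exists T : bop N NE, forall y, T y = selem y k by move=> /(xgetPex 0) /(_ y).
have fl : linear (fun y : N => selem y k) by move=> c x z; exact: selem_lin.
have fb (x : N) : `|selem x k| <= (rnorm k)%:C * `|x|.
  rewrite -rnormE -(@ler_pXn2r _ 2) ?nnegrE ?mulr_ge0 // exprMn -!hdot_norm selem_dot mulrC.
  exact: lexx.
by exists (mkbopM fl fb).
Qed.

(** Contraction of the second tensor factor against k. *)
Definition scoef (k : E) : bop NE N := adj (selem_right k).

Lemma hdot_scoef k z x : hdot (scoef k z) x = hdot z (selem x k).
Proof. by rewrite /scoef -adjPr selem_rightE. Qed.

Lemma scoef_expansion eps (z : NE) :
  fexpand eps J (val z) @[J --> \oo] --> (val z : fock n E) ->
  \sum_(j < J) selem (scoef (eps j) z) (eps j) @[J --> \oo] --> z.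
Proof.
move=> zc; have nE : tens_dot (@ftens n R E) by move=> *; exact: hdot_ftens.
pose Z := btens (@ftens n R E) (@selem n R N E) (bproj N).
have Zc : (fun J => Z (fexpand eps J (val z))) @ \oo --> Z (val z).
  exact: (@continuous_cvg _ _ _ \oo _ _ Z _ (@bop_continuous _ _ _ Z (val z)) zc).
rewrite btens_proj_id in Zc; apply: cvg_trans Zc.
suff -> : (fun J => Z (fexpand eps J (val z))) =
  (fun J => \sum_(j < J) selem (scoef (eps j) z) (eps j)) by [].
apply/funext => J; rewrite /fexpand bop_sum; apply: eq_bigr => j _.
rewrite /Z (btensP _ nE (@selem_dot n R N E) (@ftens_total n R E)); congr selem.
apply: hdot_ext => x; rewrite hdot_bproj -adjPr ftens_rightE hdot_scoef csub_hdot.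
by [].
Qed.

Lemma hdot_btens_selem (chi : bop N N) z x k :
  hdot (btens (@selem n R N E) (@selem n R N E) chi z) (selem x k) = hdot (chi (scoef k z)) x.
Proof.
have sd := @selem_dot n R N E; have st := @selem_total n R N E.
by rewrite adjP btens_adj // btensP // -hdot_scoef -adjP.
Qed.

(** chi (x) I acts on the coefficients along eps only. Written as this series,
    <(chi (x) I) z, w> depends on chi in a completely positive and ultraweakly
    continuous way. *)
Lemma btens_expansion (chi : bop N N) eps (z w : NE) :
  fexpand eps J (val w) @[J --> \oo] --> (val w : fock n E) ->
  \sum_(j < J) hdot (chi (scoef (eps j) z)) (scoef (eps j) w) @[J --> \oo] -->
    hdot (btens (@selem n R N E) (@selem n R N E) chi z) w.
Proof.
move=> /scoef_expansion wc; set Z := btens _ _ chi z.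
have c : (fun=> Z) @ \oo --> Z by exact: cvg_cst.
have := cvg_hdot c wc.
suff -> : (fun k => hdot Z (\sum_(j < k) selem (scoef (eps j) w) (eps j))) =
  (fun J => \sum_(j < J) hdot (chi (scoef (eps j) z)) (scoef (eps j) w)) by [].
by apply/funext => J; rewrite hdot_sumr; apply: eq_bigr => j _; rewrite hdot_btens_selem.
Qed.

Lemma scoef_bessel eps J (z : NE) : orthonormal0 eps ->
  \sum_(j < J) `|scoef (eps j) z| ^+ 2 <= `|z| ^+ 2.
Proof.
move=> [orth n1]; pose y := \sum_(j < J) selem (scoef (eps j) z) (eps j).
set S := \sum_(j < J) _; have S0 : 0 <= S by apply: sumr_ge0 => j _; rewrite exprn_ge0.
have e1 j : hdot (eps j) (eps j) <= 1.
  have [->|e0] := eqVneq (eps j) 0; first by rewrite hdot0l.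
  have := congr1 (fun w => hdot w (eps j)) (n1 j); rewrite hdotZl => h.
  have ee : hdot (eps j) (eps j) != 0 by apply: contra_neq e0 => /hdot_eq0.
  by rewrite -[X in _ = X]mul1r in h; rewrite (mulIf ee h).
have zy : hdot z y = S.
  by rewrite hdot_sumr; apply: eq_bigr => j _; rewrite -hdot_scoef hdot_norm.
have yy : hdot y y <= S.
  rewrite {1}/y hdot_suml; apply: ler_sum => i _; rewrite hdot_sumr (bigD1 i) //= big1 ?addr0.
    by rewrite selem_dot hdot_norm ler_piMr // exprn_ge0.
  move=> j ji; rewrite selem_dot orth ?mulr0 // eq_sym.
  by apply: contra_neq ji => ji; exact: val_inj.
have [->|Sn] := eqVneq S 0; first by rewrite exprn_ge0.
have Sp : 0 < S by rewrite lt_neqAle eq_sym Sn.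
have h : S ^+ 2 <= `|z| ^+ 2 * S.
  apply: le_trans (ler_wpM2l _ yy); last by rewrite exprn_ge0.
  rewrite hdot_norm -exprMn -(ger0_norm S0) ler_pXn2r ?nnegrE ?mulr_ge0 // -zy.
  exact: hdot_le.
by rewrite expr2 ler_pM2r in h.
Qed.

End TensorExpansion.

(** * Absolutely convergent series *)

Section DoubleSeries.
Variable R : realType.

Lemma cstC_cvg (c : R[i]) : (fun _ : nat => c) @ \oo --> c.
Proof. exact: cvg_cst. Qed.

Lemma cvgC_bigsum (I : Type) (r : seq I) (u : I -> nat -> R[i]) (l : I -> R[i])
    (s : nat -> R[i]) (t : R[i]) :
  (forall i, u i @ \oo --> l i) -> (forall J, s J = \sum_(i <- r) u i J) ->
  t = \sum_(i <- r) l i -> s @ \oo --> t.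
Proof.
move=> ul; elim: r s t => [|i r IH] s t sE tE.
  have -> : s = fun=> t by apply/funext => J; rewrite sE tE !big_nil.
  exact: cstC_cvg.
have -> : s = fun J => u i J + (s J - u i J) by apply/funext => J; rewrite addrC subrK.
rewrite -(subrK (l i) t) addrC; apply: cvgC_add; first exact: ul.
apply: IH => [J|]; first by rewrite sE big_cons addrC addKr.
by rewrite tE big_cons addrC addKr.
Qed.

Lemma abs_series_cvg (g G : nat -> R[i]) (M : R[i]) : (forall k, `|g k| <= G k) ->
  (forall N, \sum_(k < N) G k <= M) -> exists L : R[i], series g @ \oo --> L.
Proof.
move=> gG GM.
(* words over a one-letter alphabet are natural numbers *)
have E (u : nat -> R[i]) : series u = lsum (fun s : seq 'I_1 => u (size s)).
  apply/funext => N; rewrite /series /= big_mkord /lsum; apply: eq_bigr => k _.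
  rewrite (eq_bigr (fun=> u k)) => [|t _]; last by rewrite size_tuple.
  by rewrite sumr_const card_tuple card_ord exp1n.
apply: (iffLR (cvg_ex _)); rewrite E.
apply: (@lsum_cvg _ _ _ (fun s : seq 'I_1 => G (size s)) M) => [s|N]; first exact: gG.
by rewrite -E /series /= big_mkord.
Qed.

(** A double family as a sequence, along an enumeration of the pairs; numbers that
    are not codes of pairs give 0. *)
Definition unpair (V : nmodType) (f : nat -> nat -> V) (i : nat) : V :=
  if (pickle_inv i : option (nat * nat)) is Some p then f p.1 p.2 else 0.

(** The part of [unpair f] that comes from the pairs in a K by J box. *)
Definition boxterm (V : nmodType) (f : nat -> nat -> V) K J (i : nat) : V :=
  if (pickle_inv i : option (nat * nat)) is Some p then
    (if (p.1 < K)%N && (p.2 < J)%N then f p.1 p.2 else 0) else 0.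

Lemma boxterm_sum (V : nmodType) (f : nat -> nat -> V) K J i :
  \sum_(k < K) \sum_(j < J) (if choice.pickle (k : nat, j : nat) == i then f k j else 0) =
  boxterm f K J i.
Proof.
rewrite /boxterm.
have E k j : (choice.pickle (k, j) == i) = ((pickle_inv i : option (nat * nat)) == Some (k, j)).
  apply/eqP/eqP => [<-|h]; first exact: pickleK_inv.
  by have := @pickle_invK (nat * nat)%type i; rewrite h.
under eq_bigr do under eq_bigr do rewrite E.
case: (pickle_inv i) => [[k0 j0]|]; last by rewrite big1 // => k _; rewrite big1.
have Eq (k j : nat) : (Some (k0, j0) == Some (k, j)) = (k0 == k) && (j0 == j) by [].
rewrite /=; case: ltnP => k0K /=; last first.
  rewrite big1 // => k _; rewrite big1 // => j _; rewrite Eq.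
  by case: eqP => // e; move: (ltn_ord k); rewrite -e ltnNge k0K.
case: ltnP => j0J; last first.
  rewrite big1 // => k _; rewrite big1 // => j _; rewrite Eq.
  by case: (j0 =P j) => [e|_]; [move: (ltn_ord j); rewrite -e ltnNge j0J|rewrite andbF].
rewrite (bigD1 (Ordinal k0K)) //= [X in _ + X]big1 ?addr0 => [|k kk]; last first.
  rewrite big1 // => j _; rewrite Eq; case: (k0 =P k) => // e.
  by case/eqP: kk; apply: val_inj.
rewrite (bigD1 (Ordinal j0J)) //= [X in _ + X]big1 ?addr0 => [|j jj]; last first.
  rewrite Eq; case: (j0 =P j) => [e|]; last by rewrite andbF.
  by case/eqP: jj; apply: val_inj.
by rewrite eqxx.
Qed.

Lemma box_sum (V : nmodType) (f : nat -> nat -> V) K J : exists I0, forall I, (I0 <= I)%N ->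
  \sum_(k < K) \sum_(j < J) f k j = \sum_(i < I) boxterm f K J i.
Proof.
exists (\max_(k < K) \max_(j < J) (choice.pickle (k : nat, j : nat)).+1)%N => I I0I.
under [RHS]eq_bigr do rewrite -boxterm_sum.
rewrite [RHS]exchange_big; apply: eq_bigr => k _; rewrite [RHS]exchange_big.
apply: eq_bigr => j _ /=.
have lt : (choice.pickle (k : nat, j : nat) < I)%N.
  apply: leq_trans I0I; apply: leq_trans (leq_bigmax k) => /=.
  exact: (leq_bigmax j).
rewrite (bigD1 (Ordinal lt)) //= eqxx big1 ?addr0 // => i ii.
by case: eqP => // e; case/eqP: ii; apply: val_inj.
Qed.

Lemma boxterm_full I : exists K0, forall K J, (K0 <= K)%N -> (K0 <= J)%N ->
  forall (V : nmodType) (f : nat -> nat -> V) i, (i < I)%N -> boxterm f K J i = unpair f i.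
Proof.
pose c i := if (pickle_inv i : option (nat * nat)) is Some p then (p.1 + p.2).+1 else 0%N.
exists (\max_(i < I) c i)%N => K J K0K K0J V f i iI.
have ci : (c i <= \max_(i < I) c i)%N by exact: (leq_bigmax (Ordinal iI)).
move: K0K K0J ci; move: (\max_(_ < _) _)%N => M KM JM.
rewrite /boxterm /unpair /c; case: (pickle_inv i) => // -[k j] /= kj.
have -> : (k < K)%N by lia.
by have -> : (j < J)%N by lia.
Qed.

Lemma unpair_le (G : nat -> nat -> R[i]) M : (forall k j, 0 <= G k j) ->
  (forall K J, \sum_(k < K) \sum_(j < J) G k j <= M) ->
  forall I, \sum_(i < I) unpair G i <= M.
Proof.
move=> G0 GM I; have [K0 HK] := boxterm_full I; have [I0 HI] := box_sum G K0 K0.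
have b0 K J i : 0 <= boxterm G K J i.
  by rewrite /boxterm; case: (pickle_inv i) => // p; case: ifP.
apply: le_trans (GM K0 K0); rewrite (HI (maxn I0 I)) ?leq_maxl //.
rewrite -(subnKC (leq_maxr I0 I)) big_split_ord /= [X in _ <= X + _](eq_bigr (fun i : 'I_I => unpair G i)).
  by rewrite lerDl; apply: sumr_ge0.
by move=> i _ /=; rewrite HK.
Qed.

(** Fubini: the sum over a large box and a partial sum of [unpair f] differ by
    terms of a tail of the dominating series. *)
Lemma double_series (f G : nat -> nat -> R[i]) (r : nat -> R[i]) (M : R[i]) :
  (forall k j, `|f k j| <= G k j) ->
  (forall K J, \sum_(k < K) \sum_(j < J) G k j <= M) ->
  (forall k, \sum_(j < J) f k j @[J --> \oo] --> r k) ->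
  exists2 L : R[i], series (unpair f) @ \oo --> L & series r @ \oo --> L.
Proof.
move=> fG GM fr.
have G0 k j : 0 <= G k j by exact: le_trans (fG k j).
have uG i : `|unpair f i| <= unpair G i.
  by rewrite /unpair; case: (pickle_inv i) => [[k j]|] /=; rewrite ?normr0.
have u0 i : 0 <= unpair G i by rewrite /unpair; case: (pickle_inv i).
have uM := unpair_le G0 GM.
have [L gL] := abs_series_cvg uG uM.
have uGG i : `|unpair G i| <= unpair G i by rewrite ger0_norm.
have [A GA] := @abs_series_cvg (unpair G) (unpair G) M uGG uM.
exists L; first exact: gL.
apply/cvgC_seqP => e e0; have e2 : 0 < e / 2 by rewrite divr_gt0.
have [N1 HN1] := (cvgC_seqP _ _).1 gL _ e2.
have [N2 HN2] := (cvgC_seqP _ _).1 GA _ e2.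
pose N := maxn N1 N2.
have [K0 HK] := boxterm_full N; exists K0 => K KK.
rewrite (splitr e) rmorphD.
apply: le_trans (ler_normC_sub _ (series (unpair f) N) _) _; apply: lerD.
  by apply: HN1; exact: leq_maxl.
pose box J : R[i] := \sum_(k < K) \sum_(j < J) f k j.
have sK : series r K = \sum_(k < K) r k by rewrite /series /= big_mkord.
have [sr srE] : exists sr : R[i], sr = series r K by exists (series r K).
rewrite -srE in sK *.
have rc : box @ \oo --> sr by apply: (cvgC_bigsum (fun k : 'I_K => fr k) _ sK).
have [SN SNE] : exists SN : R[i], SN = series (unpair f) N by exists (series (unpair f) N).
rewrite -SNE.
have dc : `|SN - box J| @[J --> \oo] --> `|SN - sr|.
  have h := cvgC_sub (@cstC_cvg SN) rc.
  exact: (@cvg_norm _ R[i] _ \oo _ _ _ h).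
apply: cvgC_le dc; exists K0 => // J /= KJ.
have [I0 HI] := box_sum f K J; rewrite SNE /box (HI (maxn I0 N)) ?leq_maxl // distrC.
rewrite -(subnKC (leq_maxr I0 N)) big_split_ord /= (eq_bigr (fun i : 'I_N => unpair f i)); last first.
  by move=> i _ /=; rewrite HK.
rewrite /series /= big_mkord addrC addrK.
pose sG I : R[i] := \sum_(i < I) unpair G i.
have sGE : series (unpair G) = sG by apply/funext => I; rewrite /series /= big_mkord.
rewrite sGE in GA HN2.
have A_le I : sG I <= A.
  apply: cvgC_ge GA; exists I => // I' /= II'; rewrite /sG -(subnKC II').
  by rewrite big_split_ord lerDl; apply: sumr_ge0.
have tail : \sum_(i < maxn I0 N - N) unpair G (N + i)%N <= A - sG N.
  rewrite lerBrDl; apply: le_trans (A_le (N + (maxn I0 N - N))%N).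
  by rewrite /sG big_split_ord.
apply: le_trans (ler_norm_sum _ _ _) _.
apply: (@le_trans _ _ (\sum_(i < maxn I0 N - N) unpair G (N + i)%N)).
  apply: ler_sum => i _.
  rewrite /boxterm /unpair; case: (pickle_inv _) => [[k j]|] /=; last by rewrite normr0.
  by case: ifP => _ //; rewrite normr0.
apply: le_trans tail _; apply: le_trans (HN2 N (leq_maxr _ _)).
by rewrite real_ler_norm // ger0_real // subr_ge0.
Qed.

End DoubleSeries.

(** * The ultraweak topology *)

Section InitialTopology.

Lemma cvg_initial (S : choiceType) (T : topologicalType) (f : S -> T)
    (F : set_system S) (s : S) : Filter F ->
  (f @ F --> f s) -> F --> (s : initial_topology f).
Proof.
move=> FF fF A /= [_ [[B Bop <-] Bfs sBfA]].
apply: filterS sBfA _; apply: fF; exact: open_nbhs_nbhs.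
Qed.

Lemma cvg_ptws (I : Type) (T : topologicalType) (F : set_system (I -> T)) (g : I -> T) :
  Filter F -> (forall i, (fun h => h i) @ F --> g i) -> F --> (g : {ptws I -> T}).
Proof.
move=> FF Fg; apply/cvg_sup => i.
exact: (@cvg_initial (I -> T) T (fun h => h i)).
Qed.

Lemma ptws_cvg (I : Type) (T : topologicalType) (F : set_system (I -> T)) (g : I -> T) i :
  Filter F -> F --> (g : {ptws I -> T}) -> (fun h => h i) @ F --> g i.
Proof.
move=> FF /cvg_sup /(_ i) Fi.
have c := @initial_continuous (I -> T) T (fun h => h i) g.
exact: cvg_trans (cvg_app _ Fi) c.
Qed.

End InitialTopology.

Section UltraweakTopology.
Variables (R : realType) (H : hilbertType R).
Implicit Types (T : bop H H) (p : sq_pair H).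

Definition weval T p : R[i] := wstar_eval T p.

Lemma cvg_wstar (I : Type) (F : set_system I) (u : I -> bop H H) T : Filter F ->
  (forall p, weval (u i) p @[i --> F] --> weval T p) -> (u : I -> wstar H) @ F --> (T : wstar H).
Proof.
move=> FF uT; apply: (@cvg_initial _ _ (@wstar_eval R H)).
apply: cvg_ptws => p; exact: uT.
Qed.

Lemma weval_continuous p : continuous (fun T : wstar H => weval T p).
Proof.
move=> T; have h1 := @initial_continuous _ _ (@wstar_eval R H) T.
have FF : Filter (@wstar_eval R H @ nbhs (T : wstar H)) by exact: fmap_filter.
exact (@ptws_cvg (sq_pair H) R[i] _ (wstar_eval T) p FF h1).
Qed.

Lemma wcvg_weval (I : Type) (F : set_system I) (u : I -> bop H H) T p : Filter F ->
  (u : I -> wstar H) @ F --> (T : wstar H) -> weval (u i) p @[i --> F] --> weval T p.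
Proof.
move=> FF uT.
exact: (@continuous_cvg _ _ _ F FF (u : I -> wstar H) (fun T => weval T p) T (@weval_continuous p T) uT).
Qed.

(** Take the sequences (x, 0, 0, ...) and (y, 0, 0, ...). *)
Lemma rank1_exists (x y : H) : exists p, forall T, weval T p = hdot (T x) y.
Proof.
pose d (z : H) (k : nat) : H := if k == 0%N then z else 0.
have sd z : sq_summable (d z).
  exists (`|z| ^+ 2); case=> [|N]; first by rewrite big_ord0 exprn_ge0.
  by rewrite big_ord_recl /= big1 ?addr0 // => i _; rewrite normr0 expr0n.
exists (exist _ (d x, d y) (conj (sd x) (sd y))) => T.
rewrite /weval /wstar_eval /=; apply: cvg_lim; first exact: (@norm_hausdorff _ R[i]).
apply: cvg_near_cst; exists 1%N => // -[|N] // _.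
rewrite /series /= big_mkord big_ord_recl /= big1 ?addr0 // => i _.
by rewrite bop0 hdot0l.
Qed.

Lemma sq_pair_bound p : exists2 M : R[i], 0 <= M & forall N,
  \sum_(k < N) (`|(sval p).1 k| ^+ 2 + `|(sval p).2 k| ^+ 2) <= M.
Proof.
have [[M xM] [L yL]] := svalP p; exists (M + L).
  by have := lerD (xM 0%N) (yL 0%N); rewrite !big_ord0 addr0.
by move=> N; rewrite big_split lerD.
Qed.

Lemma mul_le_sq (x y : H) : `|x| * `|y| <= `|x| ^+ 2 + `|y| ^+ 2.
Proof.
have h : 0 <= `|x| * `|y| by rewrite mulr_ge0.
apply: (@le_trans _ _ ((`|x| * `|y|) *+ 2)); first by rewrite mulr2n lerDl.
rewrite -subr_ge0 (_ : _ - _ = (`|x| - `|y|) ^+ 2); last by ring.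
by rewrite -real_normK ?rpredB ?normr_real // exprn_ge0.
Qed.

Lemma weval_cvg T p :
  (fun N => \sum_(k < N) hdot (T ((sval p).1 k)) ((sval p).2 k)) @ \oo --> weval T p.
Proof.
have [C C0 TC] := bop_bounded T; have [M M0 pM] := sq_pair_bound p.
have C1 : 0 <= C%:C :> R[i] by rewrite ler0c ltW.
pose G k : R[i] := C%:C * (`|(sval p).1 k| ^+ 2 + `|(sval p).2 k| ^+ 2).
have tG k : `|hdot (T ((sval p).1 k)) ((sval p).2 k)| <= G k.
  apply: le_trans (hdot_le _ _) _; rewrite /G.
  apply: (@le_trans _ _ (C%:C * (`|(sval p).1 k| * `|(sval p).2 k|))).
    by rewrite mulrA ler_wpM2r.
  by rewrite ler_wpM2l // mul_le_sq.
have GM N : \sum_(k < N) G k <= C%:C * M by rewrite -mulr_sumr ler_wpM2l.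
have [L sL] := abs_series_cvg tG GM.
have -> : weval T p = L by apply: cvg_lim sL; exact: (@norm_hausdorff _ R[i]).
have sE : series (fun k => hdot (T ((sval p).1 k)) ((sval p).2 k)) =
    (fun N => \sum_(k < N) hdot (T ((sval p).1 k)) ((sval p).2 k)).
  by apply/funext => N; rewrite /series /= big_mkord.
by rewrite -sE.
Qed.

Lemma wevalD T T' c p : weval (c *: T + T') p = c * weval T p + weval T' p.
Proof.
have h1 := cvgC_mul (@cstC_cvg _ c) (@weval_cvg T p).
have h := cvgC_add h1 (@weval_cvg T' p).
apply: (cvg_uniq (@weval_cvg (c *: T + T') p)); apply: cvg_trans h.
suff -> : (fun N => \sum_(k < N) hdot ((c *: T + T') ((sval p).1 k)) ((sval p).2 k)) =
  (fun N => c * \sum_(k < N) hdot (T ((sval p).1 k)) ((sval p).2 k) +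
     \sum_(k < N) hdot (T' ((sval p).1 k)) ((sval p).2 k)) by [].
apply/funext => N; rewrite mulr_sumr -big_split; apply: eq_bigr => k _.
have E z : (c *: T + T') z = c *: T z + T' z by [].
by rewrite E hdotDl hdotZl.
Qed.

(** An ultraweak functional is a series whose tails are uniformly small on bounded
    sets of operators, and its partial sums are weakly continuous. *)
Lemma wot_bounded_wcvg (T : nat -> bop H H) (S : bop H H) (C : R) : 0 <= C ->
  (forall k x y, `|hdot (T k x) y| <= C%:C * (`|x| * `|y|)) ->
  wot_cvg T S -> (T : nat -> wstar H) @ \oo --> (S : wstar H).
Proof.
move=> C0 TC TS; apply: cvg_wstar => p; apply/cvgC_seqP => e e0.
have C0' : 0 <= C%:C :> R[i] by rewrite ler0c.
have SC x y : `|hdot (S x) y| <= C%:C * (`|x| * `|y|).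
  have h := TS x y.
  have h2 : `|hdot (T k x) y| @[k --> \oo] --> `|hdot (S x) y|.
    exact: (@cvg_norm _ R[i] _ \oo _ _ _ h).
  by apply: cvgC_le h2; apply: nearW.
have [M M0 pM] := sq_pair_bound p; set x := (sval p).1; set y := (sval p).2.
pose g k : R[i] := C%:C * (`|x k| ^+ 2 + `|y k| ^+ 2).
have g0 k : 0 <= g k by rewrite mulr_ge0 // addr_ge0 // exprn_ge0.
have gg k : `|g k| <= g k by rewrite ger0_norm.
have gM N : \sum_(k < N) g k <= C%:C * M by rewrite -mulr_sumr ler_wpM2l.
have [A sA] := abs_series_cvg gg gM.
pose sg N : R[i] := \sum_(k < N) g k.
have sgE : series g = sg by apply/funext => I; rewrite /series /= big_mkord.
rewrite sgE in sA; have e4 : 0 < e / 4 by rewrite divr_gt0.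
have [N HN] := (cvgC_seqP _ _).1 sA _ e4.
have A_le I : sg I <= A.
  apply: cvgC_ge sA; exists I => // I' /= II'; rewrite /sg -(subnKC II').
  by rewrite big_split_ord lerDl; apply: sumr_ge0.
pose part U I : R[i] := \sum_(k < I) hdot ((U : bop H H) (x k)) (y k).
have tail U : (forall x y, `|hdot ((U : bop H H) x) y| <= C%:C * (`|x| * `|y|)) ->
    `|weval U p - part U N| <= (e / 4)%:C.
  move=> UC; have c := cvgC_sub (@weval_cvg U p) (@cstC_cvg _ (part U N)).
  have c2 : `|part U I - part U N| @[I --> \oo] --> `|weval U p - part U N|.
    exact: (@cvg_norm _ R[i] _ \oo _ _ _ c).
  apply: cvgC_le c2; exists N => // I /= NI; rewrite /part -(subnKC NI) big_split_ord /= addrC addrK.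
  apply: le_trans (ler_norm_sum _ _ _) _.
  apply: (@le_trans _ _ (\sum_(i < I - N) g (N + i)%N)).
    apply: ler_sum => i _; apply: le_trans (UC _ _) _; rewrite ler_wpM2l //.
    exact: mul_le_sq.
  apply: le_trans (_ : _ <= A - sg N) _.
    by rewrite lerBrDl; apply: le_trans (A_le (N + (I - N))%N); rewrite /sg big_split_ord.
  apply: le_trans (HN N (leqnn _)); rewrite real_ler_norm // ger0_real // subr_ge0.
  exact: A_le.
have pc : (fun k => part (T k) N) @ \oo --> part S N.
  have h j : (fun k => hdot (T k (x j)) (y j)) @ \oo --> hdot (S (x j)) (y j) by exact: TS.
  exact: (cvgC_bigsum (fun k : 'I_N => h k) (fun J => erefl) erefl).
have e2 : 0 < e / 2 by rewrite divr_gt0.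
have [K HK] := (cvgC_seqP _ _).1 pc _ e2.
exists K => k Kk.
apply: le_trans (ler_normC_sub _ (part S N) _) _.
have -> : e = e / 4 + (e / 2 + e / 4) by lra.
rewrite !rmorphD; apply: lerD; first exact: tail.
apply: le_trans (ler_normC_sub _ (part (T k) N) _) _; apply: lerD; first exact: HK.
by rewrite distrC; apply: tail.
Qed.

End UltraweakTopology.

Section UltraweakMaps.
Variables (R : realType).
Implicit Types H K : hilbertType R.

Lemma sq_summable_bop H K (V : bop H K) (x : nat -> H) :
  sq_summable x -> sq_summable (fun k => V (x k)).
Proof.
have [C C0 VC] := bop_bounded V => -[M xM]; exists (C%:C ^+ 2 * M) => N.
have C1 : 0 <= C%:C :> R[i] by rewrite ler0c ltW.
apply: le_trans (ler_wpM2l (exprn_ge0 2 C1) (xM N)); rewrite mulr_sumr.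
by apply: ler_sum => k _; rewrite -exprMn ler_pXn2r ?nnegrE ?mulr_ge0.
Qed.

Lemma weval_conj H K (V : bop H K) (p : sq_pair H) :
  exists q : sq_pair K, forall T, weval (adj V ∘ T ∘ V) p = weval T q.
Proof.
have [px py] := svalP p.
exists (exist _ (_, _) (conj (sq_summable_bop V px) (sq_summable_bop V py))) => T.
rewrite /weval /wstar_eval /=; congr (limn (series _)); apply/funext => k.
by rewrite -[X in hdot X _]/(adj V (T (V ((sval p).1 k)))) -adjPr.
Qed.

End UltraweakMaps.

(** * The operator system of the model *)

Section OperatorSystem.
Variables (n : nat) (R : realType) (a : seq 'I_n -> R) (m : nat) (P : set (ncpoly R n)).
Local Notation N := (NP a m P).
Local Notation S := (Swstar a m P).
Local Notation B := (Bmodel a m P).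
Local Notation gens := [set T : bop N N | exists s t, T = BB a m P s t].

(** If every ultraweak functional composed with f is affine in such a functional,
    then f is ultraweakly continuous and maps the closure of the span into any
    closed set that contains the image of the span. *)
Lemma Swstar_map (f : bop N N -> bop N N) :
  (forall p, exists q c d, forall T, weval (f T) p = c * weval T q + d) ->
  (forall T, lspan gens T -> S (f T)) -> forall T, S T -> S (f T).
Proof.
move=> fc fS T ST.
have fcont : continuous (f : wstar N -> wstar N).
  move=> U; have FU := nbhs_filter (U : wstar N).
  apply: (@cvg_wstar R N _ _ f (f U) FU) => p; have [q [c [d fE]]] := fc p.
  rewrite (_ : (fun i => weval (f i) p) = fun i => c * weval i q + d); last first.
    by apply/funext => W; rewrite fE.
  rewrite fE.
  have h : weval i q @[i --> (U : wstar N)] --> weval U q by exact: weval_continuous.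
  have h1 : c * weval i q @[i --> (U : wstar N)] --> c * weval U q.
    exact: (@cvgM R[i] _ _ FU (fun=> c) _ _ _ (cvg_cst c) h).
  exact: (@cvgD _ R[i] _ _ FU _ (fun=> d) _ _ h1 (cvg_cst d)).
have cl : closed (f @^-1` S : set (wstar N)).
  apply: (@closed_comp (wstar N) (wstar N) f S) => [U _|]; first exact: fcont.
  exact: closed_closure.
suff : closure (lspan gens : set (wstar N)) `<=` (f @^-1` S : set (wstar N)) by apply.
rewrite [X in _ `<=` X]((closure_id (f @^-1` S : set (wstar N))).1 cl).
exact: closure_subset.
Qed.

Lemma Swstar_gen T : lspan gens T -> S T.
Proof. exact: subset_closure. Qed.

(** One variable at a time: T' in the span first, then T' in its closure. *)
Lemma Swstar_lin (c : R[i]) T T' : S T -> S T' -> S (c *: T + T').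
Proof.
have h1 U : S U -> forall U', lspan gens U' -> S (c *: U + U').
  move=> SU U' gU'; apply: (@Swstar_map (fun W => c *: W + U')) SU => [p|W gW].
    by exists p, c, (weval U' p) => W; rewrite wevalD.
  by apply: Swstar_gen; apply: lspanP.
move=> ST ST'; apply: (@Swstar_map (fun W => c *: T + W)) ST' => [p|W gW].
  by exists p, 1, (c * weval T p) => W; rewrite wevalD mul1r addrC.
exact: h1.
Qed.

Lemma opword_catBB s t u v :
  opword B s ∘ BB a m P u v ∘ adj (opword B t) = BB a m P (s ++ u) (t ++ v).
Proof. by rewrite /BB !opword_cat adj_comp; apply: bop_ext. Qed.

Lemma lspan_ind_bop (Q : bop N N -> Prop) : Q 0 ->
  (forall (c : R[i]) s t T, lspan gens T -> Q T -> Q (c *: BB a m P s t + T)) ->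
  forall T, lspan gens T -> Q T.
Proof.
move=> Q0 Ql T [k [c [s [gensP ->]]]].
elim: k c s gensP => [|k IH] c s gensP; first by rewrite big_ord0.
rewrite big_ord_recl; have [u [v ->]] := gensP ord0; apply: Ql.
  by exists k, (fun i => c (lift ord0 i)), (fun i => s (lift ord0 i)).
by apply: IH => i; exact: gensP.
Qed.

Lemma conjB_linear (U : bop N N) s c T T' :
  opword B s ∘ (c *: T + T') ∘ U =
  c *: (opword B s ∘ T ∘ U) + (opword B s ∘ T' ∘ U).
Proof.
apply: bop_ext => x.
change (opword B s (c *: T (U x) + T' (U x)) =
  c *: opword B s (T (U x)) + opword B s (T' (U x))).
exact: bop_linear.
Qed.

Lemma Swstar_conj s T : S T -> S (opword B s ∘ T ∘ adj (opword B s)).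
Proof.
apply: (@Swstar_map (fun T => opword B s ∘ T ∘ adj (opword B s))) => [p|W gW].
  have [q qE] := weval_conj (adj (opword B s)) p.
  by exists q, 1, 0 => W; rewrite mul1r addr0 -qE adjK.
apply: Swstar_gen; elim/lspan_ind_bop: gW => [|c u v U gU IH].
  rewrite (_ : _ ∘ 0 ∘ _ = 0); first exact: lspan0.
  by apply: bop_ext => x; exact: bop0.
rewrite conjB_linear.
rewrite opword_catBB.
apply: lspanP; last exact: IH.
by apply: sub_lspan; exists (s ++ u), (s ++ v).
Qed.

Lemma cvg_Swstar (I : Type) (F : set_system I) (u : I -> S) (chi : S) : Filter F ->
  (fun i => (set_val (u i) : wstar N)) @ F --> (set_val chi : wstar N) -> u @ F --> chi.
Proof. by move=> FF h; apply: (@cvg_initial S (wstar N) set_val). Qed.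

Lemma set_val_cvg (chi : S) : (set_val : S -> wstar N) @ chi --> (set_val chi : wstar N).
Proof. exact: (@initial_continuous S (wstar N) set_val). Qed.

Definition Swstar_mk T (ST : S T) : S := exist _ T (mem_set ST).

Variable H : hilbertType R.

(** The two maps agree on the span of the generators, which is ultraweakly dense,
    and the functionals <. x, y> separate operators. *)
Lemma op_linear_ext (phi psi : S -> bop H H) :
  op_linear phi -> op_linear psi -> wstar_continuous phi -> wstar_continuous psi ->
  (forall s t, phi (SBB a m P s t) = psi (SBB a m P s t)) -> phi = psi.
Proof.
move=> phil psil phic psic gen.
have lin0 (f : S -> bop H H) (z : S) : op_linear f -> set_val z = 0 :> bop N N -> f z = 0.
  move=> fl z0; have := fl (-1) z z z; rewrite z0 scaler0 addr0 => /(_ erefl).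
  by rewrite scaleN1r addNr.
have span T : lspan gens T -> forall z : S, set_val z = T :> bop N N -> phi z = psi z.
  elim/lspan_ind_bop => [z z0|c s t U gU IH z zE]; first by rewrite !lin0.
  have e : set_val z = c *: (set_val (SBB a m P s t) : bop N N) + set_val (Swstar_mk (Swstar_gen gU)).
    exact: zE.
  rewrite (phil _ _ _ _ e) (psil _ _ _ _ e) gen; congr (_ + _).
  exact: IH.
apply/funext => chi; apply: bop_ext => x; apply: hdot_ext => y.
have [p pE] := rank1_exists x y; rewrite -!pE.
apply/eqP; rewrite -subr_eq0; set D := _ - _; apply: contraT => D0.
have e0 : 0 < `|D| / 2 by rewrite divr_gt0 // normr_gt0.
have FC := nbhs_filter chi.
have fc : weval (phi c) p - weval (psi c) p @[c --> chi] --> D.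
  have h1 := @wcvg_weval R H S _ phi (phi chi) p FC (phic chi).
  have h2 := @wcvg_weval R H S _ psi (psi chi) p FC (psic chi).
  exact: (@cvgB _ R[i] _ _ FC _ _ _ _ h1 h2).
have nb : nbhs chi [set c : S | `|D - (weval (phi c) p - weval (psi c) p)| <= `|D| / 2].
  exact: ((@cvgrPdist_le _ R[i] _ _ FC _ _).1 fc _ e0).
move: nb; rewrite nbhsE => -[V [[U oU UO] Vchi] sub].
have Uchi : nbhs (set_val chi : wstar N) U.
  by apply: open_nbhs_nbhs; split=> //; rewrite -UO in Vchi.
have [T [gT UT]] : (lspan gens `&` (U : set (wstar N))) !=set0.
  exact: (set_mem (svalP chi)) Uchi.
have Vz : V (Swstar_mk (Swstar_gen gT)) by rewrite -UO.
have /= := sub _ Vz; rewrite (span T gT) // subrr subr0.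
rewrite ler_pdivlMr // mulr_natr mulr2n gerDl normr_le0 => Dz.
by rewrite Dz in D0.
Qed.

End OperatorSystem.

(** * Completely positive maps give pure operators *)

Section CPMaps.
Variables (n : nat) (R : realType) (a : seq 'I_n -> R) (m : nat) (P : set (ncpoly R n)).
Hypothesis a_nil : a [::] = 0.
Hypothesis a_ge0 : forall u, 0 <= a u.
Hypothesis a_gt0 : forall i, 0 < a [:: i].
Hypothesis m_gt0 : (0 < m)%N.
Local Notation N := (NP a m P).
Local Notation S := (Swstar a m P).
Local Notation B := (Bmodel a m P).
Local Notation I := (bid N).

Lemma binc_shift i h t :
  binc N (adj (B i) h) t = (wratio a m i t)%:C *: (binc N h : fock n R[i]) (i :: t).
Proof. by rewrite scalerCE; exact: adj_Bmodel_coord. Qed.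

Lemma binc_isometry : adj (binc N) ∘ binc N = I.
Proof. by rewrite adj_binc; apply: bop_ext => x; exact: bproj_id. Qed.

Lemma Bmodel_row_bounded : row_bounded a B.
Proof. exact: (dilation_row_bounded a_nil a_ge0 a_gt0 m_gt0 binc_shift binc_isometry). Qed.

(** The inclusion of N_P into the Fock space is an isometry that intertwines the
    adjoints of the B_i and the W_i. *)
Lemma bid_Cpure : Cpure a m B I.
Proof.
have := dilation_Cpure a_nil a_ge0 a_gt0 m_gt0 binc_shift Bmodel_row_bounded.
by rewrite binc_isometry.
Qed.

Variables (H : hilbertType R) (A : 'I_n -> bop H H).
Hypothesis Ab : row_bounded a A.
Variable phi : S -> bop H H.
Hypothesis phiCP : CPwstar a m P A phi.
Local Notation D := (phi (Sid a m P)).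

(** phi as a relation between operators. Elements of the operator system carry
    membership proofs, which the relation hides. *)
Definition graph (T : bop N N) (Y : bop H H) : Prop :=
  exists2 chi : S, set_val chi = T :> bop N N & phi chi = Y.

Lemma graph_fun T Y Y' : graph T Y -> graph T Y' -> Y = Y'.
Proof.
move=> [x xT <-] [x' x'T <-]; congr phi; apply: val_inj.
exact: (etrans xT (esym x'T)).
Qed.

Lemma graph_lin c T Y T' Y' : graph T Y -> graph T' Y' -> graph (c *: T + T') (c *: Y + Y').
Proof.
move=> [x xT <-] [x' x'T <-].
have ST : S T by rewrite -xT; exact: (set_mem (svalP x)).
have ST' : S T' by rewrite -x'T; exact: (set_mem (svalP x')).
exists (Swstar_mk (Swstar_lin (c := c) ST ST')) => //; case: phiCP => phil _ _ _.
by apply: phil; rewrite xT x'T.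
Qed.

Lemma graph_bid : graph I D.
Proof. by exists (Sid a m P). Qed.

Lemma graph0 : graph 0 0.
Proof. by have := graph_lin (-1) graph_bid graph_bid; rewrite !scaleN1r !addNr. Qed.

Lemma graphB T Y T' Y' : graph T Y -> graph T' Y' -> graph (T - T') (Y - Y').
Proof. by move=> h h'; have := graph_lin (-1) h' h; rewrite !scaleN1r ![- _ + _]addrC. Qed.

Lemma graph_sum (J : Type) (r : seq J) (c : J -> R[i]) (F : J -> bop N N) (G : J -> bop H H) :
  (forall j, graph (F j) (G j)) ->
  graph (\sum_(j <- r) c j *: F j) (\sum_(j <- r) c j *: G j).
Proof.
move=> h; elim: r => [|j r IH]; first by rewrite !big_nil; exact: graph0.
by rewrite !big_cons; exact: graph_lin.
Qed.

Lemma graph_pos T Y : graph T Y -> bpos T -> bpos Y.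
Proof.
move=> [x xT <-] Tp h; case: phiCP => _ cp _ _.
have := cp 1%N (fun _ _ => x); rewrite xT => /(_ _ (fun=> h)).
rewrite !big_ord1; apply=> z; rewrite !big_ord1; exact: Tp.
Qed.

(** The operator system is ultraweakly closed and phi is ultraweakly continuous,
    while bounded weakly convergent sequences converge ultraweakly. *)
Lemma graph_wcvg (T : nat -> bop N N) (Y : nat -> bop H H) T' (C : R) : 0 <= C ->
  (forall k, graph (T k) (Y k)) ->
  (forall k x y, `|hdot (T k x) y| <= C%:C * (`|x| * `|y|)) ->
  wot_cvg T T' -> exists2 Y', graph T' Y' & wot_cvg Y Y'.
Proof.
move=> C0 g TC TT'.
have Tc := wot_bounded_wcvg C0 TC TT'.
have h k : exists x : S, set_val x = T k :> bop N N /\ phi x = Y k.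
  by have [x xT xY] := g k; exists x.
have [u uP] := choice h.
have ST k : S (T k) by have [<- _] := uP k; exact: (set_mem (svalP (u k))).
have ST' : S T'.
  apply: (@closed_cvg nat (wstar N) \oo _ T S _ _ T' Tc); first exact: closed_closure.
  exact: nearW.
exists (phi (Swstar_mk ST')); first by exists (Swstar_mk ST').
have uc : u @ \oo --> Swstar_mk ST'.
  apply: cvg_Swstar; rewrite -[X in _ --> X]/(T' : wstar N).
  by rewrite (_ : (fun i => _) = T) //; apply/funext => k; have [-> _] := uP k.
have pc : (fun k => phi (u k) : wstar H) @ \oo --> (phi (Swstar_mk ST') : wstar H).
  case: phiCP => _ _ phic _.
  exact: (@continuous_cvg nat S (wstar H) \oo _ u phi (Swstar_mk ST') (phic (Swstar_mk ST')) uc).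
move=> x y; have [p pE] := rank1_exists x y.
have w : weval (phi (u k)) p @[k --> \oo] --> weval (phi (Swstar_mk ST')) p.
  exact: (@wcvg_weval R H nat \oo (fun k => phi (u k)) (phi (Swstar_mk ST')) p _ pc).
have e : (fun k => weval (phi (u k)) p) = (fun k => hdot (Y k x) y).
  by apply/funext => k; rewrite pE; have [_ ->] := uP k.
by rewrite pE e in w.
Qed.

Lemma Swstar_val (chi : S) : S (set_val chi).
Proof. exact: (set_mem (svalP chi)). Qed.

(** Both phi(B_s chi adj(B_s)) and A_s phi(chi) adj(A_s) are linear and
    ultraweakly continuous in chi, and on the generators they agree by the
    defining relation of phi. *)
Lemma graph_conj s T Y : graph T Y ->
  graph (opword B s ∘ T ∘ adj (opword B s)) (opword A s ∘ Y ∘ adj (opword A s)).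
Proof.
case: phiCP => phil _ phic phig.
pose cS chi : S := Swstar_mk (Swstar_conj (s := s) (@Swstar_val chi)).
have cSE chi : set_val (cS chi) = opword B s ∘ set_val chi ∘ adj (opword B s) :> bop N N by [].
suff E : (phi \o cS : S -> bop H H) = (fun chi => opword A s ∘ phi chi ∘ adj (opword A s)).
  move=> [chi <- <-]; exists (cS chi); first exact: cSE.
  exact: (congr1 (fun f => f chi) E).
apply: op_linear_ext.
- by move=> c x y z zE; apply: phil; rewrite !cSE zE conjB_linear.
- move=> c x y z zE; rewrite (phil _ _ _ _ zE); apply: bop_ext => h.
  exact: bop_linear.
- move=> chi; have FC := nbhs_filter chi.
  have c1 : cS @ chi --> cS chi.
    apply: cvg_Swstar; apply: cvg_wstar => p.
    have [q qE] := weval_conj (adj (opword B s)) p; rewrite adjK in qE.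
    rewrite (_ : (fun i => _) = fun i : S => weval (set_val i) q); last first.
      by apply/funext => i; rewrite cSE qE.
    rewrite cSE qE; exact: (@wcvg_weval R N S _ set_val (set_val chi) q FC (@set_val_cvg _ _ _ _ _ chi)).
  exact: (@continuous_cvg S S (wstar H) _ FC cS phi (cS chi) (phic (cS chi)) c1).
- move=> chi; have FC := nbhs_filter chi.
  apply: (@cvg_wstar R H S _ _ (opword A s ∘ phi chi ∘ adj (opword A s)) FC) => p.
  have [q qE] := weval_conj (adj (opword A s)) p; rewrite adjK in qE.
  rewrite (_ : (fun i => _) = fun i : S => weval (phi i) q); last first.
    by apply/funext => i; rewrite qE.
  rewrite qE; exact: (@wcvg_weval R H S _ phi (phi chi) q FC (phic chi)).
- move=> u v; rewrite phig /=.
  have -> : cS (SBB a m P u v) = SBB a m P (s ++ u) (s ++ v).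
    apply: val_inj; exact: opword_catBB.
  rewrite phig !opword_cat adj_comp; exact: bop_ext.
Qed.

(** phi carries partial sums to partial sums by [graph_conj]; those of Phi_B(T)
    are uniformly bounded, so that [graph_wcvg] gives the limit. *)
Lemma graph_Phi T Y : graph T Y -> graph (Phi a B T) (Phi a A Y).
Proof.
move=> TY; have [L L0 TL] := Phi_part_bound a_nil a_ge0 Bmodel_row_bounded T.
have part k : graph (Phi_part a B T k) (Phi_part a A Y k).
  rewrite /Phi_part; have h (j : nat) : graph
      (\sum_(s : j.-tuple 'I_n) (a s)%:C *: (opword B s ∘ T ∘ adj (opword B s)))
      (\sum_(s : j.-tuple 'I_n) (a s)%:C *: (opword A s ∘ Y ∘ adj (opword A s))).
    by apply: graph_sum => s; exact: graph_conj.
  have := graph_sum (index_iota 1 k) (fun=> 1) h.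
  by under eq_bigr do rewrite scale1r; under [X in graph _ X]eq_bigr do rewrite scale1r.
have [Y' TY' YY'] := graph_wcvg L0 part TL (@Phi_wot _ _ _ a_nil a_ge0 _ _ Bmodel_row_bounded T).
suff -> : Phi a A Y = Y' by [].
apply: bop_ext => x; apply: hdot_ext => y.
exact: (cvg_uniq (@Phi_wot _ _ _ a_nil a_ge0 _ _ Ab Y x y) (YY' x y)).
Qed.

Lemma graph_idPhi s : graph (idPhi a B s I) (idPhi a A s D).
Proof.
elim: s => [|s IH]; first exact: graph_bid.
by rewrite !idPhiS; apply: graphB => //; exact: graph_Phi.
Qed.

Lemma graph_iter k : graph (iter k (Phi a B) I) (iter k (Phi a A) D).
Proof. by elim: k => [|k IH]; [exact: graph_bid|exact: graph_Phi]. Qed.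

(** phi carries (id - Phi_B)^s(I) and Phi_B^k(I) to (id - Phi_A)^s(D) and
    Phi_A^k(D). The former are positive, and the bounded sequence Phi_B^k(I)
    tends weakly to 0, hence so does Phi_A^k(D); its terms being positive and
    bounded, it converges strongly. *)
Lemma CP_Cpure : Cpure a m A D.
Proof.
have [Ip I0] := bid_Cpure; split=> [s sm|].
  exact: graph_pos (graph_idPhi s) (Ip s sm).
have Ipos : bpos I by move=> x; exact: hdot_ge0.
have Bp k : bpos (iter k (Phi a B) I) by apply: iter_Phi_pos => //; exact: Bmodel_row_bounded.
have D1 : bpos (I - Phi a B I) by apply: (Ip 1%N); rewrite m_gt0.
have Ble k : bpos (I - iter k (Phi a B) I).
  apply: (bpos_sub Ipos (Bp k)) => h; rewrite -subr_ge0.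
  rewrite (telescope_qform a_nil a_ge0 Bmodel_row_bounded k h D1).
  by apply: sumr_ge0 => j _; apply: qform_ge0; apply: iter_Phi_pos => //; exact: Bmodel_row_bounded.
have Dp k : bpos (iter k (Phi a A) D) by apply: graph_pos (graph_iter k) (Bp k).
have [M M0 DM] := bop_qform_bound D.
apply: (bpos_sot0 (ltW M0) Dp) => [k h|h].
  apply: le_trans (DM h); rewrite -subr_ge0 -qform_sub; apply: qform_ge0.
  exact: graph_pos (graphB graph_bid (graph_iter k)) (Ble k).
have bnd k x y : `|hdot (iter k (Phi a B) I x) y| <= 1%:C * (`|x| * `|y|).
  rewrite mul1r; apply: le_trans (hdot_le _ _) _; rewrite ler_wpM2r //.
  have Ik z : hdot (iter k (Phi a B) I z) z <= `|z| ^+ 2.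
    by have := Ble k z; rewrite bop_subE hdotBl subr_ge0 hdot_norm.
  exact: (bpos_bound (Bp k) Ik).
have w0 : wot_cvg (fun k => iter k (Phi a B) I) 0.
  by move=> x y; apply: cvg_hdotl; exact: I0.
have [Y' Y'0 YY'] := graph_wcvg ler01 graph_iter bnd w0.
have := YY' h h; rewrite (graph_fun Y'0 graph0).
by rewrite bop_0E hdot0l.
Qed.

End CPMaps.

(** * Compressions of ampliations are completely positive *)

Section CompressionMap.
Variables (n : nat) (R : realType) (a : seq 'I_n -> R) (m : nat) (P : set (ncpoly R n)).
Local Notation N := (NP a m P).
Local Notation S := (Swstar a m P).
Local Notation B := (Bmodel a m P).
Variables (H E : hilbertType R) (V : bop H (stens N E)).
Local Notation ampl T := (btens (@selem n R N E) (@selem n R N E) T).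

Definition compression (chi : bop N N) : bop H H := adj V ∘ ampl chi ∘ V.

Lemma hdot_compression chi x y : hdot (compression chi x) y = hdot (ampl chi (V x)) (V y).
Proof. by rewrite -[compression chi x]/(adj V (ampl chi (V x))) -adjPr. Qed.

Lemma compression_bid : compression (bid N) = adj V ∘ V.
Proof.
rewrite /compression btens_id; [|exact: selem_dot|exact: selem_total].
exact: bop_ext.
Qed.

Lemma compression_linear c T T' : compression (c *: T + T') = c *: compression T + compression T'.
Proof.
rewrite /compression btens_lin; [|exact: selem_lin|exact: selem_dot|exact: selem_dot|exact: selem_total].
apply: bop_ext => x.
change (adj V (c *: ampl T (V x) + ampl T' (V x)) =
  c *: adj V (ampl T (V x)) + adj V (ampl T' (V x))).
exact: bop_linear.
Qed.

Lemma scoef_sq_summable (eps : nat -> E) (x : nat -> H) : orthonormal0 eps -> sq_summable x ->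
  exists M : R[i], forall K J,
    \sum_(k < K) \sum_(j < J) `|scoef N (eps j) (V (x k))| ^+ 2 <= M.
Proof.
move=> eO /(sq_summable_bop V)[M xM]; exists M => K J; apply: le_trans (xM K).
by apply: ler_sum => k _; exact: scoef_bessel.
Qed.

Lemma sq_summable_unpair (F : hilbertType R) (f : nat -> nat -> F) M :
  (forall K J, \sum_(k < K) \sum_(j < J) `|f k j| ^+ 2 <= M) -> sq_summable (unpair f).
Proof.
move=> fM; exists M => I.
have h k j : 0 <= `|f k j| ^+ 2 :> R[i] by rewrite exprn_ge0.
have := unpair_le h fM I; apply: le_trans; apply: ler_sum => i _.
rewrite /unpair; case: (pickle_inv i) => [[k j]|] //=.
by rewrite normr0 expr0n.
Qed.

(** Expanding all V x_k and V y_k along one family in E turns the functional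
    given by (x_k), (y_k) into a double series of terms <chi z_kj, w_kj>, which
    is again a functional of this kind once the pairs are enumerated. *)
Lemma weval_compression (p : sq_pair H) :
  exists q : sq_pair N, forall T, weval (compression T) p = weval T q.
Proof.
have [px py] := svalP p; set x := (sval p).1 in px *; set y := (sval p).2 in py *.
have [eps eO wc] := gram_schmidt_expansion (fun k => val (V (y k)) : fock n E).
pose z k j : N := scoef N (eps j) (V (x k)); pose w k j : N := scoef N (eps j) (V (y k)).
have [Mx xM] := scoef_sq_summable eO px; have [My yM] := scoef_sq_summable eO py.
have zs : sq_summable (unpair z) by exact: (@sq_summable_unpair N z _ xM).
have ws : sq_summable (unpair w) by exact: (@sq_summable_unpair N w _ yM).
exists (exist _ (unpair z, unpair w) (conj zs ws)) => T.
have [C C0 TC] := bop_bounded T; have C1 : 0 <= C%:C :> R[i] by rewrite ler0c ltW.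
pose f k j : R[i] := hdot (T (z k j)) (w k j).
pose G k j : R[i] := C%:C * (`|z k j| ^+ 2 + `|w k j| ^+ 2).
have fG k j : `|f k j| <= G k j.
  apply: le_trans (hdot_le _ _) _; rewrite /G.
  apply: (@le_trans _ _ (C%:C * (`|z k j| * `|w k j|))); first by rewrite mulrA ler_wpM2r.
  by rewrite ler_wpM2l // mul_le_sq.
have GM K J : \sum_(k < K) \sum_(j < J) G k j <= C%:C * (Mx + My).
  under eq_bigr do rewrite -mulr_sumr big_split /=.
  rewrite -mulr_sumr big_split ler_wpM2l // lerD //; [exact: xM|exact: yM].
have fr k : \sum_(j < J) f k j @[J --> \oo] --> hdot (compression T (x k)) (y k).
  rewrite hdot_compression; exact: (@btens_expansion n R E N T eps (V (x k)) (V (y k)) (wc k)).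
have [L L1 L2] := double_series fG GM fr.
have -> : weval (compression T) p = L by apply: cvg_lim L2; exact: (@norm_hausdorff _ R[i]).
symmetry; apply: cvg_lim; first exact: (@norm_hausdorff _ R[i]).
rewrite (_ : (fun k => _) = unpair f); first exact: L1.
apply/funext => i /=; rewrite /unpair; case: (pickle_inv i) => [[k j]|] //=.
by rewrite bop0 hdot0l.
Qed.

(** Expand all V h_i along one family in E. The form of the compressed matrix at h
    is then a sum of values of the form of T, one for each index of the
    expansion. *)
Lemma compression_cp (k : nat) (T : 'I_k -> 'I_k -> bop N N) :
  (forall x : 'I_k -> N, 0 <= \sum_i \sum_j hdot (T i j (x j)) (x i)) ->
  forall h : 'I_k -> H, 0 <= \sum_i \sum_j hdot (compression (T i j) (h j)) (h i).
Proof.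
move=> Tp h.
(* the finitely many V h_i, padded with zeros to a sequence *)
pose zz (l : nat) : fock n E := if insub l is Some i then val (V (h i)) else 0.
have [eps eO zc] := gram_schmidt_expansion zz.
have zE (i : 'I_k) : zz i = val (V (h i)) by rewrite /zz valK.
pose u i j (J : nat) : R[i] :=
  \sum_(l < J) hdot (T i j (scoef N (eps l) (V (h j)))) (scoef N (eps l) (V (h i))).
have uc i j : u i j @ \oo --> hdot (compression (T i j) (h j)) (h i).
  rewrite hdot_compression; apply: btens_expansion; rewrite -zE; exact: zc.
pose v i J : R[i] := \sum_j u i j J.
have vc i : v i @ \oo --> (\sum_j hdot (compression (T i j) (h j)) (h i) : R[i]).
  exact: (cvgC_bigsum (uc i) (fun J => erefl) erefl).
have sc : (fun J => \sum_i v i J : R[i]) @ \oo -->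
    (\sum_i \sum_j hdot (compression (T i j) (h j)) (h i) : R[i]).
  exact: (cvgC_bigsum vc (fun J => erefl) erefl).
apply: cvgC_ge sc; apply: nearW => J.
rewrite /v /u; under eq_bigr do rewrite exchange_big /=.
rewrite exchange_big; apply: sumr_ge0 => l _.
exact: (Tp (fun i => scoef N (eps l) (V (h i)))).
Qed.

Variable A : 'I_n -> bop H H.
Hypothesis VA : forall i, V ∘ adj (A i) = ampl (adj (B i)) ∘ V.

Lemma intertwine_opword s : V ∘ adj (opword A s) = ampl (adj (opword B s)) ∘ V.
Proof.
have sd := @selem_dot n R N E; have st := @selem_total n R N E.
elim: s => [|i s IH].
  by rewrite /= !adj_id btens_id //; apply: bop_ext.
rewrite /= (adj_comp (A i)) (adj_comp (B i)) (btens_comp _ _ sd sd sd st st); apply: bop_ext => h.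
change (V (adj (opword A s) (adj (A i) h)) = ampl (adj (opword B s)) (ampl (adj (B i)) (V h))).
rewrite -[LHS]/((V ∘ adj (opword A s)) (adj (A i) h)) IH.
exact: (congr1 (fun W : bop H (stens N E) => ampl (adj (opword B s)) (W h)) (VA i)).
Qed.

Lemma compression_CP : CPwstar a m P A (fun chi : S => compression (set_val chi)).
Proof.
have sd := @selem_dot n R N E; have st := @selem_total n R N E.
split.
- by move=> c x y z zE; rewrite zE compression_linear.
- by move=> k T Tp h; exact: (compression_cp Tp h).
- move=> chi; have FC := nbhs_filter chi.
  apply: (@cvg_wstar R H S _ _ (compression (set_val chi)) FC) => p.
  have [q qE] := weval_compression p.
  rewrite (_ : (fun i => _) = fun i : S => weval (set_val i) q); last first.
    by apply/funext => i; rewrite qE.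
  rewrite qE; exact: (@wcvg_weval R N S _ set_val (set_val chi) q FC (@set_val_cvg _ _ _ _ _ chi)).
- move=> s t; rewrite [X in _ ∘ X ∘ _]compression_bid.
  apply: bop_ext => h; apply: hdot_ext => k; rewrite hdot_compression.
  rewrite -[RHS]/(hdot (opword A s (adj V (V (adj (opword A t) h)))) k).
  rewrite [RHS]adjP -[RHS]adjPr.
  rewrite -[V (adj (opword A t) h)]/((V ∘ adj (opword A t)) h).
  rewrite -[V (adj (opword A s) k)]/((V ∘ adj (opword A s)) k) !intertwine_opword.
  rewrite -[set_val (SBB a m P s t)]/(opword B s ∘ adj (opword B t)).
  rewrite (btens_comp _ _ sd sd sd st st).
  change (hdot (ampl (opword B s) (ampl (adj (opword B t)) (V h))) (V k) =
    hdot (ampl (adj (opword B t)) (V h)) (ampl (adj (opword B s)) (V k))).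
  by rewrite [LHS]adjP btens_adj.
Qed.

End CompressionMap.

Theorem theorem2p2 (R : realType) (n m : nat) (a : seq 'I_n -> R)
    (P : set (ncpoly R n)) (H : hilbertType R) (A : 'I_n -> bop H H) :
  (0 < n)%N -> (0 < m)%N ->
  positive_regular a ->
  cset (NP a m P) <> [set 0] ->
  (exists T, sot_cvg (Phi_part a A (bid H)) T) ->
  (forall p, P p -> nceval p A = 0) ->
  [/\ set_bij (CPwstar a m P A) (Cpure a m A) (Gamma a m P),
      (forall D, Cpure a m A D ->
         forall phi, CPwstar a m P A phi -> Gamma a m P phi = D ->
         forall chi : Swstar a m P,
           phi chi = berezin a m P A (idPhi a A m D) (set_val chi)) &
      forall D : bop H H, Cpure a m A D <->
        exists (E : hilbertType R) (K : bop H (stens (NP a m P) E)),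
          D = adj K ∘ K /\
          forall i, K ∘ adj (A i) =
            btens (@selem n R (NP a m P) E) (@selem n R (NP a m P) E)
              (adj (Bmodel a m P i)) ∘ K].
Proof.
move=> _ m0 [_ a_ge0 a_nil a_gt0] _ [T0 AT] A0.
have Ab := sot_row_bounded a_nil a_ge0 AT.
have bzCP D : Cpure a m A D -> CPwstar a m P A
    (fun chi : Swstar a m P => berezin a m P A (idPhi a A m D) (set_val chi)).
  move=> DC; apply: compression_CP => i.
  exact: (Kq_intertwine a_nil a_ge0 a_gt0 m0 Ab DC A0).
have bzD D : Cpure a m A D -> berezin a m P A (idPhi a A m D) (bid (NP a m P)) = D.
  by move=> DC; rewrite [LHS]compression_bid; exact: (Kq_sq a_nil a_ge0 a_gt0 m0 Ab DC A0).
have inj phi psi : CPwstar a m P A phi -> CPwstar a m P A psi ->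
    Gamma a m P phi = Gamma a m P psi -> phi = psi.
  move=> [l1 _ c1 g1] [l2 _ c2 g2] e; apply: op_linear_ext => // s t.
  by rewrite g1 g2 -[phi (Sid a m P)]/(Gamma a m P phi) e.
split.
- split.
  + by move=> phi phiCP; exact: (CP_Cpure a_nil a_ge0 a_gt0 m0 Ab phiCP).
  + by move=> phi psi /set_mem p1 /set_mem p2; exact: inj.
  + move=> D DC; exists (fun chi : Swstar a m P => berezin a m P A (idPhi a A m D) (set_val chi)).
      exact: bzCP.
    exact: bzD.
- move=> D DC phi phiCP phiD chi.
  suff -> : phi = (fun chi : Swstar a m P => berezin a m P A (idPhi a A m D) (set_val chi)) by [].
  by apply: inj => //; [exact: bzCP|rewrite phiD; symmetry; exact: bzD].
- move=> D; split=> [DC|[E [K [-> KA]]]].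
    exists (branc (bsqrt (idPhi a A m D))), (Kq a m P A (idPhi a A m D)); split.
      by symmetry; exact: (Kq_sq a_nil a_ge0 a_gt0 m0 Ab DC A0).
    exact: (Kq_intertwine a_nil a_ge0 a_gt0 m0 Ab DC A0).
  (* K as a map into the whole of F2 (x) E *)
  pose K' := binc (stens (NP a m P) E) ∘ K.
  have -> : adj K ∘ K = adj K' ∘ K'.
    apply: bop_quad_ext => h.
    change (hdot (adj K (K h)) h = hdot (adj K' (K' h)) h).
    by rewrite -!adjPr.
  apply: (dilation_Cpure a_nil a_ge0 a_gt0 m0 _ Ab) => i h t.
  rewrite -[K' (adj (A i) h)]/(val ((K ∘ adj (A i)) h)) KA.
  exact: btensB_coord.
Qed.
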